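(* Let $\varphi$ be an analytic self-map of $\mathbb{D}$ and let $n$ be a positive integer. The operator $D_{\varphi,n}$ is bounded on $H^{2}$ if and only if \[ N_{\varphi}(w)=O\Big(\big[\log(1/|w|)\big]^{2n+1}\Big)\qquad (|w|\to 1). \]
   Context: $\mathbb{D}$ is the open unit disk in $\mathbb{C}$ and $H^2$ is the Hardy space of analytic functions $f$ on $\mathbb{D}$ with $\|f\|^2=\lim_{r\to1}\frac{1}{2\pi}\int_0^{2\pi}|f(re^{i\theta})|^2\,d\theta<\infty$. For an analytic self-map $\varphi$ of $\mathbb{D}$ and a positive integer $n$, $D_{\varphi,n}$ is the operator $D_{\varphi,n}f=f^{(n)}\circ\varphi$ (composition operator $C_\varphi$ following $n$-th order differentiation). The Nevanlinna counting function is $N_{\varphi}(w)=\sum_{z\in\mathbb{D},\,\varphi(z)=w}\log(1/|z|)$ for $w\in\mathbb{D}\setminus\{\varphi(0)\}$ (multiplicities counted; $N_\varphi(w)=0$ if $w\notin\varphi(\mathbb{D})$), and $N_\varphi(\varphi(0))=\infty$. *)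

(* Defs.v *)
From Stdlib Require Import Reals Lra List ClassicalEpsilon.
From Coquelicot Require Import Coquelicot.
Open Scope R_scope.

Definition inD (z : C) : Prop := Cmod z < 1.

Definition holomorphic_on_D (f : C -> C) : Prop :=
  forall z : C, inD z -> exists l : C, is_derive f z l.

(* The complex derivative (meaningful wherever it exists; derivatives are unique). *)
Definition Cderiv (f : C -> C) (z : C) : C :=
  epsilon (inhabits (RtoC 0)) (fun l : C => is_derive f z l).

Fixpoint Cderiv_n (k : nat) (f : C -> C) : C -> C :=
  match k with
  | O => f
  | S k' => Cderiv (Cderiv_n k' f)
  end.

Definition mean2 (f : C -> C) (r : R) : R :=
  RInt (fun t : R => (Cmod (f (r * cos t, r * sin t)%R)) ^ 2) 0 (2 * PI) / (2 * PI).

Definition H2_norm2 (f : C -> C) (L : R) : Prop :=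
  holomorphic_on_D f /\ filterlim (mean2 f) (at_left 1) (locally L).

Definition in_H2 (f : C -> C) : Prop := exists L : R, H2_norm2 f L.

Definition self_map_D (phi : C -> C) : Prop :=
  holomorphic_on_D phi /\ forall z : C, inD z -> inD (phi z).

Definition Dphin (phi : C -> C) (n : nat) (f : C -> C) : C -> C :=
  fun z => Cderiv_n n f (phi z).

Definition bounded_on_H2 (phi : C -> C) (n : nat) : Prop :=
  exists K : R, forall (f : C -> C) (L : R), H2_norm2 f L ->
    exists L' : R, H2_norm2 (Dphin phi n f) L' /\ L' <= K * L.

(* m is the multiplicity of z as a w-point of phi (phi z = w): the order of
   the zero of phi - w at z. *)
Definition is_mult (phi : C -> C) (z : C) (m : nat) : Prop :=
  (1 <= m)%nat /\
  (forall k : nat, (1 <= k)%nat -> (k < m)%nat -> Cderiv_n k phi z = RtoC 0) /\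
  Cderiv_n m phi z <> RtoC 0.

Definition wsum (l : list (C * nat)) : R :=
  fold_right (fun p acc => INR (snd p) * ln (/ Cmod (fst p)) + acc) 0 l.

Definition N_partial (phi : C -> C) (w : C) (s : R) : Prop :=
  exists l : list (C * nat),
    NoDup (map fst l) /\
    (forall p, In p l -> inD (fst p) /\ phi (fst p) = w /\ is_mult phi (fst p) (snd p)) /\
    s = wsum l.

(* Nevanlinna counting function N_phi(w) = sum over z in D with phi z = w
   (with multiplicity) of log(1/|z|), as an (unordered, nonnegative) sum in
   [0, +oo]; N_phi(phi 0) = +oo by convention. *)
Definition Nevanlinna (phi : C -> C) (w : C) : Rbar :=
  match Req_EM_T (fst w) (fst (phi (RtoC 0))), Req_EM_T (snd w) (snd (phi (RtoC 0))) with
  | left _, left _ => p_infty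
  | _, _ => Lub_Rbar (N_partial phi w)
  end.

Definition N_bigO (phi : C -> C) (n : nat) : Prop :=
  exists K delta : R, 0 <= delta < 1 /\
    forall w : C, delta < Cmod w < 1 ->
      Rbar_le (Nevanlinna phi w) (Finite (K * (ln (/ Cmod w)) ^ (2 * n + 1))).

(* Main.v *)
(* Necessity. Testing on the Szego kernels f_w(z) = 1/(1 - conj(w) z) bounds the mean of
   |1 - conj(w) phi|^{-2(n+1)} by a multiple of 1/(1-|w|^2). The function
   F = 1 - ((1-|w|^2)/(1 - conj(w) phi))^{2n+2} vanishes at every w-point of phi, so Jensen's
   inequality in the form |F(0)| prod(r/|z_j|) <= mean |F| <= 1 + O((1-|w|)^{2n+1}) bounds N_phi(w).

   Sufficiency. For |xi| = 1 put G = 4e/(1 - conj(xi) phi). Cartan's identity expresses the mean of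
   log^+|G| through the counting functions at the values of phi on the circle of radius 4e about
   xi, so that this mean is O(e^{2n+1}): the pull-back of arc length by phi is a Carleson measure of
   order 2n+1. Summing over dyadic distances to the circle, a sub-mean value estimate for
   f^(n) with a high power of the Szego kernel and Parseval's identity give the bound on H^2.

   Holomorphy only means complex differentiability, so everything rests on Goursat's theorem: in
   the logarithmic coordinate z = exp(w), for a rectangle it says that the means over two
   concentric circles agree. *)

Require Import Defs.
From Stdlib Require Import Reals Lra Lia List Factorial ClassicalEpsilon Classical.
From Coquelicot Require Import Coquelicot.
Open Scope R_scope.

(** Area integrals are avoided: each mean is a Riemann integral of a continuous function over a
    circle, and this shapes both directions. Since ln|F| is singular at zeros, Jensen's inequality
    is used for |F| itself, and Cartan's identity for ln(|G - u| + k^2), where k is made small only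
    at the end.

    The power 2n+2 in F is dictated by the test function: |(1-|w|^2)/(1 - conj(w) phi)|^(2n+2) is a
    constant multiple of the squared modulus of its image under the operator. With e = 1-|w|^2 the
    mean of that power is at most a multiple of e^(2n+2)/e, whence the exponent 2n+1.

    Conversely, the logarithmic mean at scale e only sees points mapped within 2e of xi. The tail is
    absorbed by comparing kernels at the scales e and 2e: with kernel power 2(2n+1), passing to e
    multiplies the tail by at most (4/9)^(2n+1), which beats the factor 2^(2n+1) lost in the bound.
    What is left is a dyadic Littlewood-Paley sum for f^(n), estimated one Taylor coefficient at a
    time. *)

Notation cder f z l := (@is_derive C_AbsRing C_NormedModule f z l).

(** * Limits of complex-valued functions along filters *)

Lemma Cmod_tri_minus (x y z : C) : Cmod (x - z) <= Cmod (x - y) + Cmod (y - z).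
Proof.
  replace (x - z)%C with ((x - y) + (y - z))%C by ring. apply Cmod_triangle.
Qed.

Lemma Cmod_sym (x y : C) : Cmod (x - y) = Cmod (y - x).
Proof. replace (x - y)%C with (- (y - x))%C by ring. apply Cmod_opp. Qed.

Lemma Cmod_lower (x y : C) : Cmod x - Cmod y <= Cmod (x - y).
Proof.
  assert (H := Cmod_triangle (x - y) y).
  replace (x - y + y)%C with x in H by ring. lra.
Qed.

Lemma pow_le_one (x : R) (n : nat) : 0 <= x <= 1 -> x ^ n <= 1.
Proof. intros H. rewrite <- (pow1 n). now apply pow_incr. Qed.

(** Closeness is measured by [Cmod] directly. [C] carries two uniform structures, the product one on
    pairs and the one given by the modulus; this form commits to neither and serves real, complex
    and two-variable arguments alike. *)
Definition clim {T} (F : (T -> Prop) -> Prop) (h : T -> C) (l : C) : Prop :=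
  forall eps : R, 0 < eps -> F (fun x => Cmod (h x - l) < eps).

Definition cnhds (z : C) : (C -> Prop) -> Prop :=
  fun P => exists d : R, 0 < d /\ forall y, Cmod (y - z) < d -> P y.

Global Instance cnhds_filter (z : C) : Filter (cnhds z).
Proof.
  constructor.
  - exists 1. split; [lra | auto].
  - intros P Q [d [Hd HP]] [e [He HQ]]. exists (Rmin d e). split.
    + now apply Rmin_pos.
    + intros y Hy. split.
      * apply HP. eapply Rlt_le_trans; [exact Hy | apply Rmin_l].
      * apply HQ. eapply Rlt_le_trans; [exact Hy | apply Rmin_r].
  - intros P Q H [d [Hd HP]]. exists d. split; [exact Hd | auto].
Qed.

Section Clim.
Context {T : Type} {F : (T -> Prop) -> Prop} {FF : Filter F}.

Lemma clim_const (c : C) : clim F (fun _ => c) c.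
Proof.
  intros eps He. apply filter_forall. intros _.
  replace (c - c)%C with (RtoC 0) by ring. now rewrite Cmod_0.
Qed.

Lemma clim_plus (h k : T -> C) (l m : C) :
  clim F h l -> clim F k m -> clim F (fun x => h x + k x)%C (l + m)%C.
Proof.
  intros H K eps He.
  generalize (filter_and (F := F) _ _ (H (eps / 2) ltac:(lra)) (K (eps / 2) ltac:(lra))).
  apply filter_imp. intros x [A B].
  replace (h x + k x - (l + m))%C with ((h x - l) + (k x - m))%C by ring.
  eapply Rle_lt_trans; [apply Cmod_triangle | lra].
Qed.

Lemma clim_opp (h : T -> C) (l : C) : clim F h l -> clim F (fun x => - h x)%C (- l)%C.
Proof.
  intros H eps He. generalize (H eps He). apply filter_imp. intros x A.
  replace (- h x - - l)%C with (- (h x - l))%C by ring. now rewrite Cmod_opp.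
Qed.

Lemma clim_minus (h k : T -> C) (l m : C) :
  clim F h l -> clim F k m -> clim F (fun x => h x - k x)%C (l - m)%C.
Proof. intros H K. apply clim_plus; [exact H | now apply clim_opp]. Qed.

Lemma clim_mult (h k : T -> C) (l m : C) :
  clim F h l -> clim F k m -> clim F (fun x => h x * k x)%C (l * m)%C.
Proof.
  intros H K eps He.
  assert (Hl := Cmod_ge_0 l). assert (Hm := Cmod_ge_0 m).
  set (d := Rmin 1 (eps / (Cmod l + Cmod m + 1) / 2)).
  assert (He' : 0 < eps / (Cmod l + Cmod m + 1))
    by (apply Rdiv_lt_0_compat; lra).
  assert (Hd : 0 < d) by (apply Rmin_pos; lra).
  assert (Hd1 : d <= 1) by apply Rmin_l.
  assert (Hd2 : d <= eps / (Cmod l + Cmod m + 1) / 2) by apply Rmin_r.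
  generalize (filter_and (F := F) _ _ (H d Hd) (K d Hd)).
  apply filter_imp. intros x [A B].
  replace (h x * k x - l * m)%C
    with ((h x - l) * (k x - m) + ((h x - l) * m + l * (k x - m)))%C by ring.
  eapply Rle_lt_trans; [apply Cmod_triangle |].
  assert (A2 := Cmod_triangle ((h x - l) * m) (l * (k x - m))).
  rewrite !Cmod_mult in *.
  assert (P1 := Cmod_ge_0 (h x - l)). assert (P2 := Cmod_ge_0 (k x - m)).
  assert (Q1 : Cmod (h x - l) * Cmod (k x - m) <= d * 1)
    by (apply Rmult_le_compat; lra).
  assert (Q2 : Cmod (h x - l) * Cmod m <= d * Cmod m)
    by (apply Rmult_le_compat_r; lra).
  assert (Q3 : Cmod l * Cmod (k x - m) <= Cmod l * d)
    by (apply Rmult_le_compat_l; lra).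
  assert (Q4 : d * (Cmod l + Cmod m + 1) <= eps / 2).
  { apply Rle_trans with (eps / (Cmod l + Cmod m + 1) / 2 * (Cmod l + Cmod m + 1)).
    - apply Rmult_le_compat_r; lra.
    - apply Req_le. field. lra. }
  lra.
Qed.

Lemma clim_inv (h : T -> C) (l : C) :
  l <> 0 -> clim F h l -> clim F (fun x => / h x)%C (/ l)%C.
Proof.
  intros Hl H eps He.
  assert (L : 0 < Cmod l) by now apply Cmod_gt_0.
  set (d := Rmin (Cmod l / 2) (eps * (Cmod l * Cmod l) / 2)).
  assert (LL : 0 < Cmod l * Cmod l) by now apply Rmult_lt_0_compat.
  assert (E1 : 0 < eps * (Cmod l * Cmod l)) by now apply Rmult_lt_0_compat.
  assert (Hd : 0 < d) by (apply Rmin_pos; lra).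
  generalize (H d Hd). apply filter_imp. intros x A.
  assert (A1 : Cmod (h x - l) < Cmod l / 2)
    by (eapply Rlt_le_trans; [exact A | apply Rmin_l]).
  assert (A2 : Cmod (h x - l) < eps * (Cmod l * Cmod l) / 2)
    by (eapply Rlt_le_trans; [exact A | apply Rmin_r]).
  assert (B : Cmod l / 2 < Cmod (h x)).
  { assert (B := Cmod_lower l (l - h x)).
    replace (l - (l - h x))%C with (h x) in B by ring.
    rewrite (Cmod_sym l (h x)) in B. lra. }
  assert (N : h x <> 0) by (apply Cmod_gt_0; lra).
  replace (/ h x - / l)%C with ((l - h x) * (/ h x * / l))%C by now field.
  rewrite !Cmod_mult, !Cmod_inv by assumption. rewrite Cmod_sym.
  assert (I1 : / Cmod (h x) < / (Cmod l / 2))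
    by (apply Rinv_lt_contravar; [apply Rmult_lt_0_compat; lra | exact B]).
  assert (I2 : 0 < / Cmod (h x)) by (apply Rinv_0_lt_compat; lra).
  assert (I3 : 0 < / Cmod l) by now apply Rinv_0_lt_compat.
  apply Rle_lt_trans with (Cmod (h x - l) * (/ (Cmod l / 2) * / Cmod l)).
  - apply Rmult_le_compat_l; [apply Cmod_ge_0 |].
    apply Rmult_le_compat_r; lra.
  - apply Rlt_le_trans with (eps * (Cmod l * Cmod l) / 2 * (/ (Cmod l / 2) * / Cmod l)).
    + apply Rmult_lt_compat_r; [| exact A2].
      apply Rmult_lt_0_compat; [apply Rinv_0_lt_compat; lra | exact I3].
    + apply Req_le. field. lra.
Qed.

Lemma clim_div (h k : T -> C) (l m : C) :
  m <> 0 -> clim F h l -> clim F k m -> clim F (fun x => h x / k x)%C (l / m)%C.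
Proof. intros Hm H K. apply clim_mult; [exact H | now apply clim_inv]. Qed.

Lemma clim_pow (h : T -> C) (l : C) (n : nat) :
  clim F h l -> clim F (fun x => h x ^ n)%C (l ^ n)%C.
Proof.
  intros H. induction n as [| n IH]; simpl.
  - apply clim_const.
  - now apply clim_mult.
Qed.

Lemma clim_comp (g : C -> C) (h : T -> C) (l : C) :
  clim (cnhds l) g (g l) -> clim F h l -> clim F (fun x => g (h x)) (g l).
Proof.
  intros G H eps He. destruct (G eps He) as [d [Hd Gd]].
  generalize (H d Hd). apply filter_imp. intros x. apply Gd.
Qed.

Lemma clim_Cmod (h : T -> C) (l : C) :
  clim F h l -> filterlim (fun x => Cmod (h x)) F (locally (Cmod l)).
Proof.
  intros H. apply filterlim_locally. intros eps.
  generalize (H eps (cond_pos eps)). apply filter_imp. intros x A.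
  unfold ball; simpl; unfold AbsRing_ball, abs, minus, plus, opp; simpl.
  assert (B1 := Cmod_lower (h x) l). assert (B2 := Cmod_lower l (h x)).
  rewrite (Cmod_sym l (h x)) in B2. apply Rabs_def1; lra.
Qed.

Lemma clim_fst (h : T -> C) (l : C) :
  clim F h l -> filterlim (fun x => fst (h x)) F (locally (fst l)).
Proof.
  intros H. apply filterlim_locally. intros eps.
  generalize (H eps (cond_pos eps)). apply filter_imp. intros x A.
  unfold ball; simpl; unfold AbsRing_ball, abs, minus, plus, opp; simpl.
  eapply Rle_lt_trans; [| exact A].
  apply (re_le_Cmod (h x - l)).
Qed.

Lemma Cmod_le_abs (z : C) : Cmod z <= Rabs (fst z) + Rabs (snd z).
Proof.
  unfold Cmod. apply Rsqr_incr_0_var.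
  - rewrite Rsqr_sqrt by nra. unfold Rsqr.
    assert (A := Rabs_pos (fst z)). assert (B := Rabs_pos (snd z)).
    assert (A2 := Rsqr_abs (fst z)). assert (B2 := Rsqr_abs (snd z)).
    unfold Rsqr in *. nra.
  - assert (A := Rabs_pos (fst z)). assert (B := Rabs_pos (snd z)). lra.
Qed.

Lemma snd_le_Cmod (z : C) : Rabs (snd z) <= Cmod z.
Proof.
  eapply Rle_trans; [| apply Rmax_Cmod]. apply Rmax_r.
Qed.

Lemma clim_snd (h : T -> C) (l : C) :
  clim F h l -> filterlim (fun x => snd (h x)) F (locally (snd l)).
Proof.
  intros H. apply filterlim_locally. intros eps.
  generalize (H eps (cond_pos eps)). apply filter_imp. intros x A.
  unfold ball; simpl; unfold AbsRing_ball, abs, minus, plus, opp; simpl.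
  eapply Rle_lt_trans; [| exact A].
  apply (snd_le_Cmod (h x - l)).
Qed.

Lemma clim_pair (u v : T -> R) (a b : R) :
  filterlim u F (locally a) -> filterlim v F (locally b) ->
  clim F (fun x => (u x, v x) : C) (a, b).
Proof.
  intros U V eps He.
  assert (He2 : 0 < eps / 2) by lra.
  generalize (filter_and (F := F) _ _
    (proj1 (filterlim_locally u a) U (mkposreal _ He2))
    (proj1 (filterlim_locally v b) V (mkposreal _ He2))).
  apply filter_imp. intros x [A B].
  unfold ball in A, B; simpl in A, B.
  unfold AbsRing_ball, abs, minus, plus, opp in A, B; simpl in A, B.
  eapply Rle_lt_trans; [apply Cmod_le_abs |]. simpl.
  unfold Rminus in *. lra.
Qed.

Lemma clim_conj (h : T -> C) (l : C) :
  clim F h l -> clim F (fun x => Cconj (h x)) (Cconj l).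
Proof.
  intros H eps He. generalize (H eps He). apply filter_imp. intros x A.
  rewrite <- Cminus_conj. now rewrite Cmod_conj.
Qed.

Lemma clim_RtoC (u : T -> R) (a : R) :
  filterlim u F (locally a) -> clim F (fun x => RtoC (u x)) (RtoC a).
Proof. intros U. apply clim_pair; [exact U | apply filterlim_const]. Qed.

End Clim.

(** * Rules for complex derivatives *)

Definition ccont (h : C -> C) (z : C) : Prop := clim (cnhds z) h (h z).
Definition pcont (h : R -> C) (t : R) : Prop := clim (locally t) h (h t).

(** The library derivative quantifies over all limit points of the neighbourhood filter; uniqueness
    of that limit reduces it to the usual first-order remainder estimate, the form in which
    derivatives are handled below. *)
Lemma cder_eps (f : C -> C) (z l : C) :
  cder f z l <->
  forall eps, 0 < eps -> exists d, 0 < d /\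
    forall y, Cmod (y - z) < d -> Cmod (f y - f z - l * (y - z)) <= eps * Cmod (y - z).
Proof.
  split.
  - intros [_ H] eps He.
    specialize (H z (fun P Q => Q) (mkposreal eps He)).
    destruct H as [d Hd]. exists d. split; [apply cond_pos |].
    intros y Hy. specialize (Hd y Hy).
    change (Cmod ((f y + - f z) + - ((y + - z) * l)) <= eps * Cmod (y + - z)) in Hd.
    replace (f y - f z - l * (y - z))%C
      with ((f y + - f z) + - ((y + - z) * l))%C by ring. exact Hd.
  - intros H. split.
    + apply (is_linear_scal_l (K := C_AbsRing) (V := C_NormedModule)).
    + intros x Hx. apply (is_filter_lim_locally_unique (z : AbsRing_UniformSpace C_AbsRing)) in Hx. subst x.
      intros eps. destruct (H eps (cond_pos eps)) as [d [Hd Hy]].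
      exists (mkposreal d Hd). intros y By. specialize (Hy y By).
      change (Cmod ((f y + - f z) + - ((y + - z) * l)) <= eps * Cmod (y + - z)).
      replace ((f y + - f z) + - ((y + - z) * l))%C
        with (f y - f z - l * (y - z))%C by ring. exact Hy.
Qed.

Lemma cder_unique (f : C -> C) (z l m : C) : cder f z l -> cder f z m -> l = m.
Proof.
  intros H K. rewrite <- (is_C_derive_unique f z l H). now apply is_C_derive_unique.
Qed.

Lemma cder_eq (f : C -> C) (z l m : C) : cder f z l -> l = m -> cder f z m.
Proof. now intros H <-. Qed.

Lemma cder_ext_loc (f g : C -> C) (z l : C) (d : R) :
  0 < d -> (forall y, Cmod (y - z) < d -> f y = g y) -> cder f z l -> cder g z l.
Proof.
  intros Hd E H. rewrite cder_eps in H |- *. intros eps He.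
  destruct (H eps He) as [e [He' A]]. exists (Rmin d e). split.
  - now apply Rmin_pos.
  - intros y Hy.
    assert (Y1 : Cmod (y - z) < d) by (eapply Rlt_le_trans; [exact Hy | apply Rmin_l]).
    assert (Y2 : Cmod (y - z) < e) by (eapply Rlt_le_trans; [exact Hy | apply Rmin_r]).
    rewrite <- (E y Y1), <- (E z); [now apply A |].
    replace (z - z)%C with (RtoC 0) by ring. now rewrite Cmod_0.
Qed.

Lemma cder_ext (f g : C -> C) (z l : C) :
  (forall y, f y = g y) -> cder f z l -> cder g z l.
Proof. intros E. apply (cder_ext_loc f g z l 1); [lra | auto]. Qed.

Lemma cder_const (c z : C) : cder (fun _ => c) z (RtoC 0).
Proof. apply (is_derive_const (K := C_AbsRing) (V := C_NormedModule)). Qed.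

Lemma cder_id (z : C) : cder (fun y => y) z (RtoC 1).
Proof.
  rewrite cder_eps. intros eps He. exists 1. split; [lra |]. intros y _.
  replace (y - z - 1 * (y - z))%C with (RtoC 0) by ring. rewrite Cmod_0.
  apply Rmult_le_pos; [lra | apply Cmod_ge_0].
Qed.

Lemma cder_plus (f g : C -> C) (z l m : C) :
  cder f z l -> cder g z m -> cder (fun y => f y + g y)%C z (l + m)%C.
Proof. intros H K. exact (is_derive_plus (K := C_AbsRing) (V := C_NormedModule) f g z l m H K). Qed.

(* [is_derive_mult] and [is_derive_comp] see the target as the ring itself, whose
   module structure differs (only) in its uniform space from [C_NormedModule]. *)
Lemma cder_ring (f : C -> C) (z l : C) :
  cder f z l <-> is_derive (K := C_AbsRing) (V := AbsRing_NormedModule C_AbsRing) f z l.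
Proof.
  split; intros [A B]; split.
  - apply (is_linear_scal_l (K := C_AbsRing) (V := AbsRing_NormedModule C_AbsRing)).
  - exact B.
  - apply (is_linear_scal_l (K := C_AbsRing) (V := C_NormedModule)).
  - exact B.
Qed.

Lemma cder_comp (f g : C -> C) (z l m : C) :
  cder f (g z) l -> cder g z m -> cder (fun y => f (g y)) z (m * l)%C.
Proof. intros H K. apply cder_ring in K.
  exact (is_derive_comp (K := C_AbsRing) (V := C_NormedModule) f g z l m H K). Qed.

Lemma cder_mult (f g : C -> C) (z l m : C) :
  cder f z l -> cder g z m -> cder (fun y => f y * g y)%C z (l * g z + f z * m)%C.
Proof.
  intros H K. apply cder_ring in H. apply cder_ring in K. apply cder_ring.
  exact (is_derive_mult (K := C_AbsRing) f g z l m H K Cmult_comm).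
Qed.

Lemma cder_scal (c : C) (f : C -> C) (z l : C) :
  cder f z l -> cder (fun y => c * f y)%C z (c * l)%C.
Proof.
  intros H. generalize (cder_mult (fun _ => c) f z _ _ (cder_const c z) H).
  replace (RtoC 0 * f z + c * l)%C with (c * l)%C by ring. auto.
Qed.

Lemma cder_opp (f : C -> C) (z l : C) : cder f z l -> cder (fun y => - f y)%C z (- l)%C.
Proof.
  intros H. apply (cder_ext (fun y => (- 1) * f y)%C); [intros; ring |].
  replace (- l)%C with ((- 1) * l)%C by ring. now apply cder_scal.
Qed.

Lemma cder_minus (f g : C -> C) (z l m : C) :
  cder f z l -> cder g z m -> cder (fun y => f y - g y)%C z (l - m)%C.
Proof. intros H K. apply cder_plus; [exact H | now apply cder_opp]. Qed.

Lemma cder_ccont (f : C -> C) (z l : C) : cder f z l -> ccont f z.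
Proof.
  rewrite cder_eps. intros H eps He.
  destruct (H 1 Rlt_0_1) as [d [Hd A]].
  assert (L := Cmod_ge_0 l).
  assert (Q : 0 < eps / (Cmod l + 1)) by (apply Rdiv_lt_0_compat; lra).
  exists (Rmin d (eps / (Cmod l + 1))). split; [now apply Rmin_pos |].
  intros y Hy.
  assert (Y1 : Cmod (y - z) < d) by (eapply Rlt_le_trans; [exact Hy | apply Rmin_l]).
  assert (Y2 : Cmod (y - z) < eps / (Cmod l + 1))
    by (eapply Rlt_le_trans; [exact Hy | apply Rmin_r]).
  specialize (A y Y1).
  replace (f y - f z)%C with ((f y - f z - l * (y - z)) + l * (y - z))%C by ring.
  eapply Rle_lt_trans; [apply Cmod_triangle |]. rewrite Cmod_mult.
  apply Rle_lt_trans with ((Cmod l + 1) * Cmod (y - z)); [lra |].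
  apply Rlt_le_trans with ((Cmod l + 1) * (eps / (Cmod l + 1))).
  - apply Rmult_lt_compat_l; lra.
  - apply Req_le. field. lra.
Qed.

Lemma cder_inv_id (z : C) : z <> 0 -> cder (fun y => / y)%C z (- / (z * z))%C.
Proof.
  intros N. assert (M : 0 < Cmod z) by now apply Cmod_gt_0.
  rewrite cder_eps. intros eps He.
  assert (L : clim (cnhds z) (fun y => / (y * (z * z)))%C (/ (z * (z * z)))%C).
  { apply clim_inv.
    - intros E. apply N. apply Cmod_eq_0. apply (f_equal Cmod) in E.
      rewrite !Cmod_mult, Cmod_0 in E.
      apply Rmult_integral in E. destruct E as [E | E]; [exact E |].
      apply Rmult_integral in E. tauto.
    - apply clim_mult; [| apply clim_const].
      intros e He'. exists e. auto. }
  set (B := Cmod (/ (z * (z * z))) + 1).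
  assert (HB : 0 < B) by (unfold B; assert (H := Cmod_ge_0 (/ (z * (z * z)))); lra).
  destruct (L 1 Rlt_0_1) as [d [Hd A]].
  exists (Rmin (Rmin d (Cmod z)) (eps / B)). split.
  { repeat apply Rmin_pos; try assumption. now apply Rdiv_lt_0_compat. }
  intros y Hy.
  assert (Y0 : Cmod (y - z) < Rmin d (Cmod z))
    by (eapply Rlt_le_trans; [exact Hy | apply Rmin_l]).
  assert (Y1 : Cmod (y - z) < d) by (eapply Rlt_le_trans; [exact Y0 | apply Rmin_l]).
  assert (Y2 : Cmod (y - z) < Cmod z) by (eapply Rlt_le_trans; [exact Y0 | apply Rmin_r]).
  assert (Y3 : Cmod (y - z) < eps / B) by (eapply Rlt_le_trans; [exact Hy | apply Rmin_r]).
  assert (Ny : y <> 0).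
  { intros E. subst y. replace (RtoC 0 - z)%C with (- z)%C in Y2 by ring.
    rewrite Cmod_opp in Y2. lra. }
  (* The first-order remainder of 1/y is exactly (y - z)^2 / (y z^2), and continuity keeps 1 / (y
     z^2) below [B] near z. *)
  replace (/ y - / z - - / (z * z) * (y - z))%C
    with ((y - z) * ((y - z) * / (y * (z * z))))%C by (field; auto).
  rewrite (Cmod_mult (y - z)), Rmult_comm.
  apply Rmult_le_compat_r; [apply Cmod_ge_0 |]. rewrite Cmod_mult.
  specialize (A y Y1).
  assert (A' : Cmod (/ (y * (z * z))) <= B).
  { unfold B. assert (H := Cmod_lower (/ (y * (z * z))) (/ (z * (z * z)))). lra. }
  apply Rle_trans with (eps / B * B).
  - apply Rmult_le_compat; try apply Cmod_ge_0; lra.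
  - apply Req_le. field. lra.
Qed.

Lemma cder_inv (f : C -> C) (z l : C) :
  f z <> 0 -> cder f z l -> cder (fun y => / f y)%C z (- l / (f z * f z))%C.
Proof.
  intros N H. replace (- l / (f z * f z))%C with (l * - / (f z * f z))%C by (field; auto).
  apply (cder_comp (fun y => / y)%C f); [now apply cder_inv_id | exact H].
Qed.

Lemma cder_div (f g : C -> C) (z l m : C) :
  g z <> 0 -> cder f z l -> cder g z m ->
  cder (fun y => f y / g y)%C z ((l * g z - f z * m) / (g z * g z))%C.
Proof.
  intros N H K.
  replace ((l * g z - f z * m) / (g z * g z))%C
    with (l * / g z + f z * (- m / (g z * g z)))%C by (field; auto).
  apply (cder_mult f (fun y => / g y)%C); [exact H | now apply cder_inv].
Qed.

Lemma cder_pow (f : C -> C) (z l : C) (n : nat) :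
  cder f z l -> cder (fun y => f y ^ S n)%C z (INR (S n) * f z ^ n * l)%C.
Proof.
  intros H. induction n as [| n IH].
  - apply (cder_ext f); [intros; simpl; ring |].
    replace (INR 1 * f z ^ 0 * l)%C with l; [exact H |]. simpl. ring.
  - apply (cder_ext (fun y => f y * f y ^ S n)%C); [reflexivity |].
    replace (INR (S (S n)) * f z ^ S n * l)%C
      with (l * f z ^ S n + f z * (INR (S n) * f z ^ n * l))%C.
    + now apply cder_mult.
    + rewrite (S_INR (S n)), RtoC_plus. simpl (f z ^ S n)%C. ring.
Qed.

(** * Complex-valued integrals of functions of a real variable *)

Definition exC (h : R -> C) (a b : R) : Prop :=
  ex_RInt (fun t => fst (h t)) a b /\ ex_RInt (fun t => snd (h t)) a b.

Definition CI (h : R -> C) (a b : R) : C :=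
  (RInt (fun t => fst (h t)) a b, RInt (fun t => snd (h t)) a b).

Lemma exC_pcont (h : R -> C) (a b : R) :
  (forall t, Rmin a b <= t <= Rmax a b -> pcont h t) -> exC h a b.
Proof.
  intros H. split; apply (ex_RInt_continuous (V := R_CompleteNormedModule));
    intros t Ht; [apply (clim_fst h (h t)) | apply (clim_snd h (h t))]; now apply H.
Qed.

Lemma CI_ext (h k : R -> C) (a b : R) :
  (forall t, Rmin a b < t < Rmax a b -> h t = k t) -> CI h a b = CI k a b.
Proof.
  intros E. unfold CI. f_equal; apply RInt_ext; intros t Ht; now rewrite E.
Qed.

Lemma CI_plus (h k : R -> C) (a b : R) :
  exC h a b -> exC k a b -> CI (fun t => h t + k t)%C a b = (CI h a b + CI k a b)%C.
Proof.
  intros [H1 H2] [K1 K2]. unfold CI, Cplus; simpl. f_equal.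
  - apply (RInt_plus (V := R_CompleteNormedModule) _ _ _ _ H1 K1).
  - apply (RInt_plus (V := R_CompleteNormedModule) _ _ _ _ H2 K2).
Qed.

Lemma RInt_lin2 (u v : R -> R) (a b p q : R) :
  ex_RInt u a b -> ex_RInt v a b ->
  is_RInt (fun t => p * u t + q * v t) a b (p * RInt u a b + q * RInt v a b).
Proof.
  intros U V.
  apply (is_RInt_plus (V := R_NormedModule) (fun t => p * u t) (fun t => q * v t)).
  - apply (is_RInt_scal (V := R_NormedModule) u). now apply (RInt_correct (V := R_CompleteNormedModule)).
  - apply (is_RInt_scal (V := R_NormedModule) v). now apply (RInt_correct (V := R_CompleteNormedModule)).
Qed.

Lemma CI_scal_aux (c : C) (h : R -> C) (a b : R) :
  exC h a b -> exC (fun t => c * h t)%C a b /\ CI (fun t => c * h t)%C a b = (c * CI h a b)%C.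
Proof.
  intros [H1 H2].
  assert (A := RInt_lin2 _ _ a b (fst c) (- snd c) H1 H2).
  assert (B := RInt_lin2 _ _ a b (snd c) (fst c) H1 H2).
  assert (A' : is_RInt (fun t => fst (c * h t)%C) a b (fst (c * CI h a b)%C)).
  { eapply (is_RInt_ext (V := R_NormedModule)); [| eapply eq_rect; [exact A |]]; simpl; intros; ring. }
  assert (B' : is_RInt (fun t => snd (c * h t)%C) a b (snd (c * CI h a b)%C)).
  { eapply (is_RInt_ext (V := R_NormedModule)); [| eapply eq_rect; [exact B |]]; simpl; intros; ring. }
  split.
  - split; eexists; [exact A' | exact B'].
  - unfold CI at 1. rewrite (is_RInt_unique _ _ _ _ A'), (is_RInt_unique _ _ _ _ B').
    symmetry. apply surjective_pairing.
Qed.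

Lemma exC_scal (c : C) (h : R -> C) (a b : R) : exC h a b -> exC (fun t => c * h t)%C a b.
Proof. intros H. now apply CI_scal_aux. Qed.

Lemma CI_scal (c : C) (h : R -> C) (a b : R) :
  exC h a b -> CI (fun t => c * h t)%C a b = (c * CI h a b)%C.
Proof. intros H. now apply CI_scal_aux. Qed.

Lemma CI_minus (h k : R -> C) (a b : R) :
  exC h a b -> exC k a b -> CI (fun t => h t - k t)%C a b = (CI h a b - CI k a b)%C.
Proof.
  intros H K.
  rewrite (CI_ext _ (fun t => h t + (- 1) * k t)%C) by (intros; ring).
  rewrite CI_plus, CI_scal; [ring | assumption | assumption | now apply exC_scal].
Qed.

Lemma exC_minus (h k : R -> C) (a b : R) :
  exC h a b -> exC k a b -> exC (fun t => h t - k t)%C a b.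
Proof.
  intros [H1 H2] [K1 K2]. split.
  - apply (ex_RInt_minus (V := R_NormedModule) _ _ _ _ H1 K1).
  - apply (ex_RInt_minus (V := R_NormedModule) _ _ _ _ H2 K2).
Qed.

Lemma CI_const (c : C) (a b : R) : CI (fun _ => c) a b = (RtoC (b - a) * c)%C.
Proof.
  unfold CI. rewrite !RInt_const. unfold scal; simpl; unfold mult; simpl.
  unfold RtoC, Cmult; simpl. f_equal; ring.
Qed.

Lemma CI_Chasles (h : R -> C) (a b c : R) :
  exC h a b -> exC h b c -> (CI h a b + CI h b c)%C = CI h a c.
Proof.
  intros [H1 H2] [K1 K2]. unfold CI, Cplus; simpl. f_equal.
  - apply (RInt_Chasles (V := R_CompleteNormedModule) _ _ _ _ H1 K1).
  - apply (RInt_Chasles (V := R_CompleteNormedModule) _ _ _ _ H2 K2).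
Qed.

Lemma CI_conj (h : R -> C) (a b : R) :
  exC h a b -> CI (fun t => Cconj (h t)) a b = Cconj (CI h a b).
Proof.
  intros [H1 H2]. unfold CI, Cconj; simpl. f_equal.
  apply (RInt_opp (V := R_CompleteNormedModule) _ _ _ H2).
Qed.

(* Rotating the integral to the positive real axis reduces the bound to [RInt_le]. *)
Lemma Cmod_CI_le (h : R -> C) (a b : R) (u : R -> R) :
  a <= b -> exC h a b -> ex_RInt u a b ->
  (forall t, a < t < b -> Cmod (h t) <= u t) -> Cmod (CI h a b) <= RInt u a b.
Proof.
  intros ab H U B. set (I := CI h a b).
  assert (P := Cmod_ge_0 I).
  assert (U0 : 0 <= RInt u a b).
  { apply RInt_ge_0; [exact ab | exact U |]. intros t Ht.
    eapply Rle_trans; [apply Cmod_ge_0 | now apply B]. }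
  destruct (Req_dec (Cmod I) 0) as [E | N]; [lra |].
  assert (E := CI_scal (Cconj I) h a b H). fold I in E.
  assert (E1 : fst (Cconj I * I)%C = Cmod I * Cmod I).
  { rewrite Cmult_comm, <- Cmod2_conj. simpl. ring. }
  apply Rmult_le_reg_l with (Cmod I); [lra |].
  rewrite <- E1, <- E. simpl fst.
  rewrite <- (is_RInt_unique (fun t => Cmod I * u t) a b (Cmod I * RInt u a b)).
  2:{ apply (is_RInt_scal (V := R_NormedModule) u). now apply (RInt_correct (V := R_CompleteNormedModule)). }
  apply RInt_le; [exact ab | | |].
  - apply (exC_scal (Cconj I) h a b H).
  - apply (ex_RInt_scal (V := R_NormedModule) u). exact U.
  - intros t Ht. apply Rle_trans with (Cmod (Cconj I * h t)).
    + eapply Rle_trans; [apply Rle_abs |]. apply (re_le_Cmod (Cconj I * h t)).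
    + rewrite Cmod_mult, Cmod_conj. apply Rmult_le_compat_l; [exact P | now apply B].
Qed.

Lemma Cmod_CI_le_const (h : R -> C) (a b M : R) :
  a <= b -> exC h a b -> (forall t, a < t < b -> Cmod (h t) <= M) ->
  Cmod (CI h a b) <= (b - a) * M.
Proof.
  intros ab H B.
  assert (A := Cmod_CI_le h a b (fun _ => M) ab H (ex_RInt_const _ _ _) B).
  rewrite RInt_const in A. exact A.
Qed.

(** * Goursat's theorem for rectangles *)

(** The contour integral along the boundary of [a, b] x [c, d], counterclockwise. *)
Definition rectI (f : C -> C) (a b c d : R) : C :=
  (CI (fun x => f (x, c)) a b + Ci * CI (fun y => f (b, y)) c d
   - CI (fun x => f (x, d)) a b - Ci * CI (fun y => f (a, y)) c d)%C.

Definition ccont_on_rect (f : C -> C) (a b c d : R) : Prop :=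
  forall x y, a <= x <= b -> c <= y <= d -> ccont f (x, y).

Definition cder_on_rect (f : C -> C) (a b c d : R) : Prop :=
  forall x y, a <= x <= b -> c <= y <= d -> exists l, cder f (x, y) l.

Lemma cder_ccont_on_rect (f : C -> C) (a b c d : R) :
  cder_on_rect f a b c d -> ccont_on_rect f a b c d.
Proof. intros H x y X Y. destruct (H x y X Y) as [l Hl]. now apply cder_ccont in Hl. Qed.

Lemma exC_horizontal (f : C -> C) (a b c d u v y : R) :
  ccont_on_rect f a b c d -> a <= u -> u <= v -> v <= b -> c <= y <= d ->
  exC (fun x => f (x, y)) u v.
Proof.
  intros H U UV V Y. apply exC_pcont. rewrite Rmin_left, Rmax_right by lra.
  intros t Ht. apply (clim_comp f (fun x => (x, y) : C) (t, y)).
  - apply H; lra.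
  - apply clim_pair; [apply filterlim_id | apply filterlim_const].
Qed.

Lemma exC_vertical (f : C -> C) (a b c d u v x : R) :
  ccont_on_rect f a b c d -> c <= u -> u <= v -> v <= d -> a <= x <= b ->
  exC (fun y => f (x, y)) u v.
Proof.
  intros H U UV V Y. apply exC_pcont. rewrite Rmin_left, Rmax_right by lra.
  intros t Ht. apply (clim_comp f (fun y => (x, y) : C) (x, t)).
  - apply H; lra.
  - apply clim_pair; [apply filterlim_const | apply filterlim_id].
Qed.

Lemma rectI_split (f : C -> C) (a b c d m p : R) :
  ccont_on_rect f a b c d -> a <= m <= b -> c <= p <= d ->
  rectI f a b c d =
  (rectI f a m c p + rectI f m b c p + rectI f a m p d + rectI f m b p d)%C.
Proof.
  intros H M P. unfold rectI.
  rewrite <- (CI_Chasles (fun x => f (x, c)) a m b);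
    try (apply (exC_horizontal f a b c d); auto; lra).
  rewrite <- (CI_Chasles (fun x => f (x, d)) a m b);
    try (apply (exC_horizontal f a b c d); auto; lra).
  rewrite <- (CI_Chasles (fun y => f (b, y)) c p d);
    try (apply (exC_vertical f a b c d); auto; lra).
  rewrite <- (CI_Chasles (fun y => f (a, y)) c p d);
    try (apply (exC_vertical f a b c d); auto; lra).
  ring.
Qed.

Lemma rectI_minus (f g : C -> C) (a b c d : R) :
  a <= b -> c <= d -> ccont_on_rect f a b c d -> ccont_on_rect g a b c d ->
  rectI (fun z => f z - g z)%C a b c d = (rectI f a b c d - rectI g a b c d)%C.
Proof.
  intros ab cd F G. unfold rectI.
  rewrite (CI_minus (fun x => f (x, c)) (fun x => g (x, c)));
    try (eapply exC_horizontal; eauto; lra).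
  rewrite (CI_minus (fun x => f (x, d)) (fun x => g (x, d)));
    try (eapply exC_horizontal; eauto; lra).
  rewrite (CI_minus (fun y => f (b, y)) (fun y => g (b, y)));
    try (eapply exC_vertical; eauto; lra).
  rewrite (CI_minus (fun y => f (a, y)) (fun y => g (a, y)));
    try (eapply exC_vertical; eauto; lra).
  ring.
Qed.

Lemma is_RInt_affine (p q a b : R) :
  is_RInt (fun x => p + q * x) a b (p * (b - a) + q * (b * b - a * a) / 2).
Proof.
  replace (p * (b - a) + q * (b * b - a * a) / 2)
    with ((p * b + q * (b * b) / 2) - (p * a + q * (a * a) / 2)) by field.
  apply (is_RInt_derive (V := R_CompleteNormedModule)
           (fun x => p * x + q * (x * x) / 2) (fun x => p + q * x)).
  - intros x _. auto_derive; [exact I | field].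
  - intros x _. apply (ex_derive_continuous (V := R_NormedModule) (fun x => p + q * x)).
    auto_derive. exact I.
Qed.

Lemma CI_affine (h : R -> C) (u v : C) (a b : R) :
  (forall t, h t = u + RtoC t * v)%C ->
  CI h a b = (RtoC (b - a) * u + RtoC ((b * b - a * a) / 2) * v)%C.
Proof.
  intros E. unfold CI.
  rewrite (RInt_ext _ (fun t => fst u + fst v * t)).
  2:{ intros t _. rewrite E. simpl. ring. }
  rewrite (RInt_ext (fun t => snd (h t)) (fun t => snd u + snd v * t)).
  2:{ intros t _. rewrite E. simpl. ring. }
  rewrite !(is_RInt_unique _ _ _ _ (is_RInt_affine _ _ _ _)).
  unfold RtoC, Cmult, Cplus; simpl. f_equal; field.
Qed.

(** Goursat's argument subtracts the first-order expansion of [f] at a point; this makes the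
    subtraction invisible to the contour integral. *)
Lemma rectI_affine (u v : C) (a b c d : R) : rectI (fun z => u + v * z)%C a b c d = 0.
Proof.
  unfold rectI.
  rewrite (CI_affine (fun x => u + v * (x, c))%C (u + v * (0, c))%C v)
    by (intros; unfold RtoC, Cmult, Cplus; simpl; f_equal; ring).
  rewrite (CI_affine (fun x => u + v * (x, d))%C (u + v * (0, d))%C v)
    by (intros; unfold RtoC, Cmult, Cplus; simpl; f_equal; ring).
  rewrite (CI_affine (fun y => u + v * (b, y))%C (u + v * (b, 0))%C (v * Ci)%C)
    by (intros; unfold RtoC, Cmult, Cplus, Ci; simpl; f_equal; ring).
  rewrite (CI_affine (fun y => u + v * (a, y))%C (u + v * (a, 0))%C (v * Ci)%C)
    by (intros; unfold RtoC, Cmult, Cplus, Ci; simpl; f_equal; ring).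
  apply injective_projections; simpl; field.
Qed.

Lemma Cmod_rectI_le (f : C -> C) (a b c d M : R) :
  a <= b -> c <= d -> ccont_on_rect f a b c d ->
  (forall x y, a <= x <= b -> c <= y <= d -> Cmod (f (x, y)) <= M) ->
  Cmod (rectI f a b c d) <= 2 * (b - a + (d - c)) * M.
Proof.
  intros ab cd H B. unfold rectI.
  assert (H1 : Cmod (CI (fun x => f (x, c)) a b) <= (b - a) * M).
  { apply Cmod_CI_le_const; [lra | eapply exC_horizontal; eauto; lra | intros; apply B; lra]. }
  assert (H2 : Cmod (CI (fun x => f (x, d)) a b) <= (b - a) * M).
  { apply Cmod_CI_le_const; [lra | eapply exC_horizontal; eauto; lra | intros; apply B; lra]. }
  assert (H3 : Cmod (CI (fun y => f (b, y)) c d) <= (d - c) * M).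
  { apply Cmod_CI_le_const; [lra | eapply exC_vertical; eauto; lra | intros; apply B; lra]. }
  assert (H4 : Cmod (CI (fun y => f (a, y)) c d) <= (d - c) * M).
  { apply Cmod_CI_le_const; [lra | eapply exC_vertical; eauto; lra | intros; apply B; lra]. }
  unfold Cminus.
  eapply Rle_trans; [apply Cmod_triangle |].
  eapply Rle_trans; [apply Rplus_le_compat_r, Cmod_triangle |].
  eapply Rle_trans; [apply Rplus_le_compat_r, Rplus_le_compat_r, Cmod_triangle |].
  rewrite !Cmod_opp, !Cmod_mult, Cmod_Ci. lra.
Qed.

Record rect := mkrect { ra : R; rb : R; rc : R; rd : R }.

(** Half the perimeter: it halves at each bisection, bounds the distance between two points of the
    rectangle, and enters [Cmod_rectI_le] with the factor 2. *)
Definition size (q : rect) : R := rb q - ra q + (rd q - rc q).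

Definition rI (f : C -> C) (q : rect) : C := rectI f (ra q) (rb q) (rc q) (rd q).

(** The threshold is quadratic in [size] so that the thresholds of the four quarters add up to that
    of the whole: if the whole is bad, some quarter is. The fourth is taken untested, and
    [quarter_bad] shows that it is bad whenever it is reached. *)
Definition quarter (f : C -> C) (eps : R) (q : rect) : rect :=
  let m := (ra q + rb q) / 2 in
  let p := (rc q + rd q) / 2 in
  let q1 := mkrect (ra q) m (rc q) p in
  let q2 := mkrect m (rb q) (rc q) p in
  let q3 := mkrect (ra q) m p (rd q) in
  let q4 := mkrect m (rb q) p (rd q) in
  let bad q := Rlt_dec (eps * size q ^ 2) (Cmod (rI f q)) in
  if bad q1 then q1 else if bad q2 then q2 else if bad q3 then q3 else q4.

Lemma quarter_shape (f : C -> C) (eps : R) (q : rect) :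
  ra q <= rb q -> rc q <= rd q ->
  let q' := quarter f eps q in
  ra q <= ra q' /\ rb q' <= rb q /\ rc q <= rc q' /\ rd q' <= rd q /\
  rb q' - ra q' = (rb q - ra q) / 2 /\ rd q' - rc q' = (rd q - rc q) / 2.
Proof.
  intros A B. unfold quarter.
  repeat destruct Rlt_dec; simpl; repeat split; lra.
Qed.

Lemma quarter_bad (f : C -> C) (eps : R) (q : rect) :
  ra q <= rb q -> rc q <= rd q -> ccont_on_rect f (ra q) (rb q) (rc q) (rd q) ->
  eps * size q ^ 2 < Cmod (rI f q) ->
  eps * size (quarter f eps q) ^ 2 < Cmod (rI f (quarter f eps q)).
Proof.
  intros A B H Q. unfold quarter.
  destruct Rlt_dec as [|N1]; [assumption |].
  destruct Rlt_dec as [|N2]; [assumption |].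
  destruct Rlt_dec as [|N3]; [assumption |].
  apply Rnot_le_lt. intros N4. apply Rnot_lt_le in N1, N2, N3.
  set (m := (ra q + rb q) / 2) in *. set (p := (rc q + rd q) / 2) in *.
  assert (S1 : size (mkrect (ra q) m (rc q) p) = size q / 2) by (unfold size, m, p; simpl; field).
  assert (S2 : size (mkrect m (rb q) (rc q) p) = size q / 2) by (unfold size, m, p; simpl; field).
  assert (S3 : size (mkrect (ra q) m p (rd q)) = size q / 2) by (unfold size, m, p; simpl; field).
  assert (S4 : size (mkrect m (rb q) p (rd q)) = size q / 2) by (unfold size, m, p; simpl; field).
  rewrite S1 in N1. rewrite S2 in N2. rewrite S3 in N3. rewrite S4 in N4.
  clear S1 S2 S3 S4.
  revert N1 N2 N3 N4 Q. unfold rI; cbn [ra rb rc rd].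
  rewrite (rectI_split f _ _ _ _ ((ra q + rb q) / 2) ((rc q + rd q) / 2) H) by lra.
  match goal with |- _ ?u <= _ -> _ ?v <= _ -> _ ?w <= _ -> _ ?x <= _ -> _ =>
    intros N1 N2 N3 N4; assert (T1 := Cmod_triangle (u + v + w) x);
    assert (T2 := Cmod_triangle (u + v) w); assert (T3 := Cmod_triangle u v) end.
  intros Q. fold m p in Q. simpl pow in *. lra.
Qed.

(** Bisection produces nested rectangles whose contour integrals stay above eps size^2. Around their
    common point [f] is affine up to eps/2 times the distance, and the affine part integrates to
    zero, so a small rectangle of the sequence violates its lower bound. *)
Theorem goursat (f : C -> C) (a b c d : R) :
  a <= b -> c <= d -> cder_on_rect f a b c d -> rectI f a b c d = 0.
Proof.
  intros ab cd D. apply Cmod_eq_0.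
  assert (P := Cmod_ge_0 (rectI f a b c d)).
  destruct (Rle_lt_dec (Cmod (rectI f a b c d)) 0) as [|Pos]; [lra |]. exfalso.
  assert (HC := cder_ccont_on_rect f a b c d D).
  set (q0 := mkrect a b c d).
  (* The denominator makes eps size^2 strictly smaller than the integral; the added 1 covers
     rectangles of size zero. *)
  set (eps := Cmod (rectI f a b c d) / (2 * (size q0 ^ 2 + 1))).
  assert (S0 : 0 <= size q0 ^ 2) by apply pow2_ge_0.
  assert (He : 0 < eps) by (apply Rdiv_lt_0_compat; lra).
  assert (B0 : eps * size q0 ^ 2 < Cmod (rI f q0)).
  { change (rI f q0) with (rectI f a b c d).
    assert (E : eps * (2 * (size q0 ^ 2 + 1)) = Cmod (rectI f a b c d))
      by (unfold eps; field; lra). nra. }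
  set (Q := fix Q n := match n with O => q0 | S n => quarter f eps (Q n) end).
  assert (QI : forall n, a <= ra (Q n) /\ ra (Q n) <= rb (Q n) /\ rb (Q n) <= b /\
     c <= rc (Q n) /\ rc (Q n) <= rd (Q n) /\ rd (Q n) <= d /\
     size (Q n) = size q0 * (/ 2) ^ n /\ eps * size (Q n) ^ 2 < Cmod (rI f (Q n))).
  { induction n as [| n IH].
    - simpl. repeat split; lra.
    - destruct IH as (I1 & I2 & I3 & I4 & I5 & I6 & I7 & I8).
      destruct (quarter_shape f eps (Q n) I2 I5) as (J1 & J2 & J3 & J4 & J5 & J6).
      simpl Q. repeat split; try lra.
      + unfold size in *. simpl pow. lra.
      + apply quarter_bad; auto. intros x y X Y. apply HC; lra. }
  assert (QM : forall n k, ra (Q n) <= ra (Q (n + k)%nat) /\ rb (Q (n + k)%nat) <= rb (Q n) /\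
                rc (Q n) <= rc (Q (n + k)%nat) /\ rd (Q (n + k)%nat) <= rd (Q n)).
  { intros n. induction k as [| k IH].
    - rewrite Nat.add_0_r. lra.
    - rewrite Nat.add_succ_r. destruct (QI (n + k)%nat) as (I1 & I2 & I3 & I4 & I5 & I6 & _).
      destruct (quarter_shape f eps (Q (n + k)%nat) I2 I5) as (J1 & J2 & J3 & J4 & _).
      simpl Q. lra. }
  assert (Nested : forall l r : nat -> R, (forall n, l n <= r n) ->
     (forall n k, l n <= l (n + k)%nat /\ r (n + k)%nat <= r n) ->
     exists x, forall n, l n <= x <= r n).
  { intros l r LR M.
    assert (LR' : forall n m, l n <= r m).
    { intros n m. destruct (M n m) as [M1 _]. destruct (M m n) as [_ M2].
      rewrite (Nat.add_comm m n) in M2. specialize (LR (n + m)%nat). lra. }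
    destruct (completeness (fun x => exists n, x = l n)) as [x [X1 X2]].
    - exists (r O). intros y [n ->]. apply LR'.
    - exists (l O). now exists O.
    - exists x. intros n. split.
      + apply X1. now exists n.
      + apply X2. intros y [k ->]. apply LR'. }
  destruct (Nested (fun n => ra (Q n)) (fun n => rb (Q n))) as [x X].
  { intros n. apply (QI n). } { intros n k. split; apply (QM n k). }
  destruct (Nested (fun n => rc (Q n)) (fun n => rd (Q n))) as [y Y].
  { intros n. apply (QI n). } { intros n k. split; apply (QM n k). }
  assert (X0 := X O). assert (Y0 := Y O). simpl in X0, Y0.
  destruct (D x y X0 Y0) as [l Hl]. assert (Hl' := Hl).
  (* Half of eps, because the boundary has length 2 size. *)
  rewrite cder_eps in Hl'. destruct (Hl' (eps / 2) ltac:(lra)) as [dl [Hdl HD]].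
  assert (Sm : exists n, size (Q n) < dl).
  { destruct (pow_lt_1_zero (/ 2) ltac:(rewrite Rabs_pos_eq; lra) (dl / (size q0 + 1)))
      as [N HN].
    - apply Rdiv_lt_0_compat; [exact Hdl |]. unfold size; simpl; lra.
    - exists N. destruct (QI N) as (_ & _ & _ & _ & _ & _ & -> & _).
      specialize (HN N (Nat.le_refl N)). rewrite Rabs_pos_eq in HN by (apply pow_le; lra).
      assert (Z : 0 <= size q0) by (unfold size; simpl; lra).
      assert (W : 0 <= (/ 2) ^ N) by (apply pow_le; lra).
      apply Rle_lt_trans with ((size q0 + 1) * (/ 2) ^ N); [nra |].
      apply Rlt_le_trans with ((size q0 + 1) * (dl / (size q0 + 1))).
      + apply Rmult_lt_compat_l; lra.
      + apply Req_le. field. lra. }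
  destruct Sm as [n Sn].
  destruct (QI n) as (I1 & I2 & I3 & I4 & I5 & I6 & _ & I8).
  specialize (X n). specialize (Y n).
  set (z0 := (x, y) : C) in *.
  set (g := fun z : C => (f z0 - l * z0 + l * z)%C).
  assert (CF : ccont_on_rect f (ra (Q n)) (rb (Q n)) (rc (Q n)) (rd (Q n)))
    by (intros s t Hs Ht; apply HC; lra).
  assert (CG : ccont_on_rect g (ra (Q n)) (rb (Q n)) (rc (Q n)) (rd (Q n))).
  { intros s t Hs Ht. apply (cder_ccont g _ (RtoC 0 + l * RtoC 1)%C).
    apply cder_plus; [apply cder_const | apply cder_scal, cder_id]. }
  assert (E : rI f (Q n) = rectI (fun z => f z - g z)%C (ra (Q n)) (rb (Q n)) (rc (Q n)) (rd (Q n))).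
  { rewrite rectI_minus by assumption. unfold g at 1. rewrite rectI_affine.
    unfold rI. ring. }
  apply (Rlt_irrefl (eps * size (Q n) ^ 2)).
  eapply Rlt_le_trans; [exact I8 |]. rewrite E.
  eapply Rle_trans.
  - apply (Cmod_rectI_le _ _ _ _ _ (eps / 2 * size (Q n))); [assumption | assumption | |].
    + intros s t Hs Ht. apply clim_minus; [now apply CF | now apply CG].
    + intros s t Hs Ht.
      assert (Z : Cmod ((s, t) - z0) <= size (Q n)).
      { eapply Rle_trans; [apply Cmod_le_abs |]. unfold z0, size; simpl.
        assert (Rabs (s + - x) <= rb (Q n) - ra (Q n)) by (apply Rabs_le; lra).
        assert (Rabs (t + - y) <= rd (Q n) - rc (Q n)) by (apply Rabs_le; lra). lra. }
      replace (f (s, t) - g (s, t))%C with (f (s, t) - f z0 - l * ((s, t) - z0))%C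
        by (unfold g; ring).
      eapply Rle_trans; [apply HD; lra |]. apply Rmult_le_compat_l; lra.
  - unfold size. apply Req_le. simpl pow. field.
Qed.

(** * Circle means and Cauchy's formula *)

Definition Cexp (z : C) : C := (exp (fst z) * cos (snd z), exp (fst z) * sin (snd z)).

Lemma Cexp_plus (z w : C) : Cexp (z + w) = (Cexp z * Cexp w)%C.
Proof.
  unfold Cexp; simpl. rewrite exp_plus, cos_plus, sin_plus.
  unfold Cmult; simpl. f_equal; ring.
Qed.

Lemma Cmod_Cexp (z : C) : Cmod (Cexp z) = exp (fst z).
Proof.
  unfold Cmod, Cexp; simpl.
  replace (exp (fst z) * cos (snd z) * (exp (fst z) * cos (snd z) * 1) +
           exp (fst z) * sin (snd z) * (exp (fst z) * sin (snd z) * 1))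
    with (exp (fst z) * exp (fst z) * (Rsqr (sin (snd z)) + Rsqr (cos (snd z))))
    by (unfold Rsqr; ring).
  rewrite sin2_cos2, Rmult_1_r. apply sqrt_square. left. apply exp_pos.
Qed.

Lemma derivable_pt_lim_0_eps (f : R -> R) (l : R) :
  derivable_pt_lim f 0 l ->
  forall eps, 0 < eps -> exists d, 0 < d /\
    forall x, Rabs x < d -> Rabs (f x - f 0 - l * x) <= eps * Rabs x.
Proof.
  intros H eps He. destruct (H eps He) as [d Hd]. exists d. split; [apply cond_pos |].
  intros x Hx. destruct (Req_dec x 0) as [-> | N].
  - rewrite Rabs_R0. replace (f 0 - f 0 - l * 0) with 0 by ring. rewrite Rabs_R0. lra.
  - specialize (Hd x N Hx). rewrite Rplus_0_l in Hd.
    replace (f x - f 0 - l * x) with (((f x - f 0) / x - l) * x) by (field; exact N).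
    rewrite Rabs_mult. apply Rmult_le_compat_r; [apply Rabs_pos | lra].
Qed.

Lemma cder_Cexp_0 : cder Cexp (RtoC 0) (RtoC 1).
Proof.
  rewrite cder_eps. intros eps0 He0.
  (* The four error terms below contribute 1 + 3 + 3 + 2 multiples of eps |z|: the remainder of exp,
     those of cos and sin weighted by exp x <= 3, and the product (exp x - 1) y. *)
  set (eps := Rmin 1 (eps0 / 9)).
  assert (He : 0 < eps) by (apply Rmin_pos; lra).
  assert (E1 : eps <= 1) by apply Rmin_l.
  assert (E2 : eps <= eps0 / 9) by apply Rmin_r.
  clearbody eps.
  destruct (derivable_pt_lim_0_eps exp 1) with (eps := eps) as [d1 [D1 H1]].
  { rewrite <- exp_0. apply derivable_pt_lim_exp. } { exact He. }
  destruct (derivable_pt_lim_0_eps cos 0) with (eps := eps) as [d2 [D2 H2]].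
  { replace 0 with (- sin 0) at 2 by (rewrite sin_0; ring). apply derivable_pt_lim_cos. }
  { exact He. }
  destruct (derivable_pt_lim_0_eps sin 1) with (eps := eps) as [d3 [D3 H3]].
  { rewrite <- cos_0. apply derivable_pt_lim_sin. } { exact He. }
  exists (Rmin (Rmin d1 d2) (Rmin d3 eps)). split.
  { repeat apply Rmin_pos; assumption. }
  intros z Hz. replace (z - 0)%C with z in * by ring.
  destruct z as [x y].
  assert (X := re_le_Cmod (x, y)). assert (Y := snd_le_Cmod (x, y)). simpl in X, Y.
  assert (Z := Rmin_l (Rmin d1 d2) (Rmin d3 eps)).
  assert (Z' := Rmin_r (Rmin d1 d2) (Rmin d3 eps)).
  assert (Z1 := Rmin_l d1 d2). assert (Z2 := Rmin_r d1 d2).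
  assert (Z3 := Rmin_l d3 eps). assert (Z4 := Rmin_r d3 eps).
  specialize (H1 x ltac:(lra)). specialize (H2 y ltac:(lra)). specialize (H3 y ltac:(lra)).
  rewrite exp_0 in H1. rewrite cos_0 in H2. rewrite sin_0 in H3.
  assert (P := Rabs_pos x). assert (P' := Rabs_pos y).
  assert (A1 : Rabs (exp x - 1) <= 2 * Rabs x).
  { replace (exp x - 1) with ((exp x - 1 - 1 * x) + x) by ring.
    eapply Rle_trans; [apply Rabs_triang |]. nra. }
  assert (A2 : exp x <= 3).
  { assert (A := Rle_abs (exp x - 1)). lra. }
  assert (A0 := exp_pos x).
  eapply Rle_trans; [apply Cmod_le_abs |]. simpl. rewrite cos_0, sin_0, exp_0.
  replace (exp x * cos y + - (1 * 1) + - (1 * x - 0 * y))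
    with ((exp x - 1 - 1 * x) + exp x * (cos y - 1 - 0 * y)) by ring.
  replace (exp x * sin y + - (1 * 0) + - (1 * y + 0 * x))
    with (exp x * (sin y - 0 - 1 * y) + (exp x - 1) * y) by ring.
  assert (T1 := Rabs_triang (exp x - 1 - 1 * x) (exp x * (cos y - 1 - 0 * y))).
  assert (T2 := Rabs_triang (exp x * (sin y - 0 - 1 * y)) ((exp x - 1) * y)).
  rewrite !Rabs_mult, (Rabs_pos_eq (exp x)) in T1 by lra.
  rewrite !Rabs_mult, (Rabs_pos_eq (exp x)) in T2 by lra.
  assert (B1 : exp x * Rabs (cos y - 1 - 0 * y) <= 3 * (eps * Rabs y))
    by (apply Rmult_le_compat; try apply Rabs_pos; lra).
  assert (B2 : exp x * Rabs (sin y - 0 - 1 * y) <= 3 * (eps * Rabs y))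
    by (apply Rmult_le_compat; try apply Rabs_pos; lra).
  assert (B3 : Rabs (exp x - 1) * Rabs y <= (2 * eps) * Rabs y).
  { apply Rmult_le_compat_r; lra. }
  set (m := Cmod (x, y)) in *.
  assert (C1 : eps * Rabs x <= eps * m) by (apply Rmult_le_compat_l; lra).
  assert (C2 : eps * Rabs y <= eps * m) by (apply Rmult_le_compat_l; lra).
  assert (C3 : eps * m <= eps0 / 9 * m) by (apply Rmult_le_compat_r; lra).
  lra.
Qed.

Lemma cder_Cexp (z : C) : cder Cexp z (Cexp z).
Proof.
  apply (cder_ext (fun w => Cexp z * Cexp (w - z))%C).
  - intros w. rewrite <- Cexp_plus. f_equal. ring.
  - apply (cder_eq _ z (Cexp z * ((1 - 0) * 1))%C); [| ring].
    apply cder_scal. apply (cder_comp Cexp (fun w => w - z)%C).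
    + replace (z - z)%C with (RtoC 0) by ring. apply cder_Cexp_0.
    + apply cder_minus; [apply cder_id | apply cder_const].
Qed.

Definition circ (r t : R) : C := (r * cos t, r * sin t).

Lemma circ_Cexp (r t : R) : 0 < r -> circ r t = Cexp (ln r, t).
Proof. intros Hr. unfold circ, Cexp; simpl. now rewrite exp_ln. Qed.

Lemma Cmod_circ (r t : R) : 0 <= r -> Cmod (circ r t) = r.
Proof.
  intros Hr. unfold circ, Cmod; simpl.
  replace (r * cos t * (r * cos t * 1) + r * sin t * (r * sin t * 1))
    with (r * r * (Rsqr (sin t) + Rsqr (cos t))) by (unfold Rsqr; ring).
  rewrite sin2_cos2, Rmult_1_r. now apply sqrt_square.
Qed.

Lemma circ_neq_0 (r t : R) : 0 < r -> circ r t <> 0.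
Proof. intros Hr. apply Cmod_gt_0. rewrite Cmod_circ; lra. Qed.

Lemma circ_conj (r t : R) : 0 < r -> Cconj (circ r t) = (RtoC (r * r) / circ r t)%C.
Proof.
  intros Hr. assert (N := circ_neq_0 r t Hr).
  assert (E := Cmod2_conj (circ r t)). rewrite Cmod_circ in E by lra.
  replace (RtoC (r * r)) with (circ r t * Cconj (circ r t))%C.
  - field. exact N.
  - rewrite <- E. f_equal. ring.
Qed.

Lemma clim_circ {T} {F : (T -> Prop) -> Prop} {FF : Filter F} (r t : T -> R) (a b : R) :
  filterlim r F (locally a) -> filterlim t F (locally b) ->
  clim F (fun x => circ (r x) (t x)) (circ a b).
Proof.
  intros Hr Ht. unfold circ. apply clim_pair.
  - eapply (filterlim_comp_2 (G := locally a) (H := locally (cos b))); [exact Hr | | ].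
    + eapply filterlim_comp; [exact Ht |]. apply continuous_cos.
    + apply (filterlim_mult (K := R_AbsRing) a (cos b)).
  - eapply (filterlim_comp_2 (G := locally a) (H := locally (sin b))); [exact Hr | | ].
    + eapply filterlim_comp; [exact Ht |]. apply continuous_sin.
    + apply (filterlim_mult (K := R_AbsRing) a (sin b)).
Qed.

Lemma pcont_circ (r t : R) : pcont (circ r) t.
Proof. apply (clim_circ (fun _ => r) (fun t => t)); [apply filterlim_const | apply filterlim_id]. Qed.

Lemma pcont_comp (h : C -> C) (g : R -> C) (t : R) :
  ccont h (g t) -> pcont g t -> pcont (fun s => h (g s)) t.
Proof. intros H G. now apply (clim_comp h g). Qed.

Definition Cmean (h : R -> C) : C := (RtoC (/ (2 * PI)) * CI h 0 (2 * PI))%C.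

Definition Rmean (u : R -> R) : R := RInt u 0 (2 * PI) / (2 * PI).

Lemma two_PI_pos : 0 < 2 * PI.
Proof. assert (H := PI_RGT_0). lra. Qed.

Lemma exC_all (h : R -> C) (a b : R) : (forall t, pcont h t) -> exC h a b.
Proof. intros H. apply exC_pcont. auto. Qed.

Lemma Cmean_ext (h k : R -> C) : (forall t, h t = k t) -> Cmean h = Cmean k.
Proof. intros E. unfold Cmean. f_equal. apply CI_ext. auto. Qed.

Lemma Cmean_const (c : C) : Cmean (fun _ => c) = c.
Proof.
  unfold Cmean. rewrite CI_const. assert (H := two_PI_pos).
  rewrite Cmult_assoc, <- RtoC_mult.
  replace (/ (2 * PI) * (2 * PI - 0)) with 1 by (field; lra). ring.
Qed.

Section CmeanLin.
Variables (h k : R -> C).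
Hypotheses (Hh : forall t, pcont h t) (Hk : forall t, pcont k t).

Lemma Cmean_plus : Cmean (fun t => h t + k t)%C = (Cmean h + Cmean k)%C.
Proof. unfold Cmean. rewrite CI_plus by now apply exC_all. ring. Qed.

Lemma Cmean_minus : Cmean (fun t => h t - k t)%C = (Cmean h - Cmean k)%C.
Proof. unfold Cmean. rewrite CI_minus by now apply exC_all. ring. Qed.

Lemma Cmean_scal (c : C) : Cmean (fun t => c * h t)%C = (c * Cmean h)%C.
Proof. unfold Cmean. rewrite CI_scal by now apply exC_all. ring. Qed.

Lemma Cmean_conj : Cmean (fun t => Cconj (h t)) = Cconj (Cmean h).
Proof.
  unfold Cmean. rewrite CI_conj by now apply exC_all.
  rewrite Cmult_conj. f_equal. unfold Cconj, RtoC; simpl. f_equal. ring.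
Qed.

Lemma Cmod_Cmean_le (u : R -> R) :
  ex_RInt u 0 (2 * PI) -> (forall t, Cmod (h t) <= u t) -> Cmod (Cmean h) <= Rmean u.
Proof.
  intros U B. assert (H := two_PI_pos). unfold Cmean, Rmean.
  rewrite Cmod_mult, Cmod_R, Rabs_pos_eq by (left; now apply Rinv_0_lt_compat).
  unfold Rdiv. rewrite Rmult_comm. apply Rmult_le_compat_r.
  - left. now apply Rinv_0_lt_compat.
  - apply Cmod_CI_le; [lra | now apply exC_all | exact U | auto].
Qed.

End CmeanLin.

Lemma Cmean_annulus (f : C -> C) (r1 r2 : R) :
  0 < r1 -> r1 <= r2 ->
  (forall z, r1 <= Cmod z <= r2 -> exists l, cder f z l) ->
  Cmean (fun t => f (circ r1 t)) = Cmean (fun t => f (circ r2 t)).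
Proof.
  intros H1 H2 D. assert (PP := two_PI_pos).
  assert (L : ln r1 <= ln r2).
  { destruct H2 as [H2 | ->]; [left; now apply ln_increasing | lra]. }
  assert (G := goursat (fun w => f (Cexp w)) (ln r1) (ln r2) 0 (2 * PI) L ltac:(lra)).
  unfold rectI in G.
  (* The horizontal sides cancel because [Cexp] has period 2 pi in the imaginary direction; what
     remains is i times the difference of the two circle integrals. *)
  rewrite (CI_ext (fun x => f (Cexp (x, 2 * PI))) (fun x => f (Cexp (x, 0)))) in G.
  2:{ intros x _. f_equal. unfold Cexp; simpl. now rewrite cos_2PI, sin_2PI, cos_0, sin_0. }
  rewrite (CI_ext (fun y => f (Cexp (ln r2, y))) (fun t => f (circ r2 t))) in G
    by (intros; now rewrite circ_Cexp by lra).
  rewrite (CI_ext (fun y => f (Cexp (ln r1, y))) (fun t => f (circ r1 t))) in G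
    by (intros; now rewrite circ_Cexp by lra).
  unfold Cmean. f_equal.
  set (A := CI (fun t => f (circ r1 t)) _ _) in *. set (B := CI (fun t => f (circ r2 t)) _ _) in *.
  set (X := CI (fun x => f (Cexp (x, 0))) _ _) in *.
  assert (E : (Ci * (B - A))%C = RtoC 0).
  { rewrite <- G.
    - ring.
    - intros x y Hx Hy. destruct (D (Cexp (x, y))) as [l Hl].
      + rewrite Cmod_Cexp; simpl. rewrite <- (exp_ln r1), <- (exp_ln r2) by lra.
        destruct Hx as [[I | I] [J | J]]; split;
          try (left; now apply exp_increasing); rewrite ?I, ?J; lra.
      + eexists. apply (cder_comp f Cexp); [exact Hl | apply cder_Cexp]. }
  replace B with (A + - Ci * (Ci * (B - A)))%C.
  - rewrite E. ring.
  - replace (- Ci * (Ci * (B - A)))%C with (- (Ci * Ci) * (B - A))%C by ring.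
    replace (Ci * Ci)%C with (- RtoC 1)%C; [ring |].
    unfold Ci, Cmult, RtoC, Copp; simpl. f_equal; ring.
Qed.

Lemma Cmod_circ_abs (r t : R) : Cmod (circ r t) = Rabs r.
Proof.
  destruct (Rle_lt_dec 0 r) as [H | H].
  - rewrite Cmod_circ, Rabs_pos_eq; auto.
  - rewrite Rabs_left by exact H. rewrite <- (Cmod_circ (- r) t) by lra.
    rewrite <- Cmod_opp. f_equal. unfold circ, Copp; simpl. f_equal; ring.
Qed.

(** Compactness of the interval of angles makes the continuity in the radius uniform in t; it is
    applied to each real coordinate. *)
Lemma circle_unif_cont (h : C -> C) (s0 : R) :
  (forall t, ccont h (circ s0 t)) ->
  forall eps, 0 < eps -> exists d, 0 < d /\ forall s t, Rabs (s - s0) < d ->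
    0 <= t <= 2 * PI -> Cmod (h (circ s t) - h (circ s0 t)) < eps.
Proof.
  intros H eps He.
  assert (C2 : forall t, clim (locally ((s0, t) : R * R)) (fun z => h (circ (fst z) (snd z))) (h (circ s0 t))).
  { intros t. apply (clim_comp h); [apply H |]. apply clim_circ.
    - apply (continuous_fst (s0 : R_UniformSpace) (t : R_UniformSpace)).
    - apply (continuous_snd (s0 : R_UniformSpace) (t : R_UniformSpace)). }
  assert (He2 : 0 < eps / 2) by lra.
  destruct (uniform_continuity_2d_1d' (fun s t => fst (h (circ s t))) 0 (2 * PI) s0) with (eps := mkposreal _ He2) as [d1 D1].
  { intros t _. apply continuity_2d_pt_filterlim. apply (clim_fst _ _ (C2 t)). }
  destruct (uniform_continuity_2d_1d' (fun s t => snd (h (circ s t))) 0 (2 * PI) s0) with (eps := mkposreal _ He2) as [d2 D2].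
  { intros t _. apply continuity_2d_pt_filterlim. apply (clim_snd _ _ (C2 t)). }
  exists (Rmin d1 d2). split; [apply Rmin_pos; apply cond_pos |].
  intros s t Hs Ht.
  assert (S1 : Rabs (s - s0) < d1) by (eapply Rlt_le_trans; [exact Hs | apply Rmin_l]).
  assert (S2 : Rabs (s - s0) < d2) by (eapply Rlt_le_trans; [exact Hs | apply Rmin_r]).
  assert (P1 := cond_pos d1). assert (P2 := cond_pos d2).
  apply Rabs_def2 in S1. apply Rabs_def2 in S2.
  specialize (D1 t s0 t s Ht ltac:(lra) Ht ltac:(lra)).
  specialize (D2 t s0 t s Ht ltac:(lra) Ht ltac:(lra)).
  replace (t - t) with 0 in * by ring. rewrite Rabs_R0 in *.
  specialize (D1 P1). specialize (D2 P2). simpl in D1, D2.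
  eapply Rle_lt_trans; [apply Cmod_le_abs |]. simpl. unfold Rminus in *. lra.
Qed.

Lemma pcont_on_circ (h : C -> C) (r : R) :
  (forall t, ccont h (circ r t)) -> forall t, pcont (fun s => h (circ r s)) t.
Proof. intros H t. apply pcont_comp; [apply H | apply pcont_circ]. Qed.

Lemma Cmean_circ_cont (h : C -> C) (r s0 : R) :
  (forall z, Cmod z < r -> ccont h z) -> Rabs s0 < r ->
  clim (locally s0) (fun s => Cmean (fun t => h (circ s t))) (Cmean (fun t => h (circ s0 t))).
Proof.
  intros H S eps He.
  destruct (circle_unif_cont h s0) with (eps := eps / 2) as [d [Hd D]].
  { intros t. apply H. now rewrite Cmod_circ_abs. } { lra. }
  assert (HE : 0 < Rmin d (r - Rabs s0)) by (apply Rmin_pos; lra).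
  exists (mkposreal _ HE). refine (fun (s : R) B => _).
  change (Rabs (s - s0) < Rmin d (r - Rabs s0)) in B.
  assert (B1 : Rabs (s - s0) < d) by (eapply Rlt_le_trans; [exact B | apply Rmin_l]).
  assert (B2 : Rabs (s - s0) < r - Rabs s0) by (eapply Rlt_le_trans; [exact B | apply Rmin_r]).
  assert (B3 := Rabs_triang (s - s0) s0). replace (s - s0 + s0) with s in B3 by ring.
  assert (X1 : exC (fun t => h (circ s t)) 0 (2 * PI)).
  { apply exC_all, pcont_on_circ. intros t. apply H. rewrite Cmod_circ_abs. lra. }
  assert (X2 : exC (fun t => h (circ s0 t)) 0 (2 * PI)).
  { apply exC_all, pcont_on_circ. intros t. apply H. rewrite Cmod_circ_abs. lra. }
  assert (PP := two_PI_pos).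
  unfold Cmean.
  replace (RtoC (/ (2 * PI)) * CI (fun t => h (circ s t)) 0 (2 * PI) -
           RtoC (/ (2 * PI)) * CI (fun t => h (circ s0 t)) 0 (2 * PI))%C
    with (RtoC (/ (2 * PI)) * CI (fun t => h (circ s t) - h (circ s0 t))%C 0 (2 * PI))%C
    by (rewrite CI_minus by assumption; ring).
  rewrite Cmod_mult, Cmod_R, Rabs_pos_eq by (left; now apply Rinv_0_lt_compat).
  apply Rle_lt_trans with (/ (2 * PI) * ((2 * PI - 0) * (eps / 2))).
  - apply Rmult_le_compat_l; [left; now apply Rinv_0_lt_compat |].
    apply Cmod_CI_le_const; [lra | now apply exC_minus |].
    intros t Ht. left. apply D; lra.
  - replace (/ (2 * PI) * ((2 * PI - 0) * (eps / 2))) with (eps / 2) by (field; lra). lra.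
Qed.

Lemma clim_eq_approx (M : R -> C) (a : R) (c : C) :
  clim (locally a) M (M a) ->
  (forall d, 0 < d -> exists s, Rabs (s - a) < d /\ M s = c) -> M a = c.
Proof.
  intros H A.
  destruct (Req_dec (Cmod (M a - c)) 0) as [E | N].
  - apply Cmod_eq_0 in E. replace (M a) with ((M a - c) + c)%C by ring. rewrite E. ring.
  - exfalso. assert (P := Cmod_ge_0 (M a - c)).
    destruct (H (Cmod (M a - c)) ltac:(lra)) as [d D].
    destruct (A d (cond_pos d)) as [s [S <-]]. specialize (D s S).
    rewrite Cmod_sym in D. lra.
Qed.

(* Circle means are locally constant away from the radius [sg] by [Cmean_annulus],
   and continuity carries the constant across [sg] and down to the centre. *)
Lemma Cmean_const_radius (h : C -> C) (r sg rho : R) :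
  (forall z, Cmod z < r -> ccont h z) ->
  (forall z, Cmod z < r -> Cmod z <> sg -> exists l, cder h z l) ->
  0 <= rho < r -> Cmean (fun t => h (circ rho t)) = h (RtoC 0).
Proof.
  intros HC HD Hr. set (M := fun s => Cmean (fun t => h (circ s t))).
  assert (M0 : M 0 = h (RtoC 0)).
  { unfold M. rewrite (Cmean_ext _ (fun _ => h (RtoC 0))); [apply Cmean_const |].
    intros t. f_equal. unfold circ, RtoC. f_equal; ring. }
  assert (CM : forall s, Rabs s < r -> clim (locally s) M (M s))
    by (intros s S; now apply (Cmean_circ_cont h r)).
  assert (An : forall s1 s2, 0 < s1 -> s1 <= s2 -> s2 < r -> (s2 < sg \/ sg < s1) -> M s1 = M s2).
  { intros s1 s2 A B D E. apply Cmean_annulus; [lra | lra |].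
    intros z Z. apply HD; lra. }
  assert (Below : forall s, 0 < s < r -> (s < sg \/ sg <= 0) -> M 0 = M s).
  { intros s S E. apply clim_eq_approx; [apply CM; rewrite Rabs_R0; lra |].
    intros d Hd. exists (Rmin (d / 2) s).
    assert (A1 := Rmin_l (d / 2) s). assert (A2 := Rmin_r (d / 2) s).
    assert (A3 : 0 < Rmin (d / 2) s) by (apply Rmin_pos; lra).
    split; [rewrite Rabs_pos_eq; lra |]. apply An; lra. }
  change (M rho = h (RtoC 0)). rewrite <- M0.
  destruct (Req_dec rho 0) as [-> | N]; [reflexivity |].
  destruct (Rlt_le_dec rho sg) as [L | L]; [symmetry; apply Below; lra |].
  destruct (Rle_lt_dec sg 0) as [K | K]; [symmetry; apply Below; lra |].
  assert (E1 : M sg = M 0).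
  { rewrite (Below (sg / 2)) by lra.
    apply clim_eq_approx; [apply CM; rewrite Rabs_pos_eq; lra |].
    intros d Hd. exists (Rmax (sg - d / 2) (sg / 2)).
    assert (A1 := Rmax_l (sg - d / 2) (sg / 2)). assert (A2 := Rmax_r (sg - d / 2) (sg / 2)).
    assert (A3 : Rmax (sg - d / 2) (sg / 2) < sg) by (apply Rmax_lub_lt; lra).
    split; [rewrite Rabs_left; lra |]. symmetry. apply An; lra. }
  destruct (Req_dec rho sg) as [-> | N2]; [exact E1 |].
  rewrite <- E1. symmetry.
  apply clim_eq_approx; [apply CM; rewrite Rabs_pos_eq; lra |].
  intros d Hd. exists (Rmin (sg + d / 2) rho).
  assert (A1 := Rmin_l (sg + d / 2) rho). assert (A2 := Rmin_r (sg + d / 2) rho).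
  assert (A3 : sg < Rmin (sg + d / 2) rho) by (apply Rmin_glb_lt; lra).
  split; [rewrite Rabs_pos_eq; lra |]. apply An; lra.
Qed.

Lemma Cmean_value (h : C -> C) (r rho : R) :
  (forall z, Cmod z < r -> exists l, cder h z l) -> 0 <= rho < r ->
  Cmean (fun t => h (circ rho t)) = h (RtoC 0).
Proof.
  (* A negative exceptional radius stands for no exceptional circle. *)
  intros H. apply (Cmean_const_radius h r (-1)).
  - intros z Hz. destruct (H z Hz) as [l Hl]. now apply cder_ccont in Hl.
  - intros z Hz _. now apply H.
Qed.

Lemma circ_sub_neq_0 (rho t : R) (zeta : C) : Cmod zeta < rho -> (circ rho t - zeta)%C <> 0.
Proof.
  intros H. apply Cmod_gt_0. assert (P := Cmod_ge_0 zeta).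
  assert (A := Cmod_lower (circ rho t) zeta). rewrite Cmod_circ in A; lra.
Qed.

Lemma pcont_cauchy_kernel (rho : R) (zeta : C) : Cmod zeta < rho ->
  forall t, pcont (fun t => circ rho t / (circ rho t - zeta))%C t.
Proof.
  intros H t. apply clim_div.
  - now apply circ_sub_neq_0.
  - apply pcont_circ.
  - apply clim_minus; [apply pcont_circ | apply clim_const].
Qed.

(* On the circle the conjugate of the Cauchy kernel is rho^2 / (rho^2 - conj(zeta) z),
   holomorphic inside. *)
Lemma cauchy_conj (f : C -> C) (r rho : R) (zeta : C) :
  (forall z, Cmod z < r -> exists l, cder f z l) -> Cmod zeta < rho < r ->
  Cmean (fun t => circ rho t / (circ rho t - zeta) * Cconj (f (circ rho t)))%C
  = Cconj (f (RtoC 0)).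
Proof.
  intros H Hr. assert (P := Cmod_ge_0 zeta).
  (* A radius strictly between rho and the modulus rho^2/|zeta| of the pole; this form stays
     meaningful when zeta = 0. *)
  set (r2 := 2 * (rho * rho) / (Cmod zeta + rho)).
  set (k := fun z => (RtoC (rho * rho) / (RtoC (rho * rho) - Cconj zeta * z) * f z)%C).
  assert (R2 : rho < r2).
  { unfold r2. apply Rmult_lt_reg_r with (Cmod zeta + rho); [lra |].
    unfold Rdiv. rewrite Rmult_assoc, Rinv_l by lra. nra. }
  assert (Rpos : 0 < rho * rho) by nra.
  assert (K0 : forall z, Cmod z < r2 -> (RtoC (rho * rho) - Cconj zeta * z)%C <> 0).
  { intros z Z. apply Cmod_gt_0.
    assert (A := Cmod_lower (RtoC (rho * rho)) (Cconj zeta * z)).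
    rewrite Cmod_mult, Cmod_conj, Cmod_R, Rabs_pos_eq in A by lra.
    assert (B : Cmod zeta * Cmod z <= Cmod zeta * r2) by (apply Rmult_le_compat_l; lra).
    assert (B2 : Cmod zeta * r2 < rho * rho).
    { unfold r2. apply Rmult_lt_reg_r with (Cmod zeta + rho); [lra |].
      replace (Cmod zeta * (2 * (rho * rho) / (Cmod zeta + rho)) * (Cmod zeta + rho))
        with (2 * Cmod zeta * (rho * rho)) by (field; lra). nra. }
    lra. }
  assert (KD : forall z, Cmod z < Rmin r r2 -> exists l, cder k z l).
  { intros z Z.
    assert (Z1 : Cmod z < r) by (eapply Rlt_le_trans; [exact Z | apply Rmin_l]).
    assert (Z2 : Cmod z < r2) by (eapply Rlt_le_trans; [exact Z | apply Rmin_r]).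
    destruct (H z Z1) as [l Hl]. eexists. apply cder_mult; [| exact Hl].
    apply cder_div; [now apply K0 | apply cder_const |].
    apply cder_minus; [apply cder_const | apply cder_scal, cder_id]. }
  assert (RM : rho < Rmin r r2) by (apply Rmin_glb_lt; lra).
  assert (E : Cmean (fun t => k (circ rho t)) = k (RtoC 0))
    by (apply (Cmean_value k (Rmin r r2)); [exact KD | lra]).
  assert (CK : forall t, pcont (fun t => k (circ rho t)) t).
  { apply pcont_on_circ. intros t.
    destruct (KD (circ rho t)) as [l Hl]; [rewrite Cmod_circ; lra |].
    now apply cder_ccont in Hl. }
  transitivity (Cconj (k (RtoC 0))).
  - rewrite <- E, <- Cmean_conj by exact CK. apply Cmean_ext. intros t. unfold k.
    rewrite Cmult_conj. f_equal.
    assert (N := circ_neq_0 rho t ltac:(lra)).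
    assert (N2 := circ_sub_neq_0 rho t zeta (proj1 Hr)).
    rewrite Cdiv_conj by (apply K0; rewrite Cmod_circ; lra).
    rewrite Cminus_conj, Cmult_conj, Cconj_conj, (circ_conj rho t) by lra.
    replace (Cconj (RtoC (rho * rho))) with (RtoC (rho * rho))
      by (unfold Cconj, RtoC; simpl; f_equal; ring).
    field. repeat split; try assumption.
    + replace (RtoC (rho * rho) * circ rho t - zeta * RtoC (rho * rho))%C
        with (RtoC (rho * rho) * (circ rho t - zeta))%C by ring.
      intros E'. apply (f_equal Cmod) in E'. rewrite Cmod_mult, Cmod_0, Cmod_R, Rabs_pos_eq in E' by lra.
      apply Cmod_gt_0 in N2. nra.
  - f_equal. unfold k. field. intros E'. injection E' as E'. lra.
Qed.

(** The difference quotient of [f] at zeta is continuous at zeta and differentiable elsewhere, which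
    is all that the constancy of circle means asks for. Its product with z has mean 0, and this is
    the formula once the kernel itself is known to have mean 1. *)
Theorem cauchy_formula (f : C -> C) (r rho : R) (zeta : C) :
  (forall z, Cmod z < r -> exists l, cder f z l) -> Cmod zeta < rho < r ->
  Cmean (fun t => circ rho t / (circ rho t - zeta) * f (circ rho t))%C = f zeta.
Proof.
  intros H Hr. assert (P := Cmod_ge_0 zeta).
  destruct (H zeta ltac:(lra)) as [l Hl].
  set (q := fun z => if excluded_middle_informative (z = zeta) then l
                     else ((f z - f zeta) / (z - zeta))%C).
  assert (Nz : forall z, z <> zeta -> (z - zeta)%C <> 0).
  { intros z N E. apply N. replace z with (z - zeta + zeta)%C by ring. rewrite E. ring. }
  assert (Q1 : forall z, Cmod z < r -> z <> zeta -> exists m, cder q z m).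
  { intros z Hz N. destruct (H z Hz) as [m Hm].
    assert (D := cder_div _ _ z _ _ (Nz z N) (cder_minus _ _ _ _ _ Hm (cder_const (f zeta) z))
                  (cder_minus _ _ _ _ _ (cder_id z) (cder_const zeta z))).
    eexists. refine (cder_ext_loc _ q z _ (Cmod (z - zeta)) _ _ D).
    - apply Cmod_gt_0. now apply Nz.
    - intros y Hy. unfold q. destruct excluded_middle_informative as [E | _]; [| reflexivity].
      subst y. rewrite Cmod_sym in Hy. lra. }
  assert (Q2 : ccont q zeta).
  { intros eps He. rewrite cder_eps in Hl. destruct (Hl (eps / 2) ltac:(lra)) as [d [Hd D]].
    exists d. split; [exact Hd |]. intros y Hy. unfold q.
    destruct (excluded_middle_informative (zeta = zeta)) as [_ | F]; [| now elim F].
    destruct excluded_middle_informative as [E | N].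
    - replace (l - l)%C with (RtoC 0) by ring. now rewrite Cmod_0.
    - specialize (D y Hy). assert (Py : 0 < Cmod (y - zeta)) by (apply Cmod_gt_0; now apply Nz).
      replace ((f y - f zeta) / (y - zeta) - l)%C
        with ((f y - f zeta - l * (y - zeta)) / (y - zeta))%C by (field; now apply Nz).
      rewrite Cmod_div by now apply Nz.
      apply Rle_lt_trans with (eps / 2); [| lra].
      apply Rmult_le_reg_r with (Cmod (y - zeta)); [exact Py |].
      unfold Rdiv at 1. rewrite Rmult_assoc, Rinv_l by lra. lra. }
  assert (Qc : forall z, Cmod z < r -> ccont q z).
  { intros z Hz. destruct (excluded_middle_informative (z = zeta)) as [-> | N]; [exact Q2 |].
    destruct (Q1 z Hz N) as [m Hm]. now apply cder_ccont in Hm. }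
  (* The only point where differentiability of [q] is unknown lies on the circle of radius |zeta|,
     taken as the exceptional one. *)
  assert (E : Cmean (fun t => circ rho t * q (circ rho t))%C = (RtoC 0 * q (RtoC 0))%C).
  { apply (Cmean_const_radius (fun z => z * q z)%C r (Cmod zeta)).
    - intros z Hz. apply clim_mult; [apply (cder_ccont _ _ _ (cder_id z)) | now apply Qc].
    - intros z Hz N. destruct (Q1 z Hz) as [m Hm]; [congruence |].
      eexists. apply cder_mult; [apply cder_id | exact Hm].
    - lra. }
  (* The normalisation of the kernel comes from the conjugate formula for the constant 1, so there
     is no circularity. *)
  assert (One := cauchy_conj (fun _ => RtoC 1) r rho zeta
    ltac:(intros; eexists; apply cder_const) Hr). simpl in One.
  assert (CF : forall t, pcont (fun t => f (circ rho t)) t).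
  { apply pcont_on_circ. intros t. destruct (H (circ rho t)) as [m Hm]; [rewrite Cmod_circ; lra |].
    now apply cder_ccont in Hm. }
  assert (K := pcont_cauchy_kernel rho zeta (proj1 Hr)).
  rewrite (Cmean_ext _ (fun t => circ rho t / (circ rho t - zeta) * f (circ rho t)
             - f zeta * (circ rho t / (circ rho t - zeta)))%C) in E.
  2:{ intros t. unfold q. assert (N := circ_sub_neq_0 rho t zeta (proj1 Hr)).
      destruct excluded_middle_informative as [F | _].
      - exfalso. apply N. rewrite F. ring.
      - field. exact N. }
  rewrite Cmean_minus in E.
  3:{ intros t. apply clim_mult; [apply clim_const | apply K]. }
  2:{ intros t. apply clim_mult; [apply K | apply CF]. }
  rewrite Cmean_scal in E by exact K.
  assert (C1 : Cconj (RtoC 1) = RtoC 1) by (unfold Cconj, RtoC; simpl; f_equal; ring).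
  rewrite C1 in One.
  rewrite (Cmean_ext _ (fun t => circ rho t / (circ rho t - zeta))%C) in One
    by (intros; ring).
  rewrite One in E.
  set (A := Cmean _) in *.
  replace A with ((A - f zeta * 1) + f zeta)%C by ring. rewrite E. ring.
Qed.

(** * Regularity of holomorphic functions on the disk *)

Lemma Cmod_Cmean_le_const_per (h : R -> C) (M : R) :
  (forall t, pcont h t) -> (forall t, 0 <= t <= 2 * PI -> Cmod (h t) <= M) -> Cmod (Cmean h) <= M.
Proof.
  intros H B. assert (PP := two_PI_pos). unfold Cmean.
  rewrite Cmod_mult, Cmod_R, Rabs_pos_eq by (left; now apply Rinv_0_lt_compat).
  apply Rle_trans with (/ (2 * PI) * ((2 * PI - 0) * M)).
  - apply Rmult_le_compat_l; [left; now apply Rinv_0_lt_compat |].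
    apply Cmod_CI_le_const; [lra | now apply exC_all |]. intros t Ht. apply B. lra.
  - apply Req_le. field. lra.
Qed.

Lemma pcont_bounded (h : R -> C) :
  (forall t, pcont h t) -> exists M, 0 < M /\ forall t, 0 <= t <= 2 * PI -> Cmod (h t) <= M.
Proof.
  intros H. assert (PP := two_PI_pos).
  destruct (continuity_ab_maj (fun t => Cmod (h t)) 0 (2 * PI)) as [m [Hm _]].
  - lra.
  - intros t _. apply continuity_pt_filterlim. apply (clim_Cmod h (h t) (H t)).
  - exists (Cmod (h m) + 1). split; [assert (P := Cmod_ge_0 (h m)); lra |].
    intros t Ht. specialize (Hm t Ht). lra.
Qed.

(** Differentiation under the integral sign; a quadratic remainder, uniform over one period,
    replaces any domination argument. *)
Lemma cder_Cmean (k : C -> R -> C) (k' : R -> C) (zeta : C) (M d : R) :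
  0 < d -> 0 <= M ->
  (forall y, Cmod (y - zeta) < d -> forall t, pcont (k y) t) ->
  (forall t, pcont k' t) ->
  (forall y, Cmod (y - zeta) < d -> forall t, 0 <= t <= 2 * PI ->
     Cmod (k y t - k zeta t - (y - zeta) * k' t) <= M * Cmod (y - zeta) ^ 2) ->
  cder (fun y => Cmean (k y)) zeta (Cmean k').
Proof.
  intros Hd HM Ck Ck' B. rewrite cder_eps. intros eps He.
  exists (Rmin d (eps / (M + 1))). split.
  { apply Rmin_pos; [exact Hd |]. apply Rdiv_lt_0_compat; lra. }
  intros y Hy.
  assert (Y1 : Cmod (y - zeta) < d) by (eapply Rlt_le_trans; [exact Hy | apply Rmin_l]).
  assert (Y2 : Cmod (y - zeta) < eps / (M + 1)) by (eapply Rlt_le_trans; [exact Hy | apply Rmin_r]).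
  assert (Z1 : Cmod (zeta - zeta) < d).
  { replace (zeta - zeta)%C with (RtoC 0) by ring. now rewrite Cmod_0. }
  assert (Q1 := Ck y Y1). assert (Q2 := Ck zeta Z1).
  assert (Q3 : forall t, pcont (fun t => k y t - k zeta t)%C t)
    by (intros t; apply clim_minus; [apply Q1 | apply Q2]).
  assert (Q4 : forall t, pcont (fun t => (y - zeta) * k' t)%C t)
    by (intros t; apply clim_mult; [apply clim_const | apply Ck']).
  rewrite <- Cmean_minus, (Cmult_comm (Cmean k')), <- Cmean_scal, <- Cmean_minus by assumption.
  eapply Rle_trans.
  - apply Cmod_Cmean_le_const_per.
    + intros t. apply clim_minus; [apply Q3 | apply Q4].
    + intros t Ht. apply (B y Y1 t Ht).
  - assert (P := Cmod_ge_0 (y - zeta)).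
    replace (M * Cmod (y - zeta) ^ 2) with (M * Cmod (y - zeta) * Cmod (y - zeta)) by ring.
    apply Rmult_le_compat_r; [exact P |].
    apply Rle_trans with ((M + 1) * (eps / (M + 1))).
    + apply Rmult_le_compat; lra.
    + apply Req_le. field. lra.
Qed.

Section CauchyTransform.
Variables (h : R -> C) (rho : R) (zeta : C).
Hypotheses (Hh : forall t, pcont h t) (Hz : Cmod zeta < rho).

(** Half the gap between zeta and the circle: for y within [d] of zeta all denominators keep modulus
    at least [d]. *)
Let d := (rho - Cmod zeta) / 2.

Lemma circ_sub_lower (y : C) (t : R) :
  Cmod (y - zeta) < d -> d <= Cmod (circ rho t - y) /\ (circ rho t - y)%C <> 0.
Proof.
  intros Y. assert (P := Cmod_ge_0 zeta).
  assert (A := Cmod_lower (circ rho t) y). rewrite Cmod_circ in A by lra.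
  assert (B := Cmod_lower y zeta).
  assert (d <= Cmod (circ rho t - y)) by (unfold d in *; lra).
  split; [assumption |]. apply Cmod_gt_0. unfold d in *; lra.
Qed.

Lemma pcont_circ_sub_pow (y : C) (n : nat) (t : R) : Cmod y < rho ->
  pcont (fun t => h t / (circ rho t - y) ^ n)%C t.
Proof.
  intros Y. apply clim_div.
  - apply Cpow_nz. now apply circ_sub_neq_0.
  - apply Hh.
  - apply clim_pow, clim_minus; [apply pcont_circ | apply clim_const].
Qed.

Lemma near_zeta (y : C) : Cmod (y - zeta) < d -> Cmod y < rho.
Proof. intros Y. assert (B := Cmod_lower y zeta). unfold d in *. lra. Qed.

Lemma Cmod_div_le (x y : C) (A B : R) :
  0 < B -> Cmod x <= A -> B <= Cmod y -> Cmod (x / y) <= A / B.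
Proof.
  intros HB Hx Hy. assert (P := Cmod_ge_0 x).
  rewrite Cmod_div by (apply Cmod_gt_0; lra).
  apply Rmult_le_compat; try lra.
  - left. apply Rinv_0_lt_compat. lra.
  - apply Rinv_le_contravar; lra.
Qed.

Lemma cder_cauchy_1 :
  cder (fun y => Cmean (fun t => h t / (circ rho t - y) ^ 1)%C) zeta
       (Cmean (fun t => h t / (circ rho t - zeta) ^ 2)%C).
Proof.
  destruct (pcont_bounded h Hh) as [M [HM B]].
  assert (Hd : 0 < d) by (unfold d; lra).
  assert (D3 : 0 < d * (d * d)) by (repeat apply Rmult_lt_0_compat; lra).
  assert (Z0 : Cmod (zeta - zeta) < d).
  { replace (zeta - zeta)%C with (RtoC 0) by ring. now rewrite Cmod_0. }
  apply (cder_Cmean (fun y t => h t / (circ rho t - y) ^ 1)%C _ _ (M / (d * (d * d))) d).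
  - exact Hd.
  - apply Rlt_le, Rdiv_lt_0_compat; assumption.
  - intros y Y t. apply pcont_circ_sub_pow. now apply near_zeta.
  - intros t. now apply pcont_circ_sub_pow.
  - intros y Y t Ht. destruct (circ_sub_lower y t Y) as [Y1 Y2].
    destruct (circ_sub_lower zeta t Z0) as [Z1 Z2].
    replace (h t / (circ rho t - y) ^ 1 - h t / (circ rho t - zeta) ^ 1
             - (y - zeta) * (h t / (circ rho t - zeta) ^ 2))%C
      with ((h t / ((circ rho t - y) * ((circ rho t - zeta) * (circ rho t - zeta))))
            * (y - zeta) ^ 2)%C by (field; auto).
    rewrite Cmod_mult, Cmod_pow. apply Rmult_le_compat_r; [apply pow2_ge_0 |].
    apply Cmod_div_le; [exact D3 | now apply B |].
    rewrite !Cmod_mult. repeat apply Rmult_le_compat; try lra. nra.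
Qed.

Lemma ex_cder_cauchy_2 :
  exists l, cder (fun y => Cmean (fun t => h t / (circ rho t - y) ^ 2)%C) zeta l.
Proof.
  destruct (pcont_bounded h Hh) as [M [HM B]].
  assert (P := Cmod_ge_0 zeta).
  assert (Hd : 0 < d) by (unfold d; lra).
  assert (D5 : 0 < (d * d) * (d * (d * d))) by (repeat apply Rmult_lt_0_compat; lra).
  assert (Z0 : Cmod (zeta - zeta) < d).
  { replace (zeta - zeta)%C with (RtoC 0) by ring. now rewrite Cmod_0. }
  exists (Cmean (fun t => 2 * (h t / (circ rho t - zeta) ^ 3))%C).
  (* The factor 8 rho generously bounds 3 (c - zeta) - 2 (y - zeta) for c on the circle, the factor
     left over once (y - zeta)^2 is taken out of the remainder. *)
  assert (MP : 0 < M * (8 * rho)) by (apply Rmult_lt_0_compat; lra).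
  apply (cder_Cmean (fun y t => h t / (circ rho t - y) ^ 2)%C _ _
           (M * (8 * rho) / ((d * d) * (d * (d * d)))) d).
  - exact Hd.
  - apply Rlt_le, Rdiv_lt_0_compat; assumption.
  - intros y Y t. apply pcont_circ_sub_pow. now apply near_zeta.
  - intros t. apply clim_mult; [apply clim_const | now apply pcont_circ_sub_pow].
  - intros y Y t Ht. destruct (circ_sub_lower y t Y) as [Y1 Y2].
    destruct (circ_sub_lower zeta t Z0) as [Z1 Z2].
    replace (h t / (circ rho t - y) ^ 2 - h t / (circ rho t - zeta) ^ 2
             - (y - zeta) * (2 * (h t / (circ rho t - zeta) ^ 3)))%C
      with ((h t * (3 * (circ rho t - zeta) - 2 * (y - zeta))
             / (((circ rho t - y) * (circ rho t - y)) *
                ((circ rho t - zeta) * ((circ rho t - zeta) * (circ rho t - zeta)))))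
            * (y - zeta) ^ 2)%C by (field; auto).
    rewrite Cmod_mult, Cmod_pow. apply Rmult_le_compat_r; [apply pow2_ge_0 |].
    apply Cmod_div_le; [exact D5 | |].
    + rewrite Cmod_mult. apply Rmult_le_compat; try apply Cmod_ge_0; [now apply B |].
      unfold Cminus at 1. eapply Rle_trans; [apply Cmod_triangle |].
      rewrite Cmod_opp, !Cmod_mult, !Cmod_R, !Rabs_pos_eq by lra.
      assert (A := Cmod_triangle (circ rho t) (- zeta)).
      rewrite Cmod_opp, Cmod_circ in A by lra. unfold Cminus in *. unfold d in *. lra.
    + rewrite !Cmod_mult. repeat apply Rmult_le_compat; try nra.
Qed.

End CauchyTransform.

Lemma holo_cont (f : C -> C) (z : C) : holomorphic_on_D f -> Cmod z < 1 -> ccont f z.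
Proof. intros H Z. destruct (H z Z) as [l Hl]. now apply cder_ccont in Hl. Qed.

Lemma holo_pcont (f : C -> C) (r : R) : holomorphic_on_D f -> 0 <= r < 1 ->
  forall t, pcont (fun t => f (circ r t)) t.
Proof. intros H Hr. apply pcont_on_circ. intros t. apply holo_cont; [exact H |]. rewrite Cmod_circ; lra. Qed.

Lemma Cderiv_correct (f : C -> C) (z : C) :
  (exists l, cder f z l) -> cder f z (Cderiv f z).
Proof. intros H. unfold Cderiv. now apply epsilon_spec. Qed.

Lemma Cderiv_unique (f : C -> C) (z l : C) : cder f z l -> Cderiv f z = l.
Proof. intros H. apply (cder_unique f z); [apply Cderiv_correct; now exists l | exact H]. Qed.

Lemma cauchy_transform_eq (f : C -> C) (rho : R) (y : C) :
  holomorphic_on_D f -> Cmod y < rho < 1 ->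
  f y = Cmean (fun t => circ rho t * f (circ rho t) / (circ rho t - y) ^ 1)%C.
Proof.
  intros H Y. rewrite <- (cauchy_formula f 1 rho y H Y). apply Cmean_ext. intros t.
  assert (N := circ_sub_neq_0 rho t y (proj1 Y)). field. exact N.
Qed.

Lemma holo_pcont_mul (f : C -> C) (rho : R) : holomorphic_on_D f -> 0 <= rho < 1 ->
  forall t, pcont (fun t => circ rho t * f (circ rho t))%C t.
Proof. intros H Hr t. apply clim_mult; [apply pcont_circ | now apply holo_pcont]. Qed.

Lemma Cderiv_cauchy (f : C -> C) (rho : R) (y : C) :
  holomorphic_on_D f -> Cmod y < rho < 1 ->
  Cderiv f y = Cmean (fun t => circ rho t * f (circ rho t) / (circ rho t - y) ^ 2)%C.
Proof.
  intros H Y. apply Cderiv_unique. assert (P := Cmod_ge_0 y).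
  refine (cder_ext_loc _ f y _ (rho - Cmod y) ltac:(lra) _
    (cder_cauchy_1 _ rho y (holo_pcont_mul f rho H ltac:(lra)) (proj1 Y))).
  intros z Z. symmetry. apply cauchy_transform_eq; [exact H |].
  assert (B := Cmod_lower z y). lra.
Qed.

(** Locally f' is a Cauchy integral with squared denominator, and such an integral can be
    differentiated once more. Iterating this gives all higher derivatives. *)
Theorem Cderiv_holo (f : C -> C) : holomorphic_on_D f -> holomorphic_on_D (Cderiv f).
Proof.
  intros H z Z. unfold inD in Z. assert (P := Cmod_ge_0 z).
  set (rho := (1 + Cmod z) / 2).
  assert (R : Cmod z < rho < 1) by (unfold rho; lra).
  destruct (ex_cder_cauchy_2 _ rho z (holo_pcont_mul f rho H ltac:(lra)) (proj1 R)) as [l Hl].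
  exists l. refine (cder_ext_loc _ _ z l (rho - Cmod z) ltac:(lra) _ Hl).
  intros y Y. symmetry. apply Cderiv_cauchy; [exact H |].
  assert (B := Cmod_lower y z). lra.
Qed.

Lemma Cderiv_n_holo (f : C -> C) (n : nat) : holomorphic_on_D f -> holomorphic_on_D (Cderiv_n n f).
Proof. intros H. induction n as [| n IH]; [exact H | now apply Cderiv_holo]. Qed.

Lemma Csub_neq_0 (x y : C) : x <> y -> (x - y)%C <> 0.
Proof. intros N E. apply N. replace x with (x - y + y)%C by ring. rewrite E. ring. Qed.

(** Removable singularity: near [a] the quotient is the Cauchy transform of f(c)/(c - a), hence
    differentiable at [a] too. The factorisation holds at every complex number because off [a] the
    function [g] is defined by division. *)
Theorem holo_divide (f : C -> C) (a : C) :
  holomorphic_on_D f -> Cmod a < 1 -> f a = 0 ->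
  exists g, holomorphic_on_D g /\ forall z, f z = ((z - a) * g z)%C.
Proof.
  intros H A E. assert (P := Cmod_ge_0 a).
  set (g := fun z => if excluded_middle_informative (z = a) then Cderiv f a else (f z / (z - a))%C).
  exists g. split.
  - intros z Z. unfold inD in Z. destruct (excluded_middle_informative (z = a)) as [-> | N].
    + set (rho := (1 + Cmod a) / 2).
      assert (R : Cmod a < rho < 1) by (unfold rho; lra).
      set (h := fun t => (circ rho t * f (circ rho t) / (circ rho t - a))%C).
      assert (Hh : forall t, pcont h t).
      { intros t. apply clim_div.
        - apply circ_sub_neq_0. lra.
        - apply holo_pcont_mul; [exact H | lra].
        - apply clim_minus; [apply pcont_circ | apply clim_const]. }
      eexists. refine (cder_ext_loc _ g a _ (rho - Cmod a) ltac:(lra) _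
        (cder_cauchy_1 h rho a Hh (proj1 R))).
      intros y Y. assert (B := Cmod_lower y a). assert (Y2 : Cmod y < rho < 1) by lra.
      unfold g, h. destruct excluded_middle_informative as [-> | N].
      * rewrite (Cderiv_cauchy f rho a H R). apply Cmean_ext. intros t.
        assert (N := circ_sub_neq_0 rho t a (proj1 R)). field. exact N.
      * assert (Ny := Csub_neq_0 y a N).
        assert (K : forall b, Cmod b < rho -> forall t,
          pcont (fun t => circ rho t * f (circ rho t) / (circ rho t - b) ^ 1)%C t).
        { intros b Hb t. apply (pcont_circ_sub_pow (fun t => circ rho t * f (circ rho t))%C);
            [| exact Hb]. intros s. apply holo_pcont_mul; [exact H | lra]. }
        (* Partial fractions: 1/((c - a)(c - y)) is the difference of 1/(c - y) and 1/(c - a)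
           divided by y - a. *)
        rewrite (Cmean_ext _ (fun t => (/ (y - a)) *
          (circ rho t * f (circ rho t) / (circ rho t - y) ^ 1
           - circ rho t * f (circ rho t) / (circ rho t - a) ^ 1))%C).
        2:{ intros t. assert (N1 := circ_sub_neq_0 rho t a (proj1 R)).
            assert (N2 := circ_sub_neq_0 rho t y (proj1 Y2)). field. auto. }
        rewrite Cmean_scal, Cmean_minus, <- !cauchy_transform_eq, E; try assumption.
        -- field. exact Ny.
        -- apply K; lra.
        -- apply K; lra.
        -- intros t. apply clim_minus; apply K; lra.
    + destruct (H z Z) as [l Hl].
      assert (D := cder_div _ _ z _ _ (Csub_neq_0 z a N) Hl
                    (cder_minus _ _ _ _ _ (cder_id z) (cder_const a z))).
      eexists. refine (cder_ext_loc _ g z _ (Cmod (z - a)) _ _ D).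
      * apply Cmod_gt_0. now apply Csub_neq_0.
      * intros y Hy. unfold g. destruct excluded_middle_informative as [F | _]; [| reflexivity].
        subst y. rewrite Cmod_sym in Hy. lra.
  - intros z. unfold g. destruct excluded_middle_informative as [-> | N].
    + rewrite E. ring.
    + field. now apply Csub_neq_0.
Qed.

(** * Taylor coefficients and Parseval's identity *)

(** The k-th Taylor coefficient at 0. The radius 1/2 is arbitrary, as [coef_radius] shows. *)
Definition coef (f : C -> C) (k : nat) : C :=
  Cmean (fun t => f (circ (/ 2) t) / circ (/ 2) t ^ k)%C.

Lemma pcont_coef (f : C -> C) (k : nat) (r : R) : holomorphic_on_D f -> 0 < r < 1 ->
  forall t, pcont (fun t => f (circ r t) / circ r t ^ k)%C t.
Proof.
  intros H Hr t. apply clim_div.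
  - apply Cpow_nz, circ_neq_0. lra.
  - apply holo_pcont; [exact H | lra].
  - apply clim_pow, pcont_circ.
Qed.

Lemma ex_cder_div_pow (f : C -> C) (k : nat) (z : C) :
  holomorphic_on_D f -> 0 < Cmod z < 1 -> exists l, cder (fun z => f z / z ^ k)%C z l.
Proof.
  intros H Z. destruct (H z (proj2 Z)) as [l Hl].
  assert (N : z <> 0) by (apply Cmod_gt_0; lra).
  destruct k as [| k].
  - eexists. apply cder_div; [apply Cpow_nz; exact N | exact Hl | apply (cder_const (RtoC 1))].
  - eexists. apply cder_div; [apply Cpow_nz; exact N | exact Hl |].
    apply (cder_pow (fun z => z)). apply cder_id.
Qed.

Lemma coef_radius (f : C -> C) (k : nat) (r : R) : holomorphic_on_D f -> 0 < r < 1 ->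
  Cmean (fun t => f (circ r t) / circ r t ^ k)%C = coef f k.
Proof.
  intros H Hr. unfold coef. destruct (Rle_lt_dec r (/ 2)) as [L | L].
  - apply (Cmean_annulus (fun z => f z / z ^ k)%C); [lra | lra |].
    intros z Z. apply ex_cder_div_pow; [exact H | lra].
  - symmetry. apply (Cmean_annulus (fun z => f z / z ^ k)%C); [lra | lra |].
    intros z Z. apply ex_cder_div_pow; [exact H | lra].
Qed.

Fixpoint tpoly (f : C -> C) (K : nat) (z : C) : C :=
  match K with O => RtoC 0 | S K => (tpoly f K z + coef f K * z ^ K)%C end.

(** Each induction step rewrites the kernel as c/(c - zeta) = 1 + (zeta/c) c/(c - zeta): the first
    summand yields the next coefficient, the second the next remainder. *)
Lemma taylor_remainder (f : C -> C) (K : nat) (rho : R) (zeta : C) :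
  holomorphic_on_D f -> Cmod zeta < rho < 1 ->
  f zeta = (tpoly f K zeta + zeta ^ K *
    Cmean (fun t => f (circ rho t) / circ rho t ^ K * (circ rho t / (circ rho t - zeta)))%C)%C.
Proof.
  intros H R. assert (P := Cmod_ge_0 zeta). induction K as [| K IH].
  - simpl. rewrite <- (cauchy_formula f 1 rho zeta H R) at 1.
    rewrite (Cmean_ext _ (fun t => f (circ rho t) / 1 * (circ rho t / (circ rho t - zeta)))%C).
    + ring.
    + intros t. assert (N := circ_sub_neq_0 rho t zeta (proj1 R)). field. exact N.
  - rewrite IH at 1.
    assert (C1 := pcont_cauchy_kernel rho zeta (proj1 R)).
    rewrite (Cmean_ext _ (fun t => f (circ rho t) / circ rho t ^ K
       + zeta * (f (circ rho t) / circ rho t ^ S K * (circ rho t / (circ rho t - zeta))))%C).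
    2:{ intros t. assert (N := circ_sub_neq_0 rho t zeta (proj1 R)).
        assert (N2 := circ_neq_0 rho t ltac:(lra)).
        assert (N3 := Cpow_nz _ K N2). simpl. field. auto. }
    assert (Q : forall t, pcont (fun t => f (circ rho t) / circ rho t ^ S K
                 * (circ rho t / (circ rho t - zeta)))%C t).
    { intros t. apply clim_mult; [apply (pcont_coef f (S K)); [exact H | lra] | apply C1]. }
    rewrite Cmean_plus.
    + rewrite Cmean_scal by exact Q. rewrite coef_radius by (auto; lra). simpl. ring.
    + apply pcont_coef; [exact H | lra].
    + intros t. apply clim_mult; [apply clim_const | apply Q].
Qed.

(** Writing the remainder on a circle halfway between r and 1 gains the factor (r/rho)^K, uniformly
    on |z| <= r. *)
Lemma tpoly_approx (f : C -> C) (r : R) : holomorphic_on_D f -> 0 < r < 1 ->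
  exists A q, 0 < A /\ 0 <= q < 1 /\ forall K z, Cmod z <= r ->
    Cmod (f z - tpoly f K z) <= A * q ^ K.
Proof.
  intros H Hr. set (rho := (1 + r) / 2).
  assert (R1 : r < rho < 1) by (unfold rho; lra).
  destruct (pcont_bounded (fun t => f (circ rho t))) as [M [HM B]].
  { apply holo_pcont; [exact H | lra]. }
  exists (M * (rho / (rho - r))), (r / rho).
  assert (X0 : 0 < rho / (rho - r)) by (apply Rdiv_lt_0_compat; lra).
  split; [now apply Rmult_lt_0_compat |]. split.
  { split; [left; apply Rdiv_lt_0_compat; lra |].
    apply -> Rdiv_lt_1; lra. }
  intros K z Z. assert (P := Cmod_ge_0 z).
  rewrite (taylor_remainder f K rho z H ltac:(lra)).
  replace (tpoly f K z + z ^ K * Cmean (fun t => f (circ rho t) / circ rho t ^ K * (circ rho t / (circ rho t - z)))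
           - tpoly f K z)%C
    with (z ^ K * Cmean (fun t => f (circ rho t) / circ rho t ^ K * (circ rho t / (circ rho t - z))))%C by ring.
  rewrite Cmod_mult, Cmod_pow.
  apply Rle_trans with (r ^ K * (M / rho ^ K * (rho / (rho - r)))).
  - assert (PK : 0 < rho ^ K) by (apply pow_lt; lra).
    apply Rmult_le_compat; [apply pow_le; lra | apply Cmod_ge_0 | apply pow_incr; lra |].
    apply Cmod_Cmean_le_const_per.
    + intros t. apply clim_mult; [apply pcont_coef; [exact H | lra] |].
      apply pcont_cauchy_kernel. lra.
    + intros t Ht. rewrite Cmod_mult. apply Rmult_le_compat; try apply Cmod_ge_0.
      * apply Cmod_div_le; [exact PK | now apply B |].
        rewrite Cmod_pow, Cmod_circ by lra. lra.
      * apply Cmod_div_le; [lra | rewrite Cmod_circ; lra |].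
        assert (A := Cmod_lower (circ rho t) z). rewrite Cmod_circ in A by lra. lra.
  - unfold Rdiv. rewrite Rpow_mult_distr, pow_inv. apply Req_le. ring.
Qed.

Fixpoint parseval_sum (f : C -> C) (r : R) (K : nat) : R :=
  match K with O => 0 | S K => parseval_sum f r K + Cmod (coef f K) ^ 2 * (r ^ 2) ^ K end.

Lemma Cmean_RtoC (u : R -> R) : Cmean (fun t => RtoC (u t)) = RtoC (Rmean u).
Proof.
  unfold Cmean. replace (CI (fun t => RtoC (u t)) 0 (2 * PI)) with (RtoC (RInt u 0 (2 * PI))).
  - rewrite <- RtoC_mult. f_equal. unfold Rmean, Rdiv. ring.
  - unfold CI, RtoC; simpl. f_equal. rewrite RInt_const.
    unfold scal; simpl; unfold mult; simpl. ring.
Qed.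

Lemma pcont_tpoly (f : C -> C) (K : nat) (h : R -> C) (t : R) :
  pcont h t -> pcont (fun t => tpoly f K (h t)) t.
Proof.
  intros H. unfold pcont. induction K as [| K IH]; simpl.
  - apply clim_const.
  - apply clim_plus; [exact IH |]. apply clim_mult; [apply clim_const | now apply clim_pow].
Qed.

(* Pairing [f] with a Taylor polynomial only needs the integral formula for the
   coefficients, since conj(z)^k = r^{2k} / z^k on the circle. *)
Lemma Cmean_mul_conj_tpoly (f : C -> C) (r : R) (K : nat) : holomorphic_on_D f -> 0 < r < 1 ->
  Cmean (fun t => f (circ r t) * Cconj (tpoly f K (circ r t)))%C = RtoC (parseval_sum f r K).
Proof.
  intros H Hr. induction K as [| K IH].
  - simpl. rewrite (Cmean_ext _ (fun _ => RtoC 0)); [apply Cmean_const |].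
    intros t. unfold Cconj, RtoC, Cmult; simpl. f_equal; ring.
  - cbn [tpoly parseval_sum]. rewrite RtoC_plus, <- IH.
    rewrite (Cmean_ext _ (fun t => f (circ r t) * Cconj (tpoly f K (circ r t))
      + (Cconj (coef f K) * RtoC ((r * r) ^ K)) * (f (circ r t) / circ r t ^ K))%C).
    + rewrite Cmean_plus, Cmean_scal, coef_radius; try (auto; lra).
      * f_equal. rewrite RtoC_mult, Cmod2_conj. replace (r ^ 2) with (r * r) by ring. ring.
      * now apply pcont_coef.
      * intros t. apply clim_mult; [apply holo_pcont; [exact H | lra] |].
        apply clim_conj, pcont_tpoly, pcont_circ.
      * intros t. apply clim_mult; [apply clim_const | now apply pcont_coef].
    + intros t. assert (N := circ_neq_0 r t ltac:(lra)).
      rewrite Cplus_conj, Cmult_conj, Cpow_conj, circ_conj by lra.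
      rewrite RtoC_pow. unfold Cdiv at 1. rewrite Cpow_mult_l, Cpow_inv by exact N.
      unfold Cdiv. ring.
Qed.

Lemma mean2_Cmean (f : C -> C) (r : R) :
  RtoC (mean2 f r) = Cmean (fun t => f (circ r t) * Cconj (f (circ r t)))%C.
Proof.
  rewrite (Cmean_ext _ (fun t => RtoC (Cmod (f (circ r t)) ^ 2))).
  - now rewrite Cmean_RtoC.
  - intros t. now rewrite Cmod2_conj.
Qed.

(** Only the conjugated factor of f conj(f) is replaced by a Taylor polynomial; the other is bounded
    on the circle, so the error decays geometrically. *)
Lemma parseval_approx (f : C -> C) (r : R) : holomorphic_on_D f -> 0 < r < 1 ->
  is_lim_seq (parseval_sum f r) (mean2 f r).
Proof.
  intros H Hr. destruct (tpoly_approx f r H Hr) as (A & q & HA & Hq & B).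
  destruct (pcont_bounded (fun t => f (circ r t))) as [M [HM BM]].
  { apply holo_pcont; [exact H | lra]. }
  assert (E : forall K, Rabs (parseval_sum f r K - mean2 f r) <= (M * A) * q ^ K).
  { intros K. rewrite <- Cmod_R, RtoC_minus, mean2_Cmean, <- Cmean_mul_conj_tpoly by assumption.
    assert (HF : forall t, pcont (fun t => f (circ r t)) t) by (apply holo_pcont; [exact H | lra]).
    assert (HT : forall t, pcont (fun t => tpoly f K (circ r t)) t)
      by (intros t; apply pcont_tpoly, pcont_circ).
    rewrite <- Cmean_minus.
    - apply Cmod_Cmean_le_const_per.
      + intros t. apply clim_minus; (apply clim_mult; [apply HF |]); apply clim_conj; [apply HT | apply HF].
      + intros t Ht.
        replace (f (circ r t) * Cconj (tpoly f K (circ r t)) - f (circ r t) * Cconj (f (circ r t)))%C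
          with (f (circ r t) * Cconj (tpoly f K (circ r t) - f (circ r t)))%C
          by (rewrite Cminus_conj; ring).
        rewrite Cmod_mult, Cmod_conj, Cmod_sym, Rmult_assoc.
        apply Rmult_le_compat; try apply Cmod_ge_0; [now apply BM |].
        apply B. rewrite Cmod_circ; lra.
    - intros t. apply clim_mult; [apply HF | apply clim_conj, HT].
    - intros t. apply clim_mult; [apply HF | apply clim_conj, HF]. }
  apply (is_lim_seq_le_le (fun K => mean2 f r - (M * A) * q ^ K) _ (fun K => mean2 f r + (M * A) * q ^ K)).
  - intros K. specialize (E K). apply Rabs_le_between in E. lra.
  - replace (Finite (mean2 f r)) with (Finite (mean2 f r - M * A * 0)) by (f_equal; ring).
    apply (is_lim_seq_minus' _ _ (mean2 f r) (M * A * 0)); [apply is_lim_seq_const |].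
    apply (is_lim_seq_scal_l _ (M * A) 0). apply is_lim_seq_geom. rewrite Rabs_pos_eq; lra.
  - replace (Finite (mean2 f r)) with (Finite (mean2 f r + M * A * 0)) by (f_equal; ring).
    apply (is_lim_seq_plus' _ _ (mean2 f r) (M * A * 0)); [apply is_lim_seq_const |].
    apply (is_lim_seq_scal_l _ (M * A) 0). apply is_lim_seq_geom. rewrite Rabs_pos_eq; lra.
Qed.

Lemma parseval_sum_incr (f : C -> C) (r : R) (K m : nat) :
  parseval_sum f r K <= parseval_sum f r (m + K).
Proof.
  induction m as [| m IH]; [apply Rle_refl |]. rewrite Nat.add_succ_l. cbn [parseval_sum].
  assert (0 <= Cmod (coef f (m + K)) ^ 2 * (r ^ 2) ^ (m + K))
    by (apply Rmult_le_pos; [apply pow2_ge_0 | apply pow_le, pow2_ge_0]).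
  lra.
Qed.

Lemma parseval_sum_le_mean2 (f : C -> C) (r : R) (K : nat) : holomorphic_on_D f -> 0 < r < 1 ->
  parseval_sum f r K <= mean2 f r.
Proof.
  intros H Hr.
  assert (L := proj1 (is_lim_seq_incr_n (parseval_sum f r) K _) (parseval_approx f r H Hr)).
  apply (is_lim_seq_le (fun _ => parseval_sum f r K) (fun n => parseval_sum f r (n + K)) _ _
     (fun m => parseval_sum_incr f r K m) (is_lim_seq_const _) L).
Qed.

Lemma mean2_le (f : C -> C) (r B : R) : holomorphic_on_D f -> 0 < r < 1 ->
  (forall K, parseval_sum f r K <= B) -> mean2 f r <= B.
Proof.
  intros H Hr U.
  apply (is_lim_seq_le (parseval_sum f r) (fun _ => B) _ _ U (parseval_approx f r H Hr) (is_lim_seq_const B)).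
Qed.

Lemma parseval_sum_mono (f : C -> C) (r s : R) (K : nat) : 0 < r <= s ->
  parseval_sum f r K <= parseval_sum f s K.
Proof.
  intros Hr. induction K as [| K IH]; cbn [parseval_sum]; [lra |].
  apply Rplus_le_compat; [exact IH |]. apply Rmult_le_compat_l; [apply pow2_ge_0 |].
  apply pow_incr. split; [apply pow2_ge_0 | apply pow_incr; lra].
Qed.

Lemma mean2_mono (f : C -> C) (r s : R) : holomorphic_on_D f -> 0 < r <= s -> s < 1 ->
  mean2 f r <= mean2 f s.
Proof.
  intros H Hr Hs. apply mean2_le; [exact H | lra |]. intros K.
  eapply Rle_trans; [now apply parseval_sum_mono |].
  apply parseval_sum_le_mean2; [exact H | lra].
Qed.

Lemma at_left_1_near (d : R) : 0 < d -> at_left 1 (fun r => 1 - d < r < 1).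
Proof.
  intros Hd. exists (mkposreal d Hd). intros y B L.
  change (Rabs (y - 1) < d) in B. change (y < 1) in L. apply Rabs_def2 in B. split; lra.
Qed.

Lemma mean2_le_norm2 (f : C -> C) (L r : R) : H2_norm2 f L -> 0 < r < 1 -> mean2 f r <= L.
Proof.
  intros [H Lim] Hr.
  apply (filterlim_le (F := at_left 1) (fun _ => mean2 f r) (mean2 f) (mean2 f r) L).
  - generalize (at_left_1_near (1 - r) ltac:(lra)). apply filter_imp. intros s S.
    apply mean2_mono; [exact H | lra | lra].
  - apply filterlim_const.
  - exact Lim.
Qed.

(** Circle means increase with the radius, so their limit at 1 is their supremum. This reduces
    boundedness of the operator to a bound on each circle. *)
Lemma norm2_exists (f : C -> C) (B : R) : holomorphic_on_D f ->
  (forall r, 0 < r < 1 -> mean2 f r <= B) -> exists L, H2_norm2 f L /\ L <= B.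
Proof.
  intros H U.
  destruct (completeness (fun x => exists r, 0 < r < 1 /\ x = mean2 f r)) as [L [L1 L2]].
  - exists B. intros x [r [Hr ->]]. now apply U.
  - exists (mean2 f (/ 2)), (/ 2). split; [lra | reflexivity].
  - exists L. split.
    + split; [exact H |]. apply filterlim_locally. intros eps.
      destruct (classic (exists r, 0 < r < 1 /\ L - eps < mean2 f r)) as [[r [Hr Er]] | N].
      * generalize (at_left_1_near (1 - r) ltac:(lra)). apply filter_imp. intros s S.
        change (Rabs (mean2 f s - L) < eps).
        assert (A1 : mean2 f r <= mean2 f s) by (apply mean2_mono; [exact H | lra | lra]).
        assert (A2 : mean2 f s <= L) by (apply L1; exists s; split; [lra | reflexivity]).
        assert (P := cond_pos eps). apply Rabs_def1; lra.
      * exfalso. assert (P := cond_pos eps).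
        assert (L <= L - eps); [| lra].
        apply L2. intros x [r [Hr ->]]. apply Rnot_lt_le. intros F. apply N. now exists r.
    + apply L2. intros x [r [Hr ->]]. now apply U.
Qed.

(** The passage from complex to real calculus. Composed with [Cexp], the vertical line through ln r
    becomes the circle of radius r, so derivatives in the angle are covered as well. *)
Lemma is_derive_line (G : C -> C) (u v L : C) (t : R) :
  cder G (u + RtoC t * v)%C L ->
  is_derive (fun s : R => fst (G (u + RtoC s * v)%C)) t (fst (v * L)%C) /\
  is_derive (fun s : R => snd (G (u + RtoC s * v)%C)) t (snd (v * L)%C).
Proof.
  intros H. rewrite cder_eps in H. assert (Pv := Cmod_ge_0 v).
  assert (B : forall eps, 0 < eps -> exists d : posreal, forall h, h <> 0 -> Rabs h < d ->
    Cmod ((G (u + RtoC (t + h) * v) - G (u + RtoC t * v)) / RtoC h - v * L)%C < eps).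
  { intros eps He.
    assert (He' : 0 < eps / (Cmod v + 1) / 2)
      by (apply Rdiv_lt_0_compat; [apply Rdiv_lt_0_compat; lra | lra]).
    destruct (H _ He') as [d [Hd D]].
    assert (Hd' : 0 < d / (Cmod v + 1)) by (apply Rdiv_lt_0_compat; lra).
    exists (mkposreal _ Hd'). intros h Nh Hh. simpl in Hh.
    assert (Ph := Rabs_pos_lt h Nh).
    assert (E : (u + RtoC (t + h) * v - (u + RtoC t * v))%C = (RtoC h * v)%C)
      by (rewrite RtoC_plus; ring).
    assert (S : Cmod (RtoC h * v) < d).
    { rewrite Cmod_mult, Cmod_R. apply Rle_lt_trans with (Rabs h * (Cmod v + 1)); [nra |].
      apply Rlt_le_trans with (d / (Cmod v + 1) * (Cmod v + 1)).
      - apply Rmult_lt_compat_r; lra.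
      - apply Req_le. field. lra. }
    specialize (D (u + RtoC (t + h) * v)%C). rewrite E in D. specialize (D S).
    assert (Nh' : RtoC h <> 0) by (intros F; injection F; lra).
    replace ((G (u + RtoC (t + h) * v) - G (u + RtoC t * v)) / RtoC h - v * L)%C
      with ((G (u + RtoC (t + h) * v) - G (u + RtoC t * v) - L * (RtoC h * v)) / RtoC h)%C
      by (field; exact Nh').
    rewrite Cmod_div, Cmod_R by exact Nh'.
    apply Rmult_lt_reg_r with (Rabs h); [exact Ph |].
    unfold Rdiv at 1. rewrite Rmult_assoc, Rinv_l, Rmult_1_r by lra.
    eapply Rle_lt_trans; [exact D |]. rewrite Cmod_mult, Cmod_R.
    replace (eps / (Cmod v + 1) / 2 * (Rabs h * Cmod v))
      with ((Cmod v / (Cmod v + 1) / 2) * (eps * Rabs h)) by (field; lra).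
    assert (Q : Cmod v / (Cmod v + 1) <= 1).
    { apply -> Rdiv_le_1; lra. }
    assert (PE : 0 < eps * Rabs h) by (apply Rmult_lt_0_compat; lra). nra. }
  split; apply is_derive_Reals; intros eps He; destruct (B eps He) as [d D]; exists d;
    intros h Nh Hh; specialize (D h Nh Hh); eapply Rle_lt_trans; [| exact D | | exact D].
  - eapply Rle_trans; [| apply re_le_Cmod]. apply Req_le. f_equal.
    unfold Cdiv. rewrite <- RtoC_inv by exact Nh. unfold Re, Rdiv. simpl. ring.
  - eapply Rle_trans; [| apply snd_le_Cmod]. apply Req_le. f_equal.
    unfold Cdiv. rewrite <- RtoC_inv by exact Nh. unfold Rdiv. simpl. ring.
Qed.

Lemma cder_zero_const (G : C -> C) (zeta : C) :
  (forall z, Cmod z < 1 -> cder G z (RtoC 0)) -> Cmod zeta < 1 -> G zeta = G (RtoC 0).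
Proof.
  intros H Z. assert (P := Cmod_ge_0 zeta).
  assert (D : forall t, 0 <= t <= 1 -> cder G (RtoC 0 + RtoC t * zeta)%C (RtoC 0)).
  { intros t Ht. apply H. rewrite Cplus_0_l, Cmod_mult, Cmod_R, Rabs_pos_eq by lra. nra. }
  assert (E0 : (RtoC 0 + RtoC 0 * zeta)%C = RtoC 0) by ring.
  assert (E1 : (RtoC 0 + RtoC 1 * zeta)%C = zeta) by ring.
  assert (Z0 : fst (zeta * RtoC 0)%C = 0) by (simpl; ring).
  assert (Z1 : snd (zeta * RtoC 0)%C = 0) by (simpl; ring).
  apply injective_projections; symmetry.
  - assert (A := eq_is_derive (V := R_NormedModule) (fun s : R => fst (G (RtoC 0 + RtoC s * zeta)%C)) 0 1).
    cbv beta in A. rewrite E0, E1 in A. apply A; [| lra].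
    intros t Ht. assert (B := proj1 (is_derive_line G _ _ _ t (D t Ht))). rewrite Z0 in B. exact B.
  - assert (A := eq_is_derive (V := R_NormedModule) (fun s : R => snd (G (RtoC 0 + RtoC s * zeta)%C)) 0 1).
    cbv beta in A. rewrite E0, E1 in A. apply A; [| lra].
    intros t Ht. assert (B := proj2 (is_derive_line G _ _ _ t (D t Ht))). rewrite Z1 in B. exact B.
Qed.

(** Along the circle, i z g'(z) is the derivative of g with respect to the angle, and its integral
    over a full period vanishes. *)
Lemma Cmean_derivative (g g' : C -> C) (r : R) : 0 < r ->
  (forall t, cder g (circ r t) (g' (circ r t))) -> (forall t, ccont g' (circ r t)) ->
  Cmean (fun t => circ r t * g' (circ r t))%C = 0.
Proof.
  intros Hr D Cg. assert (PP := two_PI_pos).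
  set (dh := fun t => (Ci * (circ r t * g' (circ r t)))%C).
  assert (L : forall t, (((ln r, 0) : C) + RtoC t * Ci)%C = (ln r, t)).
  { intros t. unfold Cplus, Cmult, RtoC, Ci; simpl. f_equal; ring. }
  assert (Dh : forall t, is_derive (fun s : R => fst (g (circ r s))) t (fst (dh t)) /\
                         is_derive (fun s : R => snd (g (circ r s))) t (snd (dh t))).
  { intros t.
    assert (A := is_derive_line (fun w => g (Cexp w)) (ln r, 0) Ci (circ r t * g' (circ r t))%C t).
    rewrite L in A. destruct A as [A1 A2].
    - assert (E := circ_Cexp r t Hr). rewrite E.
      apply (cder_comp g Cexp); [rewrite <- E; apply D | apply cder_Cexp].
    - split; (eapply is_derive_ext; [| eassumption]); intros s; cbv beta; now rewrite L, <- circ_Cexp. }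
  assert (Cd : forall t, pcont dh t).
  { intros t. apply clim_mult; [apply clim_const |]. apply clim_mult; [apply pcont_circ |].
    apply pcont_on_circ. exact Cg. }
  assert (E2 : circ r (2 * PI) = circ r 0) by (unfold circ; now rewrite cos_2PI, sin_2PI, cos_0, sin_0).
  assert (E : CI dh 0 (2 * PI) = 0).
  { unfold CI. apply injective_projections; simpl; apply is_RInt_unique.
    - assert (A := is_RInt_derive (V := R_CompleteNormedModule) (fun s => fst (g (circ r s))) (fun t => fst (dh t)) 0 (2 * PI)
        (fun x _ => proj1 (Dh x)) (fun x _ => clim_fst dh (dh x) (Cd x))).
      cbv beta in A. rewrite E2 in A. rewrite minus_eq_zero in A. exact A.
    - assert (A := is_RInt_derive (V := R_CompleteNormedModule) (fun s => snd (g (circ r s))) (fun t => snd (dh t)) 0 (2 * PI)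
        (fun x _ => proj2 (Dh x)) (fun x _ => clim_snd dh (dh x) (Cd x))).
      cbv beta in A. rewrite E2 in A. rewrite minus_eq_zero in A. exact A. }
  assert (EM : Cmean dh = 0) by (unfold Cmean; rewrite E; ring).
  unfold dh in EM. rewrite Cmean_scal in EM.
  - set (m := Cmean _) in *. replace m with (- Ci * (Ci * m))%C.
    + rewrite EM. ring.
    + replace (- Ci * (Ci * m))%C with (- (Ci * Ci) * m)%C by ring.
      replace (Ci * Ci)%C with (- RtoC 1)%C; [ring |].
      unfold Ci, Cmult, RtoC, Copp; simpl. f_equal; ring.
  - intros t. apply clim_mult; [apply pcont_circ |]. apply pcont_on_circ. exact Cg.
Qed.

(** Integration by parts on the circle: the mean of z times the derivative of f/z^(k+1) is zero, and
    its two terms are the two sides. *)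
Lemma coef_Cderiv (f : C -> C) (k : nat) : holomorphic_on_D f ->
  coef (Cderiv f) k = (RtoC (INR (S k)) * coef f (S k))%C.
Proof.
  intros H. assert (H' := Cderiv_holo f H). set (r := / 2).
  assert (Hr : 0 < r < 1) by (unfold r; lra).
  assert (M := Cmean_derivative (fun z => f z / z ^ S k)%C
    (fun z => Cderiv f z / z ^ S k - RtoC (INR (S k)) * (f z / z ^ S (S k)))%C r ltac:(lra)).
  assert (E : Cmean (fun t => circ r t * (Cderiv f (circ r t) / circ r t ^ S k
              - RtoC (INR (S k)) * (f (circ r t) / circ r t ^ S (S k))))%C = 0).
  { apply M.
    - intros t. assert (N := circ_neq_0 r t ltac:(lra)). assert (Nk := Cpow_nz _ k N).
      assert (Z : Cmod (circ r t) < 1) by (rewrite Cmod_circ; lra).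
      eapply cder_eq.
      + apply cder_div; [now apply Cpow_nz | apply Cderiv_correct, H, Z |].
        apply (cder_pow (fun z => z)). apply cder_id.
      + cbn [Cpow]. field. auto.
    - intros t. assert (N := circ_neq_0 r t ltac:(lra)).
      assert (Z : Cmod (circ r t) < 1) by (rewrite Cmod_circ; lra).
      apply clim_minus.
      + apply clim_div; [now apply Cpow_nz | now apply holo_cont |].
        apply clim_pow, (cder_ccont _ _ _ (cder_id _)).
      + apply clim_mult; [apply clim_const |].
        apply clim_div; [now apply Cpow_nz | now apply holo_cont |].
        apply clim_pow, (cder_ccont _ _ _ (cder_id _)). }
  rewrite (Cmean_ext _ (fun t => Cderiv f (circ r t) / circ r t ^ k
              - RtoC (INR (S k)) * (f (circ r t) / circ r t ^ S k))%C) in E.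
  - rewrite Cmean_minus, Cmean_scal, !coef_radius in E; auto.
    + rewrite <- (Cplus_0_r (RtoC (INR (S k)) * coef f (S k))%C), <- E. ring.
    + now apply pcont_coef.
    + now apply pcont_coef.
    + intros t. apply clim_mult; [apply clim_const | now apply pcont_coef].
  - intros t. assert (N := circ_neq_0 r t ltac:(lra)). assert (Nk := Cpow_nz _ k N).
    cbn [Cpow]. field. auto.
Qed.

(** * Primitives and the modulus of zero-free functions *)

Lemma exC_swap (h : R -> C) (a b : R) : exC h a b -> exC h b a.
Proof. intros [H K]. split; now apply ex_RInt_swap. Qed.

Lemma CI_swap (h : R -> C) (a b : R) : exC h a b -> CI h b a = (- CI h a b)%C.
Proof.
  intros [H K]. unfold CI, Copp; simpl. f_equal; symmetry.
  - exact (opp_RInt_swap (V := R_CompleteNormedModule) _ _ _ H).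
  - exact (opp_RInt_swap (V := R_CompleteNormedModule) _ _ _ K).
Qed.

Lemma Cmod_CI_le_abs (h : R -> C) (a b M : R) :
  exC h a b -> (forall t, Rmin a b <= t <= Rmax a b -> Cmod (h t) <= M) ->
  Cmod (CI h a b) <= Rabs (b - a) * M.
Proof.
  intros H B. destruct (Rle_lt_dec a b) as [L | L].
  - rewrite Rabs_pos_eq by lra. apply Cmod_CI_le_const; [exact L | exact H |].
    intros t Ht. apply B. rewrite Rmin_left, Rmax_right; lra.
  - rewrite (CI_swap h b a) by now apply exC_swap. rewrite Cmod_opp.
    rewrite Rabs_left by lra. replace (- (b - a)) with (a - b) by ring.
    apply Cmod_CI_le_const; [lra | now apply exC_swap |].
    intros t Ht. apply B. rewrite Rmin_right, Rmax_left; lra.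
Qed.

Lemma exC_h (p : C -> C) (a b y : R) :
  (forall s, Rmin a b <= s <= Rmax a b -> ccont p (s, y)) -> exC (fun s => p (s, y)) a b.
Proof.
  intros H. apply exC_pcont. intros t Ht.
  apply (clim_comp p (fun s => (s, y) : C) (t, y)); [now apply H |].
  apply clim_pair; [apply filterlim_id | apply filterlim_const].
Qed.

Lemma exC_v (p : C -> C) (a b x : R) :
  (forall s, Rmin a b <= s <= Rmax a b -> ccont p (x, s)) -> exC (fun s => p (x, s)) a b.
Proof.
  intros H. apply exC_pcont. intros t Ht.
  apply (clim_comp p (fun s => (x, s) : C) (x, t)); [now apply H |].
  apply clim_pair; [apply filterlim_const | apply filterlim_id].
Qed.

(** Exchanging the endpoints of a side changes the sign of the contour integral, so the ordered case
    suffices. The primitive below needs increments of either sign. *)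
Lemma goursat_oriented (p : C -> C) (a b c d : R) :
  (forall x y, Rmin a b <= x <= Rmax a b -> Rmin c d <= y <= Rmax c d -> exists l, cder p (x, y) l) ->
  rectI p a b c d = 0.
Proof.
  intros H.
  assert (HC : forall x y, Rmin a b <= x <= Rmax a b -> Rmin c d <= y <= Rmax c d -> ccont p (x, y)).
  { intros x y X Y. destruct (H x y X Y) as [l Hl]. now apply cder_ccont in Hl. }
  assert (S1 : rectI p b a c d = (- rectI p a b c d)%C).
  { unfold rectI.
    rewrite (CI_swap (fun x => p (x, c)) a b), (CI_swap (fun x => p (x, d)) a b).
    - ring.
    - apply exC_h. intros s Hs. apply HC; [exact Hs |]. split; [apply Rmin_r | apply Rmax_r].
    - apply exC_h. intros s Hs. apply HC; [exact Hs |]. split; [apply Rmin_l | apply Rmax_l]. }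
  assert (S2 : rectI p a b d c = (- rectI p a b c d)%C).
  { unfold rectI.
    rewrite (CI_swap (fun y => p (b, y)) c d), (CI_swap (fun y => p (a, y)) c d).
    - ring.
    - apply exC_v. intros s Hs. apply HC; [| exact Hs]. split; [apply Rmin_l | apply Rmax_l].
    - apply exC_v. intros s Hs. apply HC; [| exact Hs]. split; [apply Rmin_r | apply Rmax_r]. }
  assert (S3 : rectI p b a d c = rectI p a b c d).
  { unfold rectI.
    rewrite (CI_swap (fun x => p (x, c)) a b), (CI_swap (fun x => p (x, d)) a b).
    - rewrite (CI_swap (fun y => p (b, y)) c d), (CI_swap (fun y => p (a, y)) c d).
      + ring.
      + apply exC_v. intros s Hs. apply HC; [| exact Hs]. split; [apply Rmin_l | apply Rmax_l].
      + apply exC_v. intros s Hs. apply HC; [| exact Hs]. split; [apply Rmin_r | apply Rmax_r].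
    - apply exC_h. intros s Hs. apply HC; [exact Hs |]. split; [apply Rmin_r | apply Rmax_r].
    - apply exC_h. intros s Hs. apply HC; [exact Hs |]. split; [apply Rmin_l | apply Rmax_l]. }
  assert (Fl : forall z, (- z)%C = 0 -> z = 0).
  { intros z E. replace z with (- - z)%C by ring. rewrite E. ring. }
  destruct (Rle_lt_dec a b) as [L1 | L1]; destruct (Rle_lt_dec c d) as [L2 | L2].
  - rewrite Rmin_left, Rmax_right, Rmin_left, Rmax_right in H by lra.
    apply goursat; [lra | lra | exact H].
  - apply Fl. rewrite <- S2.
    rewrite Rmin_left, Rmax_right, Rmin_right, Rmax_left in H by lra.
    apply goursat; [lra | lra | exact H].
  - apply Fl. rewrite <- S1.
    rewrite Rmin_right, Rmax_left, Rmin_left, Rmax_right in H by lra.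
    apply goursat; [lra | lra | exact H].
  - rewrite <- S3.
    rewrite Rmin_right, Rmax_left, Rmin_right, Rmax_left in H by lra.
    apply goursat; [lra | lra | exact H].
Qed.

Lemma Cmod_le_coords (x y x' y' : R) : Rabs x <= Rabs x' -> Rabs y <= Rabs y' -> Cmod (x, y) <= Cmod (x', y').
Proof.
  intros X Y. unfold Cmod. apply sqrt_le_1_alt. simpl fst. simpl snd.
  rewrite <- (pow2_abs x), <- (pow2_abs y), <- (pow2_abs x'), <- (pow2_abs y').
  apply Rplus_le_compat; apply pow_incr; split; auto; apply Rabs_pos.
Qed.

Lemma Rabs_between_0 (s y : R) : Rmin 0 y <= s <= Rmax 0 y -> Rabs s <= Rabs y.
Proof. unfold Rmin, Rmax. repeat destruct Rle_dec; intros; unfold Rabs; repeat destruct Rcase_abs; lra. Qed.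

Lemma Rabs_between (s x x' : R) : Rmin x x' <= s <= Rmax x x' -> Rabs (s - x) <= Rabs (x' - x).
Proof. unfold Rmin, Rmax. repeat destruct Rle_dec; intros; unfold Rabs; repeat destruct Rcase_abs; lra. Qed.

(** The integral follows the real axis and then a vertical segment. Goursat's theorem moves the
    horizontal part of an increment from the real axis up to the height of the point, where [p] is
    close to its value there. *)
Theorem holo_primitive (p : C -> C) : holomorphic_on_D p ->
  exists P : C -> C, P (RtoC 0) = 0 /\ forall z, Cmod z < 1 -> cder P z (p z).
Proof.
  intros H.
  exists (fun z => CI (fun s => p (s, 0)) 0 (fst z) + Ci * CI (fun s => p (fst z, s)) 0 (snd z))%C.
  split.
  { simpl. unfold CI. rewrite !RInt_point. change zero with 0. unfold Cplus, Cmult, RtoC, Ci; simpl.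
    f_equal; ring. }
  intros [x y] Z. rewrite cder_eps. intros eps He.
  destruct (holo_cont p (x, y) H Z (eps / 2) ltac:(lra)) as [d1 [Hd1 D1]].
  exists (Rmin (d1 / 2) ((1 - Cmod (x, y)) / 2)). split; [apply Rmin_pos; lra |].
  intros [x' y'] W.
  assert (W1 : Cmod ((x', y') - (x, y)) < d1 / 2) by (eapply Rlt_le_trans; [exact W | apply Rmin_l]).
  assert (W2 : Cmod ((x', y') - (x, y)) < (1 - Cmod (x, y)) / 2) by (eapply Rlt_le_trans; [exact W | apply Rmin_r]).
  clear W. cbn [fst snd].
  assert (X1 := re_le_Cmod ((x', y') - (x, y))). assert (Y1 := snd_le_Cmod ((x', y') - (x, y))).
  simpl in X1, Y1.
  assert (near : forall s t, Rabs (s - x) <= Rabs (x' - x) -> Rabs (t - y) <= Rabs (y' - y) ->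
     Cmod ((s, t) - (x, y)) <= Cmod ((x', y') - (x, y))).
  { intros s t S T. unfold Cminus, Cplus, Copp; simpl. apply Cmod_le_coords; assumption. }
  assert (In1 : forall s t, Rabs (s - x) <= Rabs (x' - x) -> Rabs (t - y) <= Rabs (y' - y) -> Cmod (s, t) < 1).
  { intros s t S T. specialize (near s t S T). assert (B := Cmod_lower (s, t) (x, y)). lra. }
  assert (R0 : Rabs (y - y) <= Rabs (y' - y)).
  { replace (y - y) with 0 by ring. rewrite Rabs_R0. apply Rabs_pos. }
  assert (R0' : Rabs (x - x) <= Rabs (x' - x)).
  { replace (x - x) with 0 by ring. rewrite Rabs_R0. apply Rabs_pos. }
  (* Moving towards the real axis decreases the modulus, so the whole rectangle between the axis and
     the increment stays in the disk. *)
  assert (In2 : forall s t, Rabs (s - x) <= Rabs (x' - x) -> Rabs t <= Rabs y -> Cmod (s, t) < 1).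
  { intros s t S T. apply Rle_lt_trans with (Cmod (s, y)); [apply Cmod_le_coords; [lra | exact T] |].
    now apply In1. }
  assert (In3 : forall s t, Rabs s <= Rabs x -> Rabs t <= Rabs y -> Cmod (s, t) < 1).
  { intros s t S T. apply Rle_lt_trans with (Cmod (x, y)); [now apply Cmod_le_coords | exact Z]. }
  assert (In4 : forall s t, Rabs s <= Rabs x' -> Rabs t <= Rabs y -> Cmod (s, t) < 1).
  { intros s t S T. apply Rle_lt_trans with (Cmod (x', t)); [apply Cmod_le_coords; [exact S | lra] |].
    apply In2; [lra | exact T]. }
  assert (Y00 : Rabs 0 <= Rabs y) by (rewrite Rabs_R0; apply Rabs_pos).
  assert (HC : forall z, Cmod z < 1 -> ccont p z) by (intros; now apply holo_cont).
  assert (G : rectI p x x' 0 y = 0).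
  { apply goursat_oriented. intros s t S T. apply H. apply In2; [now apply Rabs_between | now apply Rabs_between_0]. }
  unfold rectI in G.
  assert (E1 : exC (fun s => p (s, 0)) 0 x).
  { apply exC_h. intros s S. apply HC, In3; [now apply Rabs_between_0 | exact Y00]. }
  assert (E2 : exC (fun s => p (s, 0)) x x').
  { apply exC_h. intros s S. apply HC, In2; [now apply Rabs_between | exact Y00]. }
  assert (E3 : exC (fun s => p (x', s)) 0 y).
  { apply exC_v. intros s S. apply HC, In2; [lra | now apply Rabs_between_0]. }
  assert (E4 : exC (fun s => p (x', s)) y y').
  { apply exC_v. intros s S. apply HC, In1; [lra | now apply Rabs_between]. }
  assert (E5 : exC (fun s => p (s, y)) x x').
  { apply exC_h. intros s S. apply HC, In1; [now apply Rabs_between | exact R0]. }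
  rewrite <- (CI_Chasles (fun s => p (s, 0)) 0 x x') by assumption.
  rewrite <- (CI_Chasles (fun s => p (x', s)) 0 y y') by assumption.
  set (A := CI (fun s => p (s, 0)) 0 x) in *. set (B := CI (fun s => p (s, 0)) x x') in *.
  set (E := CI (fun s => p (x', s)) 0 y) in *. set (F := CI (fun s => p (x', s)) y y').
  set (K := CI (fun s => p (x, s)) 0 y) in *. set (J := CI (fun s => p (s, y)) x x') in *.
  assert (CC : forall c a b, exC (fun _ => c) a b).
  { intros c a b. split; apply ex_RInt_const. }
  assert (F1 : CI (fun s => p (s, y) - p (x, y))%C x x' = (J - RtoC (x' - x) * p (x, y))%C).
  { rewrite CI_minus by auto. now rewrite CI_const. }
  assert (F2 : CI (fun s => p (x', s) - p (x, y))%C y y' = (F - RtoC (y' - y) * p (x, y))%C).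
  { rewrite CI_minus by auto. now rewrite CI_const. }
  replace (A + B + Ci * (E + F) - (A + Ci * K) - p (x, y) * ((x', y') - (x, y)))%C
    with ((J - RtoC (x' - x) * p (x, y)) + Ci * (F - RtoC (y' - y) * p (x, y)))%C.
  2:{ replace ((x', y') - (x, y))%C with (RtoC (x' - x) + Ci * RtoC (y' - y))%C
        by (apply injective_projections; simpl; ring).
      transitivity ((J - RtoC (x' - x) * p (x, y)) + Ci * (F - RtoC (y' - y) * p (x, y)) + (B + Ci * E - J - Ci * K))%C.
      - rewrite G. ring.
      - ring. }
  rewrite <- F1, <- F2. eapply Rle_trans; [apply Cmod_triangle |]. rewrite Cmod_mult, Cmod_Ci, Rmult_1_l.
  assert (B1 : Cmod (CI (fun s => p (s, y) - p (x, y))%C x x') <= Rabs (x' - x) * (eps / 2)).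
  { apply Cmod_CI_le_abs; [now apply exC_minus |]. intros s S. left. apply D1.
    specialize (near s y (Rabs_between _ _ _ S) R0). lra. }
  assert (B2 : Cmod (CI (fun s => p (x', s) - p (x, y))%C y y') <= Rabs (y' - y) * (eps / 2)).
  { apply Cmod_CI_le_abs; [now apply exC_minus |]. intros s S. left. apply D1.
    specialize (near x' s ltac:(lra) (Rabs_between _ _ _ S)). lra. }
  unfold Rminus in *. nra.
Qed.

(* With p = Q'/Q and P a primitive of p, the product Q exp(-P) is constant. *)
Theorem zero_free_modulus (Q : C -> C) : holomorphic_on_D Q ->
  (forall z, Cmod z < 1 -> Q z <> 0) ->
  exists P : C -> C, holomorphic_on_D P /\ P (RtoC 0) = 0 /\
    forall z, Cmod z < 1 -> Cmod (Q z) = Cmod (Q (RtoC 0)) * exp (fst (P z)).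
Proof.
  intros H NZ. assert (H' := Cderiv_holo Q H).
  destruct (holo_primitive (fun z => Cderiv Q z / Q z)%C) as [P [P0 HP]].
  { intros z Z. destruct (H z Z) as [l Hl]. destruct (H' z Z) as [m Hm].
    eexists. apply cder_div; [now apply NZ | exact Hm | exact Hl]. }
  exists P. split; [intros z Z; eexists; now apply HP |]. split; [exact P0 |].
  intros z Z.
  assert (E := cder_zero_const (fun z => Q z * Cexp (- P z))%C z).
  cbv beta in E. rewrite P0 in E.
  assert (E' : (Q z * Cexp (- P z))%C = Q (RtoC 0)).
  { rewrite E; [| | exact Z].
    - replace (Cexp (- 0)) with (RtoC 1); [ring |].
      unfold Cexp, RtoC; simpl. rewrite Ropp_0, exp_0, cos_0, sin_0. f_equal; ring.
    - intros w W. assert (D := Cderiv_correct Q w (H w W)).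
      eapply cder_eq.
      + apply cder_mult; [exact D |].
        apply (cder_comp Cexp (fun z => - P z)%C); [apply cder_Cexp | apply cder_opp, HP, W].
      + cbv beta. field. now apply NZ. }
  rewrite <- E', Cmod_mult, Cmod_Cexp, Rmult_assoc, <- exp_plus. simpl.
  rewrite Rplus_opp_l, exp_0. ring.
Qed.

(** * Means of real functions and a lower bound for real parts *)

Lemma fst_Cmean (h : R -> C) : fst (Cmean h) = Rmean (fun t => fst (h t)).
Proof. unfold Cmean, CI, Rmean, Rdiv; simpl. ring. Qed.

Lemma ex_RInt_all (u : R -> R) (a b : R) : (forall t, continuous u t) -> ex_RInt u a b.
Proof. intros H. apply (ex_RInt_continuous (V := R_CompleteNormedModule)). auto. Qed.

Lemma Rmean_scal (u : R -> R) (c : R) : (forall t, continuous u t) ->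
  Rmean (fun t => c * u t) = c * Rmean u.
Proof.
  intros Hu.   unfold Rmean. rewrite (is_RInt_unique _ _ _ (c * RInt u 0 (2 * PI))); [unfold Rdiv; ring |].
  apply (is_RInt_scal (V := R_NormedModule) u).
  apply (RInt_correct (V := R_CompleteNormedModule)). now apply ex_RInt_all.
Qed.

Section RmeanOrder.
Variables u v : R -> R.
Hypotheses (Hu : forall t, continuous u t) (Hv : forall t, continuous v t).

Lemma Rmean_lin (p q : R) : Rmean (fun t => p * u t + q * v t) = p * Rmean u + q * Rmean v.
Proof.
  unfold Rmean. rewrite (is_RInt_unique _ _ _ (p * RInt u 0 (2 * PI) + q * RInt v 0 (2 * PI))).
  - unfold Rdiv. ring.
  - apply RInt_lin2; now apply ex_RInt_all.
Qed.

Lemma Rmean_le : (forall t, u t <= v t) -> Rmean u <= Rmean v.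
Proof.
  intros L. assert (PP := two_PI_pos). unfold Rmean. apply Rmult_le_compat_r.
  - left. now apply Rinv_0_lt_compat.
  - apply RInt_le; [lra | now apply ex_RInt_all | now apply ex_RInt_all | auto].
Qed.

End RmeanOrder.

Lemma Rmean_lin_le (u v w : R -> R) (p q : R) : (forall t, continuous u t) ->
  (forall t, continuous v t) -> (forall t, continuous w t) ->
  (forall t, u t <= p * v t + q * w t) -> Rmean u <= p * Rmean v + q * Rmean w.
Proof.
  intros Hu Hv Hw L. rewrite <- Rmean_lin by assumption. apply Rmean_le; [exact Hu | | exact L].
  intros t. apply (continuous_plus (V := R_NormedModule) (fun t => p * v t) (fun t => q * w t)).
  - apply (continuous_mult (K := R_AbsRing) (fun _ => p)); [apply continuous_const | apply Hv].
  - apply (continuous_mult (K := R_AbsRing) (fun _ => q)); [apply continuous_const | apply Hw].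
Qed.

Lemma Rmean_ext (u v : R -> R) : (forall t, u t = v t) -> Rmean u = Rmean v.
Proof. intros E. unfold Rmean. f_equal. apply RInt_ext. auto. Qed.

Lemma Rmean_const (c : R) : Rmean (fun _ => c) = c.
Proof.
  unfold Rmean. rewrite RInt_const. unfold scal; simpl; unfold mult; simpl.
  assert (PP := two_PI_pos). field. lra.
Qed.

Lemma Rmean_affine_le (u v : R -> R) (p q : R) : (forall t, continuous u t) ->
  (forall t, continuous v t) -> (forall t, u t <= p * v t + q) -> Rmean u <= p * Rmean v + q.
Proof.
  intros Hu Hv L. rewrite <- (Rmult_1_r q), <- (Rmean_const 1) at 1.
  apply Rmean_lin_le; [exact Hu | exact Hv | intros; apply continuous_const |].
  intros t. now rewrite Rmult_1_r.
Qed.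

Lemma Rmean_fst_circ (P : C -> C) (r : R) : holomorphic_on_D P -> 0 <= r < 1 ->
  Rmean (fun t => fst (P (circ r t))) = fst (P (RtoC 0)).
Proof. intros H Hr. rewrite <- fst_Cmean. f_equal. now apply (Cmean_value P 1). Qed.

(* 2A - P is the Cauchy integral of 2(A - Re P), by [cauchy_conj]. *)
Lemma harnack (P : C -> C) (A r rho : R) (zeta : C) : holomorphic_on_D P -> P (RtoC 0) = 0 ->
  0 < rho < 1 -> (forall t, fst (P (circ rho t)) <= A) -> Cmod zeta <= r -> r < rho ->
  - (2 * A * r / (rho - r)) <= fst (P zeta).
Proof.
  intros H P0 Hrho B Z Hr. assert (Pz := Cmod_ge_0 zeta).
  set (k := fun t => (circ rho t / (circ rho t - zeta))%C).
  assert (Kc : forall t, pcont k t) by (apply pcont_cauchy_kernel; lra).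
  assert (HPc : forall t, pcont (fun t => P (circ rho t)) t) by (apply holo_pcont; [exact H | lra]).
  assert (C1 := cauchy_formula P 1 rho zeta H ltac:(lra)).
  assert (C2 := cauchy_conj P 1 rho zeta H ltac:(lra)).
  assert (C3 := cauchy_formula (fun _ => RtoC (2 * A)) 1 rho zeta
     ltac:(intros; eexists; apply cder_const) ltac:(lra)). cbv beta in C3.
  rewrite P0 in C2.
  assert (E : Cmean (fun t => k t * RtoC (2 * (A - fst (P (circ rho t)))))%C = (RtoC (2 * A) - P zeta)%C).
  { rewrite (Cmean_ext _ (fun t => k t * RtoC (2 * A) - (k t * P (circ rho t) + k t * Cconj (P (circ rho t))))%C).
    - rewrite Cmean_minus, Cmean_plus.
      + unfold k. rewrite C1, C2, C3. apply injective_projections; simpl; ring.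
      + intros t. apply clim_mult; [apply Kc | apply HPc].
      + intros t. apply clim_mult; [apply Kc | apply clim_conj, HPc].
      + intros t. apply clim_mult; [apply Kc | apply clim_const].
      + intros t. apply clim_plus; (apply clim_mult; [apply Kc |]); [apply HPc | apply clim_conj, HPc].
    - intros t.
      replace (k t * RtoC (2 * A) - (k t * P (circ rho t) + k t * Cconj (P (circ rho t))))%C
        with (k t * (RtoC (2 * A) - (P (circ rho t) + Cconj (P (circ rho t)))))%C by ring.
      f_equal. apply injective_projections; simpl; ring. }
  assert (Cu : forall t, continuous (fun t => fst (P (circ rho t))) t)
    by (intros t; apply (clim_fst _ _ (HPc t))).
  (* The integrand 2(A - Re P) is nonnegative with mean 2A, as Re P has mean Re P(0) = 0; the kernel
     contributes at most rho/(rho - r). *)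
  assert (M : Cmod (RtoC (2 * A) - P zeta) <= rho / (rho - r) * (2 * A)).
  { rewrite <- E.
    set (c := rho / (rho - r)).
    apply Rle_trans with (Rmean (fun t => (2 * c * A) * 1 + (- 2 * c) * fst (P (circ rho t)))).
    - apply Cmod_Cmean_le.
      + intros t. apply clim_mult; [apply Kc |]. apply clim_RtoC.
        change (continuous (fun s => 2 * (A - fst (P (circ rho s)))) t).
        apply (continuous_mult (K := R_AbsRing) (fun _ => 2)); [apply continuous_const |].
        apply (continuous_minus (V := R_NormedModule) (fun _ => A)); [apply continuous_const | apply Cu].
      + eexists. apply RInt_lin2; [apply ex_RInt_const | now apply ex_RInt_all].
      + intros t. rewrite Cmod_mult, Cmod_R. specialize (B t).
        rewrite Rabs_pos_eq by lra.
        assert (Kb : Cmod (k t) <= c).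
        { apply Cmod_div_le; [lra | rewrite Cmod_circ; lra |].
          assert (L := Cmod_lower (circ rho t) zeta). rewrite Cmod_circ in L by lra. lra. }
        assert (Kp := Cmod_ge_0 (k t)). nra.
    - rewrite Rmean_lin, Rmean_const, Rmean_fst_circ, P0; auto; try lra.
      + simpl. lra.
      + intros t. apply continuous_const. }
  assert (L := re_le_Cmod (RtoC (2 * A) - P zeta)). simpl in L.
  assert (L2 := Rle_abs (2 * A + - fst (P zeta))).
  replace (2 * A * r / (rho - r)) with (rho / (rho - r) * (2 * A) - 2 * A) by (field; lra).
  lra.
Qed.

(** * Zeros, multiplicities and Jensen's inequality *)

Lemma holo_const (c : C) : holomorphic_on_D (fun _ => c).
Proof. intros z _. eexists. apply cder_const. Qed.

Lemma holo_mult (f g : C -> C) : holomorphic_on_D f -> holomorphic_on_D g ->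
  holomorphic_on_D (fun z => f z * g z)%C.
Proof. intros F G z Z. destruct (F z Z), (G z Z). eexists. apply cder_mult; eassumption. Qed.

Lemma holo_plus (f g : C -> C) : holomorphic_on_D f -> holomorphic_on_D g ->
  holomorphic_on_D (fun z => f z + g z)%C.
Proof. intros F G z Z. destruct (F z Z), (G z Z). eexists. apply cder_plus; eassumption. Qed.

Lemma holo_minus (f g : C -> C) : holomorphic_on_D f -> holomorphic_on_D g ->
  holomorphic_on_D (fun z => f z - g z)%C.
Proof. intros F G z Z. destruct (F z Z), (G z Z). eexists. apply cder_minus; eassumption. Qed.

Lemma holo_id : holomorphic_on_D (fun z => z).
Proof. intros z _. eexists. apply cder_id. Qed.

Lemma holo_pow (f : C -> C) (n : nat) : holomorphic_on_D f -> holomorphic_on_D (fun z => f z ^ n)%C.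
Proof.
  intros F. induction n as [| n IH].
  - apply (holo_const (RtoC 1)).
  - now apply (holo_mult f (fun z => f z ^ n)%C).
Qed.

Lemma holo_div (f g : C -> C) : holomorphic_on_D f -> holomorphic_on_D g ->
  (forall z, Cmod z < 1 -> g z <> 0) -> holomorphic_on_D (fun z => f z / g z)%C.
Proof. intros F G N z Z. destruct (F z Z), (G z Z). eexists. apply cder_div; [now apply N | eassumption | eassumption]. Qed.

Fixpoint prodlin (L : list C) (z : C) : C :=
  match L with nil => RtoC 1 | a :: L => ((z - a) * prodlin L z)%C end.

(* The factor turning [prodlin L] into a function of modulus at least
   [|prodlin L|] on |z| <= r, with equality on |z| = r. *)
Fixpoint reflect (r : R) (L : list C) (z : C) : C :=
  match L with
  | nil => RtoC 1
  | a :: L => ((RtoC (r * r) - Cconj a * z) / RtoC r * reflect r L z)%C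
  end.

Fixpoint sumlog (r : R) (L : list C) : R :=
  match L with nil => 0 | a :: L => ln (r / Cmod a) + sumlog r L end.

Lemma holo_prodlin (L : list C) : holomorphic_on_D (prodlin L).
Proof.
  induction L as [| a L IH]; [apply (holo_const (RtoC 1)) |].
  apply (holo_mult (fun z => z - a)%C); [| exact IH].
  apply holo_minus; [apply holo_id | apply holo_const].
Qed.

Lemma holo_reflect (r : R) (L : list C) : 0 < r -> holomorphic_on_D (reflect r L).
Proof.
  intros Hr. induction L as [| a L IH]; [apply (holo_const (RtoC 1)) |].
  apply (holo_mult (fun z => (RtoC (r * r) - Cconj a * z) / RtoC r)%C); [| exact IH].
  apply holo_div.
  - apply holo_minus; [apply holo_const | apply holo_mult; [apply holo_const | apply holo_id]].
  - apply holo_const.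
  - intros z _ E. injection E. lra.
Qed.

Lemma prodlin_neq_0 (L : list C) (z : C) : ~ In z L -> prodlin L z <> 0.
Proof.
  induction L as [| a L IH]; simpl; intros N.
  - intros E. injection E. lra.
  - apply Cmult_neq_0; [apply Csub_neq_0; intros E; apply N; auto | apply IH; tauto].
Qed.

Lemma prodlin_eq_0 (L : list C) (z : C) : In z L -> prodlin L z = 0.
Proof.
  induction L as [| a L IH]; simpl; [tauto |]. intros [-> | I].
  - ring.
  - rewrite IH by exact I. ring.
Qed.

(** Everything follows from |r^2 - conj(a) z|^2 - r^2 |z - a|^2 = (r^2 - |a|^2)(r^2 - |z|^2). *)
Lemma Cmod_reflect_factor (r : R) (a z : C) : 0 < r -> Cmod a <= r -> Cmod z <= r ->
  Cmod (z - a) <= Cmod ((RtoC (r * r) - Cconj a * z) / RtoC r) /\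
  (Cmod z = r -> Cmod (z - a) = Cmod ((RtoC (r * r) - Cconj a * z) / RtoC r)).
Proof.
  intros Hr A Z.
  assert (Nr : RtoC r <> 0) by (intros E; injection E; lra).
  rewrite Cmod_div by exact Nr. rewrite (Cmod_R r), (Rabs_pos_eq r) by lra.
  set (x := Cmod (z - a)). set (y := Cmod (RtoC (r * r) - Cconj a * z)).
  assert (Px : 0 <= x) by apply Cmod_ge_0. assert (Py : 0 <= y) by apply Cmod_ge_0.
  assert (Pa := Cmod_ge_0 a). assert (Pz := Cmod_ge_0 z).
  assert (I : y ^ 2 - r ^ 2 * x ^ 2 = (r ^ 2 - Cmod a ^ 2) * (r ^ 2 - Cmod z ^ 2)).
  { unfold x, y. rewrite !Cmod2_alt. destruct a as [a1 a2], z as [z1 z2]. simpl. ring. }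
  assert (A2 : Cmod a ^ 2 <= r ^ 2) by (apply pow_incr; lra).
  assert (Z2 : Cmod z ^ 2 <= r ^ 2) by (apply pow_incr; lra).
  assert (E : forall u v, 0 <= u -> 0 <= v -> u ^ 2 <= v ^ 2 -> u <= v).
  { intros u v U V W. apply Rsqr_incr_0; unfold Rsqr; simpl in W; lra. }
  split.
  - apply Rmult_le_reg_r with r; [exact Hr |]. unfold Rdiv. rewrite Rmult_assoc, Rinv_l by lra.
    apply E; [nra | lra |]. rewrite Rpow_mult_distr. nra.
  - intros Zr. rewrite Zr in I.
    apply Rmult_eq_reg_r with r; [| lra]. unfold Rdiv. rewrite Rmult_assoc, Rinv_l by lra.
    apply Rle_antisym; apply E; try nra.
Qed.

Lemma Cmod_reflect (r : R) (L : list C) (z : C) : 0 < r -> (forall a, In a L -> Cmod a <= r) -> Cmod z <= r ->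
  Cmod (prodlin L z) <= Cmod (reflect r L z) /\
  (Cmod z = r -> Cmod (prodlin L z) = Cmod (reflect r L z)).
Proof.
  intros Hr A Z. induction L as [| a L IH]; [simpl; split; auto; lra |].
  destruct IH as [I1 I2]; [intros b Hb; apply A; now right |].
  destruct (Cmod_reflect_factor r a z Hr) as [J1 J2]; [apply A; now left | exact Z |].
  cbn [prodlin reflect]. rewrite !(Cmod_mult _ (prodlin _ _)), !(Cmod_mult _ (reflect _ _ _)). split.
  - apply Rmult_le_compat; auto; apply Cmod_ge_0.
  - intros E. now rewrite I2, J2.
Qed.

Lemma reflect_neq_0 (r : R) (L : list C) (z : C) : 0 < r -> (forall a, In a L -> Cmod a < r) -> Cmod z <= r ->
  reflect r L z <> 0.
Proof.
  intros Hr A Z. assert (Nr : RtoC r <> 0) by (intros E; injection E; lra).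
  induction L as [| a L IH]; simpl; [intros E; injection E; lra |].
  apply Cmult_neq_0; [| apply IH; intros b Hb; apply A; now right].
  apply Cmult_neq_0.
  - apply Cmod_gt_0. assert (B := Cmod_lower (RtoC (r * r)) (Cconj a * z)).
    rewrite Cmod_mult, Cmod_conj, Cmod_R, Rabs_pos_eq in B by nra.
    specialize (A a (or_introl eq_refl)). assert (Pa := Cmod_ge_0 a). assert (Pz := Cmod_ge_0 z). nra.
  - intros E. apply (f_equal (Cmult (RtoC r))) in E. rewrite Cinv_r in E by exact Nr.
    rewrite Cmult_0_r in E. injection E. lra.
Qed.

Lemma Cmod_reflect_0 (r : R) (L : list C) : 0 < r -> ~ In (RtoC 0) L ->
  Cmod (reflect r L (RtoC 0)) = Cmod (prodlin L (RtoC 0)) * exp (sumlog r L).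
Proof.
  intros Hr. assert (Nr : RtoC r <> 0) by (intros E; injection E; lra).
  induction L as [| a L IH]; intros N; cbn [reflect prodlin sumlog].
  - rewrite exp_0. ring.
  - assert (Na : a <> 0) by (intros E; apply N; left; exact E).
    assert (Pa : 0 < Cmod a) by now apply Cmod_gt_0.
    rewrite !(Cmod_mult _ (prodlin _ _)), !(Cmod_mult _ (reflect _ _ _)), IH by (intros I; apply N; now right).
    rewrite exp_plus, exp_ln by (apply Rdiv_lt_0_compat; lra).
    replace ((RtoC (r * r) - Cconj a * 0) / RtoC r)%C with (RtoC r)
      by (rewrite RtoC_mult; field; exact Nr).
    replace (0 - a)%C with (- a)%C by ring. rewrite Cmod_opp, Cmod_R, Rabs_pos_eq by lra.
    field. lra.
Qed.

Lemma Cmod_le_mean (f : C -> C) (r : R) : holomorphic_on_D f -> 0 <= r < 1 ->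
  Cmod (f (RtoC 0)) <= Rmean (fun t => Cmod (f (circ r t))).
Proof.
  intros H Hr. rewrite <- (Cmean_value f 1 r H Hr).
  assert (HP := holo_pcont f r H Hr).
  apply Cmod_Cmean_le; [exact HP | | intros; lra].
  apply ex_RInt_all. intros t. apply (clim_Cmod _ _ (HP t)).
Qed.

(** Replacing the linear factors by their reflections keeps the modulus on the circle and multiplies
    it at 0 by [exp (sumlog r L)]; the sub-mean value property does the rest. Averaging |F| rather
    than ln|F| keeps the integrand continuous when F vanishes on the circle. *)
Theorem jensen (F G : C -> C) (L : list C) (r : R) : holomorphic_on_D G -> 0 < r < 1 ->
  (forall z, Cmod z < 1 -> F z = prodlin L z * G z)%C -> (forall a, In a L -> Cmod a <= r) -> ~ In (RtoC 0) L ->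
  Cmod (F (RtoC 0)) * exp (sumlog r L) <= Rmean (fun t => Cmod (F (circ r t))).
Proof.
  intros H Hr E A N.
  assert (M := Cmod_le_mean (fun z => reflect r L z * G z)%C r
    (holo_mult _ _ (holo_reflect r L ltac:(lra)) H) ltac:(lra)). cbv beta in M.
  rewrite E, !Cmod_mult by (rewrite Cmod_0; lra). rewrite Cmod_mult, Cmod_reflect_0 in M by (auto; lra).
  rewrite (Rmean_ext _ (fun t => Cmod (F (circ r t)))) in M.
  - eapply Rle_trans; [| exact M]. apply Req_le. ring.
  - intros t. rewrite E, !Cmod_mult by (rewrite Cmod_circ; lra). f_equal. symmetry.
    apply Cmod_reflect; [lra | exact A | |]; rewrite Cmod_circ; lra.
Qed.

Lemma sumlog_lower (r s : R) (L : list C) : 0 < s -> s < r ->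
  (forall a, In a L -> Cmod a < s) -> ~ In (RtoC 0) L -> INR (length L) * ln (r / s) <= sumlog r L.
Proof.
  intros Hs Hr A N. induction L as [| a L IH]; [simpl; lra |].
  cbn [length sumlog]. rewrite S_INR.
  assert (Pa : 0 < Cmod a) by (apply Cmod_gt_0; intros E; apply N; now left).
  assert (Aa := A a (or_introl eq_refl)).
  assert (ln (r / s) <= ln (r / Cmod a)).
  { left. apply ln_increasing; [apply Rdiv_lt_0_compat; lra |].
    apply Rmult_lt_compat_l; [lra |]. apply Rinv_lt_contravar; [nra | exact Aa]. }
  assert (I := IH (fun b Hb => A b (or_intror Hb)) (fun H => N (or_intror H))). lra.
Qed.

(* Dividing out zeros terminates since Jensen's inequality bounds their number. *)
Theorem zeros_factor (F : C -> C) (s : R) : holomorphic_on_D F -> F (RtoC 0) <> 0 -> 0 < s < 1 ->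
  exists L Q, (forall a, In a L -> Cmod a < s) /\ holomorphic_on_D Q /\
    (forall z, F z = prodlin L z * Q z)%C /\ (forall z, Cmod z < s -> Q z <> 0).
Proof.
  intros H F0 Hs. apply NNPP. intros NN.
  assert (Step : forall n, exists L Q, length L = n /\ (forall a, In a L -> Cmod a < s) /\
     holomorphic_on_D Q /\ (forall z, F z = prodlin L z * Q z)%C).
  { induction n as [| n (L & Q & Ln & A & HQ & E)].
    - exists nil, F. repeat split; [intros a []| exact H |]. intros z. simpl. ring.
    - destruct (classic (exists a, Cmod a < s /\ Q a = 0)) as [(a & Ha & Qa) | N0].
      + destruct (holo_divide Q a HQ ltac:(lra) Qa) as [G [HG EG]].
        exists (a :: L), G. repeat split.
        * simpl. now rewrite Ln.
        * intros b [<- | Hb]; [exact Ha | now apply A].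
        * exact HG.
        * intros z. rewrite E, EG. simpl. ring.
      + exfalso. apply NN. exists L, Q. repeat split; auto.
        intros z Z Ez. apply N0. now exists z. }
  set (r := (1 + s) / 2).
  set (B := Rmean (fun t => Cmod (F (circ r t)))).
  assert (P0 : 0 < Cmod (F (RtoC 0))) by now apply Cmod_gt_0.
  assert (Lr : 0 < ln (r / s)).
  { rewrite <- ln_1. apply ln_increasing; [lra |]. unfold r.
    apply Rmult_lt_reg_r with s; [lra |]. unfold Rdiv at 1. rewrite Rmult_assoc, Rinv_l; lra. }
  (* With n zeros of modulus below s the left side of Jensen's inequality exceeds |F(0)| n ln(r/s),
     so this n makes it larger than [B]. *)
  destruct (INR_unbounded (B / Cmod (F (RtoC 0)) / ln (r / s))) as [n Hn].
  destruct (Step n) as (L & Q & Ln & A & HQ & E).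
  assert (N : ~ In (RtoC 0) L).
  { intros I. apply F0. rewrite E, prodlin_eq_0 by exact I. ring. }
  assert (J := jensen F Q L r HQ ltac:(unfold r; lra) (fun z _ => E z)
     (fun a Ha => ltac:(specialize (A a Ha); unfold r; lra)) N). fold B in J.
  assert (S := sumlog_lower r s L ltac:(lra) ltac:(unfold r; lra) A N). rewrite Ln in S.
  assert (X := exp_ineq1_le (sumlog r L)).
  assert (EB : B = B / Cmod (F (RtoC 0)) / ln (r / s) * (ln (r / s) * Cmod (F (RtoC 0)))) by (field; lra).
  assert (Pl : 0 < ln (r / s) * Cmod (F (RtoC 0))) by now apply Rmult_lt_0_compat.
  assert (Y : B < Cmod (F (RtoC 0)) * (INR n * ln (r / s))).
  { rewrite EB. apply Rmult_gt_compat_r with (r := ln (r / s) * Cmod (F (RtoC 0))) in Hn; [lra | exact Pl]. }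
  assert (Z : Cmod (F (RtoC 0)) * (INR n * ln (r / s)) <= Cmod (F (RtoC 0)) * exp (sumlog r L))
    by (apply Rmult_le_compat_l; lra).
  lra.
Qed.

(** Each differentiation lowers the power of z - a by one and multiplies the cofactor at [a] by the
    old exponent; [c] is thus a falling factorial, of which only its being nonzero matters. *)
Lemma Cderiv_n_factor (F G : C -> C) (a w : C) (m : nat) : holomorphic_on_D G ->
  (forall z, Cmod z < 1 -> F z = w + (z - a) ^ m * G z)%C ->
  forall k, (1 <= k)%nat -> (k <= m)%nat -> exists Gk (c : R), holomorphic_on_D Gk /\ c <> 0 /\
    Gk a = (RtoC c * G a)%C /\ forall z, Cmod z < 1 -> Cderiv_n k F z = ((z - a) ^ (m - k) * Gk z)%C.
Proof.
  intros HG E.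
  assert (Step : forall (H K : C -> C) (u : C) j, holomorphic_on_D K ->
    (forall z, Cmod z < 1 -> H z = u + (z - a) ^ S j * K z)%C ->
    exists K', holomorphic_on_D K' /\ K' a = (RtoC (INR (S j)) * K a)%C /\
      forall z, Cmod z < 1 -> Cderiv H z = ((z - a) ^ j * K' z)%C).
  { intros H K u j HK EH.
    exists (fun z => RtoC (INR (S j)) * K z + (z - a) * Cderiv K z)%C. repeat split.
    - apply holo_plus; [apply holo_mult; [apply holo_const | exact HK] |].
      apply holo_mult; [apply holo_minus; [apply holo_id | apply holo_const] | now apply Cderiv_holo].
    - ring.
    - intros z Z. apply Cderiv_unique.
      assert (D := cder_plus _ _ z _ _ (cder_const u z)
        (cder_mult _ _ z _ _ (cder_pow _ z _ j (cder_minus _ _ z _ _ (cder_id z) (cder_const a z)))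
          (Cderiv_correct K z (HK z Z)))). cbv beta in D.
      apply (cder_ext_loc _ H z _ (1 - Cmod z)) in D; [| lra |].
      + eapply cder_eq; [exact D |]. cbn [Cpow]. ring.
      + intros y Y. symmetry. apply EH. assert (B := Cmod_lower y z). lra. }
  induction k as [| k IH]; intros K1 Km; [lia |].
  (* The first derivative is treated apart because it removes the constant [w]; from then on the
     constant term is 0. *)
  destruct k as [| k].
  - destruct (Step F G w (m - 1)%nat HG) as (K' & HK' & Ka & EK).
    { intros z Z. rewrite E by exact Z. do 3 f_equal. lia. }
    exists K', (INR (S (m - 1))). repeat split; auto. apply not_0_INR. lia.
  - destruct IH as (Gk & c & HGk & Hc & Ga & EG); [lia | lia |].
    destruct (Step (Cderiv_n (S k) F) Gk (RtoC 0) (m - S (S k))%nat HGk) as (K' & HK' & Ka & EK).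
    { intros z Z. rewrite EG by exact Z. rewrite Cplus_0_l. do 2 f_equal. lia. }
    exists K', (INR (S (m - S (S k))) * c). repeat split; auto.
    + apply Rmult_integral_contrapositive_currified; [apply not_0_INR; lia | exact Hc].
    + rewrite Ka, Ga, RtoC_mult. ring.
Qed.

Lemma Cpow_0_l (n : nat) : n <> O -> (RtoC 0 ^ n)%C = 0.
Proof. destruct n; [easy |]. intros _. simpl. ring. Qed.

Lemma is_mult_of_factor (F G : C -> C) (a w : C) (m : nat) : holomorphic_on_D G -> Cmod a < 1 ->
  (1 <= m)%nat -> (forall z, Cmod z < 1 -> F z = w + (z - a) ^ m * G z)%C -> G a <> 0 -> is_mult F a m.
Proof.
  intros HG A Hm E N.
  assert (X : (a - a)%C = RtoC 0) by ring.
  split; [exact Hm |]. split.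
  - intros k K1 Km. destruct (Cderiv_n_factor F G a w m HG E k K1 ltac:(lia)) as (Gk & c & _ & _ & _ & EG).
    rewrite EG, X, Cpow_0_l by (auto; lia). ring.
  - destruct (Cderiv_n_factor F G a w m HG E m Hm ltac:(lia)) as (Gk & c & _ & Hc & Ga & EG).
    rewrite EG, X, Nat.sub_diag, Ga by exact A. simpl. rewrite Cmult_1_l.
    apply Cmult_neq_0; [| exact N]. intros F0. injection F0. exact Hc.
Qed.

(** While fewer than m factors z - a have been taken out, the vanishing derivative of that order
    forces the cofactor to vanish at [a], and one more factor can be divided out. *)
Lemma factor_of_is_mult (F : C -> C) (a w : C) (m : nat) : holomorphic_on_D F -> Cmod a < 1 ->
  F a = w -> is_mult F a m -> exists G, holomorphic_on_D G /\ forall z, (F z = w + (z - a) ^ m * G z)%C.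
Proof.
  intros HF A Fa (M1 & M2 & M3).
  assert (X : (a - a)%C = RtoC 0) by ring.
  assert (S : forall k, (k <= m)%nat -> exists G, holomorphic_on_D G /\ forall z, (F z = w + (z - a) ^ k * G z)%C).
  { induction k as [| k IH]; intros Hk.
    - exists (fun z => F z - w)%C. split; [apply holo_minus; [exact HF | apply holo_const] |].
      intros z. simpl. ring.
    - destruct IH as (G & HG & E); [lia |].
      assert (G0 : G a = 0).
      { destruct k as [| k].
        - specialize (E a). rewrite Fa in E. simpl in E.
          replace (G a) with (w + 1 * G a - w)%C by ring. rewrite <- E. ring.
        - destruct (Cderiv_n_factor F G a w (S k) HG (fun z _ => E z) (S k) ltac:(lia) ltac:(lia)) as (Gk & c & _ & Hc & Ga & EG).
          specialize (EG a A). rewrite M2 in EG by lia. rewrite X, Nat.sub_diag, Ga in EG. simpl in EG.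
          apply Cmod_eq_0. apply (f_equal Cmod) in EG. rewrite Cmod_0, !Cmod_mult, Cmod_1, Cmod_R in EG.
          assert (Pc := Rabs_pos_lt c Hc). assert (Pg := Cmod_ge_0 (G a)). nra. }
      destruct (holo_divide G a HG A G0) as [G' [HG' EG']].
      exists G'. split; [exact HG' |]. intros z. rewrite E, EG'. simpl. ring. }
  now apply S.
Qed.

Lemma ccont_eq_off_point (f g : C -> C) (a : C) : ccont f a -> ccont g a ->
  (forall z, z <> a -> f z = g z) -> f a = g a.
Proof.
  intros F G E.
  destruct (Req_dec (Cmod (f a - g a)) 0) as [Z | N].
  - apply Cmod_eq_0 in Z. replace (f a) with (f a - g a + g a)%C by ring. rewrite Z. ring.
  - exfalso. assert (P := Cmod_ge_0 (f a - g a)). set (e := Cmod (f a - g a) / 2).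
    destruct (F e ltac:(unfold e; lra)) as [d1 [D1 F1]].
    destruct (G e ltac:(unfold e; lra)) as [d2 [D2 G1]].
    set (d := Rmin d1 d2 / 2). assert (Hd : 0 < Rmin d1 d2) by now apply Rmin_pos.
    assert (M1 := Rmin_l d1 d2). assert (M2 := Rmin_r d1 d2).
    set (z := (a + RtoC d)%C). assert (Ez : (z - a)%C = RtoC d) by (unfold z; ring).
    assert (Mz : Cmod (z - a) = d) by (rewrite Ez, Cmod_R, Rabs_pos_eq; unfold d; lra).
    assert (Nz : z <> a).
    { intros Q. rewrite Q in Mz. replace (a - a)%C with (RtoC 0) in Mz by ring.
      rewrite Cmod_0 in Mz. unfold d in Mz. lra. }
    specialize (F1 z ltac:(rewrite Mz; unfold d; lra)). specialize (G1 z ltac:(rewrite Mz; unfold d; lra)).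
    rewrite (E z Nz) in F1.
    assert (T := Cmod_tri_minus (f a) (g z) (g a)). rewrite (Cmod_sym (f a) (g z)) in T.
    unfold e in *. lra.
Qed.

(** * Lists of zeros with multiplicity and the counting function *)

Lemma prodlin_repeat (a : C) (m : nat) (z : C) : prodlin (repeat a m) z = ((z - a) ^ m)%C.
Proof. induction m as [| m IH]; simpl; [reflexivity | now rewrite IH]. Qed.

Lemma prodlin_app (L M : list C) (z : C) : prodlin (L ++ M) z = (prodlin L z * prodlin M z)%C.
Proof. induction L as [| a L IH]; simpl; [ring | rewrite IH; ring]. Qed.

(** The powers of z - a are peeled off one at a time: after cancelling, by continuity at [a], the
    linear factors do not vanish there, so the remaining cofactor must. *)
Lemma factor_coprime (L : list C) (G H : C -> C) (a : C) (m : nat) :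
  holomorphic_on_D G -> holomorphic_on_D H -> Cmod a < 1 -> ~ In a L ->
  (forall z, prodlin L z * G z = (z - a) ^ m * H z)%C ->
  exists G', holomorphic_on_D G' /\ forall z, (G z = (z - a) ^ m * G' z)%C.
Proof.
  intros HG HH A N E.
  assert (S : forall k, (k <= m)%nat -> exists G', holomorphic_on_D G' /\ forall z, (G z = (z - a) ^ k * G' z)%C).
  { induction k as [| k IH]; intros Hk.
    - exists G. split; [exact HG |]. intros z. simpl. ring.
    - destruct IH as (K & HK & EK); [lia |].
      assert (Z : (prodlin L a * K a)%C = ((a - a) ^ (m - k) * H a)%C).
      { apply (ccont_eq_off_point (fun z => prodlin L z * K z)%C (fun z => (z - a) ^ (m - k) * H z)%C).
        - apply (holo_cont (fun z => prodlin L z * K z)%C); [| exact A].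
          apply holo_mult; [apply holo_prodlin | exact HK].
        - apply (holo_cont (fun z => (z - a) ^ (m - k) * H z)%C); [| exact A].
          apply holo_mult; [| exact HH]. apply (holo_pow (fun z => z - a)%C).
          apply holo_minus; [apply holo_id | apply holo_const].
        - intros z Nz. assert (Nz' := Cpow_nz _ k (Csub_neq_0 z a Nz)).
          specialize (E z). rewrite EK in E. replace m with (k + (m - k))%nat in E by lia.
          rewrite Cpow_add_r in E.
          replace (prodlin L z * K z)%C with (/ (z - a) ^ k * (prodlin L z * ((z - a) ^ k * K z)))%C by (field; exact Nz').
          rewrite E. field. exact Nz'. }
      assert (K0 : K a = 0).
      { replace (a - a)%C with (RtoC 0) in Z by ring. rewrite Cpow_0_l in Z by lia.
        assert (Np := prodlin_neq_0 L a N).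
        replace (K a) with (/ prodlin L a * (prodlin L a * K a))%C by (field; exact Np).
        rewrite Z. ring. }
      destruct (holo_divide K a HK A K0) as [G' [HG' EG']].
      exists G'. split; [exact HG' |]. intros z. rewrite EK, EG'. simpl. ring. }
  now apply S.
Qed.

(** Jensen's inequality wants zeros repeated, the counting function wants distinct points with
    multiplicities; this passes from the second form to the first, and [group_list] goes back. *)
Definition expand (l : list (C * nat)) : list C := flat_map (fun p => repeat (fst p) (snd p)) l.

Lemma in_expand (l : list (C * nat)) (a : C) : In a (expand l) -> In a (map fst l).
Proof.
  unfold expand. rewrite in_flat_map. intros (p & Hp & Ha).
  apply repeat_spec in Ha. subst a. now apply in_map.
Qed.

(** Since the points of the list are distinct, each power (z - a)^m divides the cofactor left by the
    other points. *)
Lemma expand_factor (phi : C -> C) (w : C) (l : list (C * nat)) : holomorphic_on_D phi ->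
  NoDup (map fst l) ->
  (forall p, In p l -> inD (fst p) /\ phi (fst p) = w /\ is_mult phi (fst p) (snd p)) ->
  exists G, holomorphic_on_D G /\ forall z, (phi z - w = prodlin (expand l) z * G z)%C.
Proof.
  intros H. induction l as [| [a m] l IH]; intros ND B.
  - exists (fun z => phi z - w)%C. split; [apply holo_minus; [exact H | apply holo_const] |].
    intros z. simpl. ring.
  - inversion ND as [| x y Nin ND']; subst.
    destruct IH as (G & HG & E); [exact ND' | intros p Hp; apply B; now right |].
    destruct (B (a, m) (or_introl eq_refl)) as (B1 & B2 & B3). simpl in *.
    destruct (factor_of_is_mult phi a w m H B1 B2 B3) as (K & HK & EK).
    destruct (factor_coprime (expand l) G K a m HG HK B1) as (G' & HG' & EG').
    + intros I. apply Nin. now apply in_expand.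
    + intros z. rewrite <- E, EK. ring.
    + exists G'. split; [exact HG' |]. intros z. rewrite E, EG'.
      change (expand ((a, m) :: l)) with (repeat a m ++ expand l).
      rewrite prodlin_app, prodlin_repeat. ring.
Qed.

Lemma sumlog_app (r : R) (L M : list C) : sumlog r (L ++ M) = sumlog r L + sumlog r M.
Proof. induction L as [| a L IH]; simpl; [ring | rewrite IH; ring]. Qed.

Lemma sumlog_repeat (r : R) (a : C) (m : nat) : sumlog r (repeat a m) = INR m * ln (r / Cmod a).
Proof.
  induction m as [| m IH]; [simpl; ring |]. cbn [repeat sumlog]. rewrite IH, S_INR. ring.
Qed.

Lemma wsum_expand (l : list (C * nat)) : wsum l = sumlog 1 (expand l).
Proof.
  induction l as [| [a m] l IH]; [reflexivity |].
  change (expand ((a, m) :: l)) with (repeat a m ++ expand l).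
  rewrite sumlog_app, sumlog_repeat, <- IH. simpl. unfold Rdiv. now rewrite Rmult_1_l.
Qed.

Definition C_eq_dec (x y : C) : {x = y} + {x <> y} := excluded_middle_informative (x = y).

Lemma count_occ_remove_neq (L : list C) (a b : C) : a <> b ->
  count_occ C_eq_dec (remove C_eq_dec a L) b = count_occ C_eq_dec L b.
Proof.
  intros N. induction L as [| c L IH]; [reflexivity |]. simpl.
  destruct (C_eq_dec a c) as [<- | N1].
  - destruct (C_eq_dec a b); [contradiction | exact IH].
  - simpl. destruct (C_eq_dec c b); now rewrite IH.
Qed.

Lemma sumlog_remove (r : R) (L : list C) (a : C) :
  sumlog r L = INR (count_occ C_eq_dec L a) * ln (r / Cmod a) + sumlog r (remove C_eq_dec a L).
Proof.
  induction L as [| c L IH]; [simpl; ring |]. cbn [sumlog count_occ remove].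
  destruct (C_eq_dec c a) as [-> | N1]; destruct (C_eq_dec a _) as [E | N2]; try congruence.
  - rewrite IH, S_INR. ring.
  - cbn [sumlog]. rewrite IH. ring.
Qed.

Lemma prodlin_remove (L : list C) (a z : C) :
  prodlin L z = ((z - a) ^ count_occ C_eq_dec L a * prodlin (remove C_eq_dec a L) z)%C.
Proof.
  induction L as [| c L IH]; [simpl; ring |]. cbn [prodlin count_occ remove].
  destruct (C_eq_dec c a) as [-> | N1]; destruct (C_eq_dec a _) as [E | N2]; try congruence.
  - rewrite IH. simpl. ring.
  - cbn [prodlin]. rewrite IH. ring.
Qed.

(** The head is recorded with its number of occurrences and all its copies are removed; the
    induction is on a bound for the length, as the list left over is not the tail. *)
Lemma group_list (L : list C) : exists l : list (C * nat), NoDup (map fst l) /\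
  (forall p, In p l -> In (fst p) L /\ snd p = count_occ C_eq_dec L (fst p)) /\ wsum l = sumlog 1 L.
Proof.
  remember (length L) as n eqn:Hn. assert (Hn' : (length L <= n)%nat) by lia. clear Hn.
  revert L Hn'. induction n as [| n IH]; intros L Hn.
  - destruct L; simpl in Hn; [| lia]. exists nil. split; [constructor | split; [intros p [] | reflexivity]].
  - destruct L as [| a L]; [exists nil; repeat split; [constructor | |]; easy |].
    destruct (IH (remove C_eq_dec a (a :: L))) as (l & ND & B & W).
    { assert (X := remove_length_le C_eq_dec L a). simpl in *. destruct (C_eq_dec a a); [lia | congruence]. }
    exists ((a, count_occ C_eq_dec (a :: L) a) :: l). split; [| split].
    + simpl. constructor; [| exact ND]. rewrite in_map_iff. intros (p & Ep & Hp).
      destruct (B p Hp) as [B1 _]. rewrite Ep in B1. now apply remove_In in B1.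
    + intros p [<- | Hp]; [split; [now left | reflexivity] |].
      destruct (B p Hp) as [B1 B2]. assert (B3 := in_remove _ _ _ _ B1).
      split; [apply B3 |]. rewrite B2. apply count_occ_remove_neq. intros E. destruct B3 as [_ B4]. apply B4. now symmetry.
    + rewrite (sumlog_remove 1 (a :: L) a), <- W. unfold wsum. cbn [fold_right fst snd].
      unfold Rdiv. now rewrite Rmult_1_l.
Qed.

(** As [Q] vanishes at no point of the list, the number of occurrences of a point is its exact
    multiplicity, so the list gives an admissible partial sum. This is how the hypothesis on the
    counting function enters the sufficiency proof. *)
Lemma N_partial_of_factor (phi Q : C -> C) (w : C) (L : list C) : holomorphic_on_D Q ->
  (forall z, Cmod z < 1 -> phi z - w = prodlin L z * Q z)%C ->
  (forall a, In a L -> Cmod a < 1 /\ Q a <> 0) -> N_partial phi w (sumlog 1 L).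
Proof.
  intros HQ E A. destruct (group_list L) as (l & ND & B & W).
  exists l. split; [exact ND |]. split; [| now symmetry].
  intros [a m] Hp. destruct (B _ Hp) as [B1 B2]. simpl in *. destruct (A a B1) as [A1 A2].
  split; [exact A1 |]. split.
  - specialize (E a A1). rewrite prodlin_eq_0 in E by exact B1.
    replace (phi a) with (phi a - w + w)%C by ring. rewrite E. ring.
  - apply (is_mult_of_factor phi (fun z => prodlin (remove C_eq_dec a L) z * Q z)%C a w m).
    + apply holo_mult; [apply holo_prodlin | exact HQ].
    + exact A1.
    + rewrite B2. apply (count_occ_In C_eq_dec) in B1. lia.
    + intros z Z. rewrite B2. replace (phi z) with (w + (phi z - w))%C by ring.
      rewrite E, (prodlin_remove L a z) by exact Z. ring.
    + apply Cmult_neq_0; [apply prodlin_neq_0, remove_In | exact A2].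
Qed.

Lemma Nevanlinna_off_center (phi : C -> C) (w : C) : w <> phi (RtoC 0) ->
  Nevanlinna phi w = Lub_Rbar (N_partial phi w).
Proof.
  intros N. unfold Nevanlinna.
  destruct (Req_EM_T (fst w) (fst (phi (RtoC 0)))) as [E1 |]; [| reflexivity].
  destruct (Req_EM_T (snd w) (snd (phi (RtoC 0)))) as [E2 |]; [| reflexivity].
  exfalso. apply N. now apply injective_projections.
Qed.

(** * Necessity *)

Lemma one_sub_conj_neq_0 (w z : C) : Cmod w < 1 -> Cmod z < 1 -> (1 - Cconj w * z)%C <> 0.
Proof.
  intros W Z. apply Cmod_gt_0. assert (B := Cmod_lower 1 (Cconj w * z)).
  rewrite Cmod_mult, Cmod_conj, Cmod_1 in B.
  assert (Pa := Cmod_ge_0 w). assert (Pz := Cmod_ge_0 z). nra.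
Qed.

Definition szego (w z : C) : C := (/ (1 - Cconj w * z))%C.

Lemma holo_szego (w : C) : Cmod w < 1 -> holomorphic_on_D (szego w).
Proof.
  intros W z Z. eexists. apply cder_inv; [now apply one_sub_conj_neq_0 |].
  apply cder_minus; [apply cder_const | apply cder_scal, cder_id].
Qed.

(* On |z| = r the conjugate of the kernel is the Cauchy kernel at r^2 w. *)
Lemma mean2_szego (w : C) (r : R) : Cmod w < 1 -> 0 < r < 1 ->
  mean2 (szego w) r <= / (1 - Cmod w ^ 2).
Proof.
  intros W Hr. assert (Pw := Cmod_ge_0 w).
  assert (Z : Cmod (RtoC (r * r) * w) < r < 1).
  { rewrite Cmod_mult, Cmod_R, Rabs_pos_eq by nra. split; [| lra]. assert (r * Cmod w < 1) by nra. nra. }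
  assert (E := cauchy_formula (szego w) 1 r _ (holo_szego w W) Z).
  assert (E2 : RtoC (mean2 (szego w) r) = szego w (RtoC (r * r) * w)%C).
  { rewrite mean2_Cmean, <- E. apply Cmean_ext. intros t. rewrite Cmult_comm. f_equal.
    assert (N := circ_neq_0 r t ltac:(lra)).
    assert (N1 := one_sub_conj_neq_0 w (circ r t) W ltac:(rewrite Cmod_circ; lra)).
    assert (N2 := circ_sub_neq_0 r t _ (proj1 Z)).
    unfold szego. rewrite Cinv_conj by exact N1.
    rewrite Cminus_conj, Cmult_conj, Cconj_conj, circ_conj by lra.
    replace (Cconj 1) with (RtoC 1) by (unfold Cconj, RtoC; simpl; f_equal; ring).
    field. split; [| exact N].
    - intros F. apply N2. rewrite <- F. ring. }
  assert (Q : (Cconj w * (RtoC (r * r) * w))%C = RtoC (r * r * Cmod w ^ 2)).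
  { rewrite (RtoC_mult (r * r)), Cmod2_conj. ring. }
  unfold szego in E2 at 2. rewrite Q, <- RtoC_minus in E2.
  assert (B0 : 0 <= Cmod w ^ 2 < 1).
  { split; [apply pow2_ge_0 |]. simpl. nra. }
  assert (B1 : r * r <= 1) by nra.
  assert (B : r * r * Cmod w ^ 2 <= Cmod w ^ 2 /\ Cmod w ^ 2 < 1) by nra.
  rewrite <- RtoC_inv in E2 by lra. injection E2 as E2. rewrite E2.
  apply Rinv_le_contravar; lra.
Qed.

Lemma Cderiv_n_szego (w : C) (n : nat) (z : C) : Cmod w < 1 -> Cmod z < 1 ->
  Cderiv_n n (szego w) z = (RtoC (INR (fact n)) * Cconj w ^ n * szego w z ^ S n)%C.
Proof.
  intros W. revert z. induction n as [| n IH]; intros z Z.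
  - simpl. ring.
  - cbn [Cderiv_n]. apply Cderiv_unique.
    assert (N := one_sub_conj_neq_0 w z W Z).
    assert (D : cder (szego w) z (Cconj w * szego w z ^ 2)%C).
    { eapply cder_eq.
      - apply cder_inv; [exact N |].
        apply cder_minus; [apply cder_const | apply cder_scal, cder_id].
      - unfold szego. simpl. field. exact N. }
    assert (D2 := cder_scal (RtoC (INR (fact n)) * Cconj w ^ n) _ z _ (cder_pow _ z _ n D)).
    cbv beta in D2.
    apply (cder_ext_loc _ (Cderiv_n n (szego w)) z _ (1 - Cmod z)) in D2; [| lra |].
    + eapply cder_eq; [exact D2 |].
      rewrite fact_simpl, mult_INR, RtoC_mult. cbn [Cpow]. ring.
    + intros y Y. symmetry. apply IH. assert (B := Cmod_lower y z). lra.
Qed.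

(** Horner form of 1 + x + ... + x^(m-1), the cofactor of 1 - x in 1 - x^m. *)
Fixpoint geom (m : nat) (x : C) : C :=
  match m with O => RtoC 0 | S m => (1 + x * geom m x)%C end.

Lemma geom_eq (m : nat) (x : C) : (1 - x ^ m = (1 - x) * geom m x)%C.
Proof. induction m as [| m IH]; simpl; [ring |]. replace (1 - x * x ^ m)%C with (1 - x + x * (1 - x ^ m))%C by ring. rewrite IH. ring. Qed.

Lemma holo_geom (m : nat) (f : C -> C) : holomorphic_on_D f -> holomorphic_on_D (fun z => geom m (f z)).
Proof.
  intros H. induction m as [| m IH]; [apply (holo_const (RtoC 0)) |].
  apply (holo_plus (fun _ => RtoC 1)); [apply holo_const | now apply holo_mult].
Qed.

Lemma cder_holo_comp (f phi : C -> C) : holomorphic_on_D f -> self_map_D phi ->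
  holomorphic_on_D (fun z => f (phi z)).
Proof.
  intros F [H S] z Z. destruct (H z Z). destruct (F (phi z) (S z Z)).
  eexists. apply (cder_comp f phi); eassumption.
Qed.

Lemma list_max_lt_1 (L : list C) : (forall a, In a L -> Cmod a < 1) ->
  exists r, 0 < r < 1 /\ forall a, In a L -> Cmod a <= r.
Proof.
  induction L as [| a L IH]; intros A.
  - exists (/ 2). split; [lra | intros a []].
  - destruct IH as [r [Hr B]]; [intros b Hb; apply A; now right |].
    exists (Rmax r (Cmod a)). assert (M := Rmax_l r (Cmod a)). assert (M' := Rmax_r r (Cmod a)).
    specialize (A a (or_introl eq_refl)). split.
    + split; [lra |]. apply Rmax_lub_lt; lra.
    + intros b [<- | Hb]; [exact M' |]. specialize (B b Hb). lra.
Qed.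

Lemma sumlog_radius (r : R) (L : list C) : 0 < r -> ~ In (RtoC 0) L ->
  sumlog r L = sumlog 1 L + INR (length L) * ln r.
Proof.
  intros Hr N. induction L as [| a L IH]; [simpl; ring |].
  cbn [sumlog length]. rewrite IH, S_INR by (intros I; apply N; now right).
  assert (Pa : 0 < Cmod a) by (apply Cmod_gt_0; intros E; apply N; now left).
  unfold Rdiv. rewrite !ln_mult by (try apply Rinv_0_lt_compat; lra). rewrite ln_1. ring.
Qed.

Lemma ln_inv_lower (x : R) : 0 < x -> 1 - x <= ln (/ x).
Proof. intros H. rewrite ln_Rinv by exact H. assert (B := exp_ineq1_le (ln x)). rewrite exp_ln in B by exact H. lra. Qed.

(** For a finite list the sum at radius r differs from that at radius 1 by length times ln r, which
    tends to 0. *)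
Lemma sumlog_limit (L : list C) (eta r0 : R) : 0 < r0 < 1 -> ~ In (RtoC 0) L ->
  (forall r, r0 <= r < 1 -> sumlog r L <= eta) -> sumlog 1 L <= eta.
Proof.
  intros Hr N B. apply Rnot_lt_le. intros Lt.
  set (d := sumlog 1 L - eta). set (m := INR (length L) + 1).
  assert (Pm : 1 <= m) by (unfold m; assert (X := pos_INR (length L)); lra).
  set (r := Rmax r0 (/ (1 + d / m))).
  assert (Hd : 0 < d / m) by (apply Rdiv_lt_0_compat; unfold d; lra).
  assert (I1 : / (1 + d / m) < 1) by (rewrite <- Rinv_1; apply Rinv_lt_contravar; lra).
  assert (R1 : r0 <= r) by apply Rmax_l. assert (R2 : / (1 + d / m) <= r) by apply Rmax_r.
  assert (R3 : r < 1) by (apply Rmax_lub_lt; lra).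
  specialize (B r ltac:(lra)). rewrite sumlog_radius in B by (auto; lra).
  assert (X : ln (/ r) <= d / m).
  { assert (Y := exp_ineq1_le (ln (/ r))).
    assert (Pr : 0 < / r) by (apply Rinv_0_lt_compat; lra). rewrite exp_ln in Y by exact Pr.
    assert (W : / r <= 1 + d / m).
    { rewrite <- (Rinv_inv (1 + d / m)). apply Rinv_le_contravar; [apply Rinv_0_lt_compat; lra | exact R2]. }
    lra. }
  rewrite ln_Rinv in X by lra.
  assert (Q : INR (length L) * (- ln r) < d); [| unfold d in *; lra].
  assert (L0 : ln r < 0) by (rewrite <- ln_1; apply ln_increasing; lra).
  apply Rlt_le_trans with (m * (- ln r)); [unfold m; nra |].
  apply Rle_trans with (m * (d / m)); [apply Rmult_le_compat_l; lra |].
  apply Req_le. field. lra.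
Qed.

(** The bound must not depend on the list, since the counting function is a supremum over finite
    lists. The condition relating w to phi(0) forces |x(0)| <= 1/2, which keeps |F(0)| away from
    0. *)
Lemma necessity_sumlog (phi : C -> C) (n : nat) (K : R) (w : C) (L : list C) (G : C -> C) :
  self_map_D phi -> 0 <= K ->
  (forall f M r, H2_norm2 f M -> 0 < r < 1 -> mean2 (Dphin phi n f) r <= K * M) ->
  / 2 <= Cmod w < 1 -> 2 * (1 - Cmod w ^ 2) <= 1 - Cmod (phi (RtoC 0)) -> ~ In (RtoC 0) L ->
  holomorphic_on_D G -> (forall z, phi z - w = prodlin L z * G z)%C ->
  (forall a, In a L -> Cmod a < 1) ->
  sumlog 1 L <= 2 * (K * 4 ^ n + / (1 - Cmod (phi (RtoC 0))) ^ (2 * n + 1)) * (1 - Cmod w ^ 2) ^ (2 * n + 1).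
Proof.
  intros SM HK Bd W Cl N0 HG E A.
  set (e := 1 - Cmod w ^ 2). set (p0 := Cmod (phi (RtoC 0))) in *.
  assert (Pp0 : 0 <= p0 < 1).
  { split; [apply Cmod_ge_0 |]. apply SM. unfold inD. rewrite Cmod_0. lra. }
  assert (He : 0 < e) by (unfold e; simpl; nra).
  assert (Nz : forall z, Cmod z < 1 -> (1 - Cconj w * phi z)%C <> 0).
  { intros z Z. apply one_sub_conj_neq_0; [lra | now apply SM]. }
  set (x := fun z => (RtoC e * szego w (phi z))%C).
  assert (Hx : holomorphic_on_D x).
  { apply holo_mult; [apply holo_const |].
    apply cder_holo_comp; [apply holo_szego; lra | exact SM]. }
  (* The n-th derivative of the test function is a multiple of its power n+1, so the square of its
     modulus carries the power 2(n+1). *)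
  set (m := (2 * (n + 1))%nat).
  set (F := fun z => (1 - x z ^ m)%C).
  set (Q := fun z => (G z * (- Cconj w * szego w (phi z)) * geom m (x z))%C).
  assert (HQ : holomorphic_on_D Q).
  { unfold Q. apply (holo_mult (fun z => G z * (- Cconj w * szego w (phi z)))%C).
    - apply holo_mult; [exact HG |]. apply holo_mult; [apply holo_const |].
      apply cder_holo_comp; [apply holo_szego; lra | exact SM].
    - now apply holo_geom. }
  assert (EF : forall z, Cmod z < 1 -> F z = (prodlin L z * Q z)%C).
  { intros z Z. unfold F, Q. rewrite geom_eq.
    (* Because e = 1 - w conj(w), the difference 1 - conj(w) phi - e equals -conj(w) (phi - w). *)
    replace (1 - x z)%C with ((phi z - w) * (- Cconj w * szego w (phi z)))%C.
    - rewrite E. ring.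
    - unfold x, szego, e.
      rewrite RtoC_minus, Cmod2_conj. field. now apply Nz. }
  assert (B1 : forall r, 0 < r < 1 -> Rmean (fun t => Cmod (F (circ r t))) <= 1 + K * 4 ^ n * e ^ (2 * n + 1)).
  { intros r Hr.
    destruct (norm2_exists (szego w) (/ e)) as [M [HM MB]].
    - apply holo_szego. lra.
    - intros s Hs. apply mean2_szego; [lra | exact Hs].
    - assert (B := Bd _ M r HM Hr).
      (* The exact ratio of |x|^m to the squared modulus of the image of the test function. *)
      set (c := e ^ (2 * n + 2) / (INR (fact n) ^ 2 * Cmod w ^ (2 * n))).
      assert (Pf : 1 <= INR (fact n)).
      { rewrite <- INR_1. apply le_INR. apply lt_O_fact. }
      assert (Pw : 0 < Cmod w ^ (2 * n)) by (apply pow_lt; lra).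
      assert (Pf2 : 1 <= INR (fact n) ^ 2) by (simpl; nra).
      assert (Pd : 0 < INR (fact n) ^ 2 * Cmod w ^ (2 * n)) by (apply Rmult_lt_0_compat; lra).
      assert (Pc : 0 < c).
      { apply Rdiv_lt_0_compat; [now apply pow_lt |]. apply Rmult_lt_0_compat; lra. }
      assert (HF : forall t, continuous (fun t => Cmod (F (circ r t))) t).
      { intros t. apply (clim_Cmod (fun t => F (circ r t))).
        apply (holo_pcont F); [| lra]. apply holo_minus; [apply holo_const | now apply holo_pow]. }
      assert (HD : forall t, continuous (fun t => Cmod (Dphin phi n (szego w) (circ r t)) ^ 2) t).
      { intros t. apply (continuous_comp (fun t => Cmod (Dphin phi n (szego w) (circ r t))) (fun y => y ^ 2)).
        - apply (clim_Cmod (fun t => Dphin phi n (szego w) (circ r t))).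
          apply (holo_pcont (Dphin phi n (szego w))); [| lra].
          apply (cder_holo_comp (Cderiv_n n (szego w))); [apply Cderiv_n_holo, holo_szego; lra | exact SM].
        - apply (ex_derive_continuous (V := R_NormedModule)). auto_derive. exact I. }
      apply Rle_trans with (c * mean2 (Dphin phi n (szego w)) r + 1).
      + apply Rmean_affine_le; [exact HF | exact HD |].
        intros t. change (r * cos t, r * sin t) with (circ r t). unfold F, Cminus. eapply Rle_trans; [apply Cmod_triangle |].
        rewrite Cmod_1, Cmod_opp, Cmod_pow, Rplus_comm. apply Rplus_le_compat_r.
        assert (Zc : Cmod (circ r t) < 1) by (rewrite Cmod_circ; lra).
        unfold Dphin. rewrite Cderiv_n_szego by (try lra; now apply SM).
        unfold x. rewrite !Cmod_mult, !Cmod_pow, !Cmod_R, Cmod_conj, !Rabs_pos_eq by lra.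
        set (s := Cmod (szego w (phi (circ r t)))).
        apply Req_le. unfold c, m. rewrite !Rpow_mult_distr, <- !pow_mult.
        replace (n * 2)%nat with (2 * n)%nat by lia. replace (S n * 2)%nat with (2 * (n + 1))%nat by lia.
        replace (2 * n + 2)%nat with (2 * (n + 1))%nat by lia.
        field. split; [lra | apply not_0_INR, fact_neq_0].
      + assert (B2 : mean2 (Dphin phi n (szego w)) r <= K * / e).
        { eapply Rle_trans; [exact B |]. apply Rmult_le_compat_l; lra. }
        assert (B3 : c * mean2 (Dphin phi n (szego w)) r <= c * (K * / e)) by (apply Rmult_le_compat_l; lra).
        (* One power of e is spent on the norm 1/e of the test function; 4^n comes from |w| >= 1/2,
           and n! is at least 1. *)
        assert (B4 : c * (K * / e) <= K * 4 ^ n * e ^ (2 * n + 1)).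
        { unfold c. replace (2 * n + 2)%nat with (S (2 * n + 1)) by lia.
          replace (e ^ S (2 * n + 1) / (INR (fact n) ^ 2 * Cmod w ^ (2 * n)) * (K * / e))
            with (K * e ^ (2 * n + 1) * / (INR (fact n) ^ 2 * Cmod w ^ (2 * n)))
            by (cbn [pow]; set (d := INR (fact n) ^ 2 * Cmod w ^ (2 * n)) in *; field; lra).
          replace (K * 4 ^ n * e ^ (2 * n + 1)) with (K * e ^ (2 * n + 1) * 4 ^ n) by ring.
          apply Rmult_le_compat_l.
          - apply Rmult_le_pos; [exact HK | left; now apply pow_lt].
          - rewrite <- (Rinv_inv (4 ^ n)), <- pow_inv. apply Rinv_le_contravar; [apply pow_lt; lra |].
            replace (/ 4) with ((/ 2) ^ 2) by field. rewrite <- pow_mult.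
            rewrite <- (Rmult_1_l ((/ 2) ^ (2 * n))). apply Rmult_le_compat; try lra.
            + apply pow_le. lra.
            + apply pow_incr. lra. }
        lra. }
  set (a := (e / (1 - p0)) ^ (2 * n + 1)).
  assert (x0 : 0 < e / (1 - p0) <= / 2).
  { split; [apply Rdiv_lt_0_compat; lra |]. apply Rmult_le_reg_r with (1 - p0); [lra |].
    unfold Rdiv. rewrite Rmult_assoc, Rinv_l by lra. fold e in Cl. lra. }
  assert (Pa : 0 < a) by (apply pow_lt; lra).
  (* The exponent m exceeds 2n+1 by one, and the spare factor is at most 1/2. *)
  assert (F0 : 1 - a * / 2 <= Cmod (F (RtoC 0)) /\ a <= 1).
  { assert (Z0 : Cmod (RtoC 0) < 1) by (rewrite Cmod_0; lra).
    assert (X : Cmod (x (RtoC 0)) <= e / (1 - p0)).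
    { unfold x, szego. rewrite Cmod_mult, Cmod_R, Rabs_pos_eq, Cmod_inv by (auto; lra).
      apply Rmult_le_compat_l; [lra |]. apply Rinv_le_contravar; [lra |].
      assert (B := Cmod_lower 1 (Cconj w * phi (RtoC 0))).
      rewrite Cmod_mult, Cmod_conj, Cmod_1 in B. fold p0 in B. nra. }
    assert (A1 : a <= 1).
    { apply pow_le_one; lra. }
    split; [| exact A1]. unfold F. assert (B := Cmod_lower 1 (x (RtoC 0) ^ m)).
    rewrite Cmod_1, Cmod_pow in B.
    assert (Y : Cmod (x (RtoC 0)) ^ m <= a * / 2).
    { eapply Rle_trans; [apply pow_incr; split; [apply Cmod_ge_0 | exact X] |].
      unfold m. replace (2 * (n + 1))%nat with (S (2 * n + 1)) by lia. cbn [pow]. fold a. nra. }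
    lra. }
  destruct (list_max_lt_1 L A) as [r0 [Hr0 Hm]].
  apply (sumlog_limit L _ r0 Hr0 N0). intros r Hr.
  assert (J := jensen F Q L r HQ ltac:(lra) EF (fun b Hb => ltac:(specialize (Hm b Hb); lra)) N0).
  specialize (B1 r ltac:(lra)).
  assert (X := exp_ineq1_le (sumlog r L)).
  replace (2 * (K * 4 ^ n + / (1 - p0) ^ (2 * n + 1)) * e ^ (2 * n + 1))
    with (2 * (K * 4 ^ n * e ^ (2 * n + 1) + a))
    by (unfold a, Rdiv; rewrite Rpow_mult_distr, pow_inv; ring).
  set (b := K * 4 ^ n * e ^ (2 * n + 1)) in *.
  assert (Pb : 0 <= b).
  { unfold b. apply Rmult_le_pos; [apply Rmult_le_pos; [exact HK | apply pow_le; lra] | apply pow_le; lra]. }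
  (* With S for the sum and exp S >= 1 + S, this gives S (1 - a/2) <= b + a/2, hence S <= 2b + a
     because a <= 1. *)
  assert (Y : (1 - a * / 2) * exp (sumlog r L) <= 1 + b).
  { eapply Rle_trans; [| eapply Rle_trans; [exact J | exact B1]].
    apply Rmult_le_compat_r; [left; apply exp_pos | lra]. }
  nra.
Qed.

Theorem necessity (phi : C -> C) (n : nat) : self_map_D phi -> bounded_on_H2 phi n -> N_bigO phi n.
Proof.
  intros SM [K0 HB]. set (p0 := Cmod (phi (RtoC 0))).
  assert (Pp0 : 0 <= p0 < 1).
  { split; [apply Cmod_ge_0 |]. apply SM. unfold inD. rewrite Cmod_0. lra. }
  set (K := Rabs K0). assert (HK : 0 <= K) by apply Rabs_pos.
  assert (Bd : forall f M r, H2_norm2 f M -> 0 < r < 1 -> mean2 (Dphin phi n f) r <= K * M).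
  { intros f M r HM Hr. destruct (HB f M HM) as [L' [HL' LB]].
    eapply Rle_trans; [apply (mean2_le_norm2 _ L' r HL' Hr) |].
    eapply Rle_trans; [exact LB |]. apply Rmult_le_compat_r; [| apply Rle_abs].
    eapply Rle_trans; [| apply (mean2_le_norm2 _ M r HM Hr)].
    eapply Rle_trans; [| apply (parseval_sum_le_mean2 f r 0); [apply HM | exact Hr]]. simpl. lra. }
  set (C2 := 2 * (K * 4 ^ n + / (1 - p0) ^ (2 * n + 1))).
  assert (PC : 0 < C2).
  { unfold C2. apply Rmult_lt_0_compat; [lra |]. apply Rplus_le_lt_0_compat.
    - apply Rmult_le_pos; [exact HK | apply pow_le; lra].
    - apply Rinv_0_lt_compat, pow_lt. lra. }
  (* Beyond (3 + p0)/4 one has 1 - |w|^2 <= 2(1 - |w|) < (1 - p0)/2, and also |w| >= 1/2 and |w| >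
     p0. The power of 2 converts the bound through 1 - |w|^2 <= 2(1 - |w|) <= 2 ln(1/|w|). *)
  exists (C2 * 2 ^ (2 * n + 1)), ((3 + p0) / 4). split; [lra |].
  intros w W. assert (Nw : w <> phi (RtoC 0)).
  { intros E. assert (Cmod w = p0) by (unfold p0; now rewrite E). lra. }
  rewrite Nevanlinna_off_center by exact Nw.
  apply (proj2 (Lub_Rbar_correct (N_partial phi w))).
  intros s (l & ND & B & ->).
  destruct (expand_factor phi w l (proj1 SM) ND B) as (G & HG & E).
  assert (A : forall a, In a (expand l) -> Cmod a < 1).
  { intros a Ha. apply in_expand, in_map_iff in Ha. destruct Ha as (p & <- & Hp). apply (B p Hp). }
  assert (N0 : ~ In (RtoC 0) (expand l)).
  { intros I. apply Nw. apply prodlin_eq_0 in I. specialize (E (RtoC 0)). rewrite I in E.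
    replace w with (phi (RtoC 0) - (phi (RtoC 0) - w))%C by ring. rewrite E. ring. }
  assert (S := necessity_sumlog phi n K w (expand l) G SM HK Bd ltac:(lra)).
  rewrite wsum_expand. simpl. fold p0 in S. fold C2 in S.
  eapply Rle_trans; [apply S; auto; simpl; nra |].
  rewrite Rmult_assoc. apply Rmult_le_compat_l; [lra |].
  rewrite <- Rpow_mult_distr. apply pow_incr. split; [simpl; nra |].
  assert (Q := ln_inv_lower (Cmod w) ltac:(lra)). simpl. nra.
Qed.

(** * Cartan's identity as an inequality *)

Definition cont2 (F : R -> R -> R) : Prop :=
  forall x y, filterlim (fun z : R * R => F (fst z) (snd z)) (locally (x, y)) (locally (F x y)).

Lemma cont2_pt (F : R -> R -> R) (x y : R) : cont2 F -> continuity_2d_pt F x y.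
Proof. intros H. apply continuity_2d_pt_filterlim, H. Qed.

Lemma cont2_swap (F : R -> R -> R) : cont2 F -> cont2 (fun y x => F x y).
Proof.
  intros H y x. apply (filterlim_comp _ _ _ (fun z : R * R => (snd z, fst z)) (fun z : R * R => F (fst z) (snd z)) _ (locally (x, y))).
  - intros P [d D]. exists d. intros [u v] [U V]. apply D. split; assumption.
  - apply H.
Qed.

Lemma cont2_r (F : R -> R -> R) (x y : R) : cont2 F -> continuous (F x) y.
Proof.
  intros H. apply (filterlim_comp _ _ _ (fun v : R => (x, v)) (fun z : R * R => F (fst z) (snd z)) _ (locally (x, y))).
  - intros P [d D]. exists d. intros v V. apply D. split; [apply ball_center | exact V].
  - apply H.
Qed.

Lemma continuous_RInt_param (F : R -> R -> R) (c d x : R) : c <= d -> cont2 F ->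
  continuous (fun x => RInt (F x) c d) x.
Proof.
  intros cd H. apply filterlim_locally. intros eps.
  assert (He : 0 < eps / (d - c + 1)) by (apply Rdiv_lt_0_compat; [apply cond_pos | lra]).
  destruct (uniform_continuity_2d_1d' F c d x) with (eps := mkposreal _ He) as [del D].
  { intros y _. now apply cont2_pt. }
  exists del. refine (fun (u : R) B => _). change (Rabs (u - x) < del) in B.
  change (Rabs (RInt (F u) c d - RInt (F x) c d) < eps).
  assert (X : forall v, ex_RInt (F v) c d).
  { intros v. apply ex_RInt_all. intros y. now apply cont2_r. }
  rewrite <- (RInt_minus (V := R_CompleteNormedModule) (F u) (F x)) by apply X.
  apply Rle_lt_trans with ((d - c) * (eps / (d - c + 1))).
  - apply abs_RInt_le_const; [exact cd | |].
    + apply (ex_RInt_minus (V := R_NormedModule)); apply X.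
    + intros y Hy. left. assert (P := cond_pos del). apply Rabs_def2 in B.
      apply (D y x y u); try lra.
      replace (y - y) with 0 by ring. rewrite Rabs_R0. exact P.
  - assert (P := cond_pos eps). apply Rlt_le_trans with ((d - c + 1) * (eps / (d - c + 1))).
    + apply Rmult_lt_compat_r; lra.
    + apply Req_le. field. lra.
Qed.

(* Both iterated integrals have the same derivative in the upper bound [b]. *)
Lemma fubini (F : R -> R -> R) (a b c d : R) : a < b -> c <= d -> cont2 F ->
  RInt (fun x => RInt (F x) c d) a b = RInt (fun y => RInt (fun x => F x y) a b) c d.
Proof.
  intros ab cd H.
  assert (Hs := cont2_swap F H).
  assert (X : forall y u v, ex_RInt (fun x => F x y) u v).
  { intros y u v. apply ex_RInt_all. intros x. apply (cont2_r (fun y x => F x y) y x Hs). }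
  assert (CG : forall x, continuous (fun x => RInt (F x) c d) x)
    by (intros x; now apply continuous_RInt_param).
  set (Psi := fun u => RInt (fun y => RInt (fun x => F x y) a u) c d).
  assert (DPsi : forall u, is_derive Psi u (RInt (F u) c d)).
  { intros u.
    assert (DI : forall y v, is_derive (fun w : R => RInt (fun x => F x y) a w) v (F v y)).
    { intros y v. apply (is_derive_RInt (V := R_NormedModule) (fun x => F x y) _ a).
      - apply filter_forall. intros w. apply (RInt_correct (V := R_CompleteNormedModule)), X.
      - apply (cont2_r (fun y x => F x y) y v Hs). }
    assert (E : forall y v, Derive (fun w : R => RInt (fun x => F x y) a w) v = F v y)
      by (intros y v; apply is_derive_unique, DI).
    assert (D := is_derive_RInt_param (fun u y => RInt (fun x => F x y) a u) c d u).
    rewrite (RInt_ext _ (F u)) in D by (intros; apply E). apply D.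
    - apply filter_forall. intros v y _. eexists. apply DI.
    - intros y _. apply (continuity_2d_pt_ext F); [intros; now rewrite E | now apply cont2_pt].
    - apply filter_forall. intros v. apply ex_RInt_all. intros y.
      destruct (Rle_lt_dec a v) as [L | L].
      + apply (continuous_RInt_param (fun y x => F x y) a v y L Hs).
      + apply (continuous_ext (fun y => opp (RInt (fun x => F x y) v a))).
        * intros z. apply (opp_RInt_swap (V := R_CompleteNormedModule)), X.
        * apply (continuous_opp (V := R_NormedModule)).
          apply (continuous_RInt_param (fun y x => F x y) v a y ltac:(lra) Hs). }
  assert (DPhi : forall u, is_derive (fun u => RInt (fun x => RInt (F x) c d) a u) u (RInt (F u) c d)).
  { intros u. apply (is_derive_RInt (V := R_NormedModule) (fun x => RInt (F x) c d) _ a).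
    - apply filter_forall. intros w. apply (RInt_correct (V := R_CompleteNormedModule)), ex_RInt_all, CG.
    - apply CG. }
  assert (E := eq_is_derive (V := R_NormedModule) (fun u => RInt (fun x => RInt (F x) c d) a u - Psi u) a b).
  cbv beta in E.
  assert (PA : Psi a = 0).
  { unfold Psi. rewrite (RInt_ext _ (fun _ => 0)) by (intros; exact (RInt_point (V := R_CompleteNormedModule) _ _)).
    rewrite RInt_const. apply Rmult_0_r. }
  rewrite RInt_point, PA in E. change zero with 0 in E.
  change (RInt (fun x => RInt (F x) c d) a b = Psi b).
  assert (Z : 0 - 0 = RInt (fun x => RInt (F x) c d) a b - Psi b); [| lra].
  apply E; [| exact ab].
  intros t _. assert (D := is_derive_minus (V := R_NormedModule) _ _ t _ _ (DPhi t) (DPsi t)).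
  rewrite minus_eq_zero in D. exact D.
Qed.

Lemma Rmean_fubini (F : R -> R -> R) : cont2 F ->
  Rmean (fun x => Rmean (F x)) = Rmean (fun y => Rmean (fun x => F x y)).
Proof.
  intros H. assert (PP := two_PI_pos). unfold Rmean, Rdiv.
  assert (S : forall u : R -> R, (forall t, continuous u t) ->
    RInt (fun x => u x * / (2 * PI)) 0 (2 * PI) = RInt u 0 (2 * PI) * / (2 * PI)).
  { intros u Hu. rewrite (RInt_ext _ (fun x => scal (/ (2 * PI)) (u x)))
      by (intros; unfold scal; simpl; unfold mult; simpl; ring).
    rewrite (RInt_scal (V := R_CompleteNormedModule)) by now apply ex_RInt_all.
    unfold scal; simpl; unfold mult; simpl. ring. }
  rewrite (S (fun x => RInt (F x) 0 (2 * PI))) by (intros; apply continuous_RInt_param; auto; lra).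
  rewrite (S (fun y => RInt (fun x => F x y) 0 (2 * PI)))
    by (intros; apply (continuous_RInt_param (fun y x => F x y)); [lra | now apply cont2_swap]).
  do 2 f_equal. apply fubini; auto; lra.
Qed.

Lemma continuous_Rmean_param (F : R -> R -> R) (x : R) : cont2 F -> continuous (fun x => Rmean (F x)) x.
Proof.
  intros H. unfold Rmean, Rdiv. assert (PP := two_PI_pos).
  apply (continuous_mult (K := R_AbsRing) (fun x => RInt (F x) 0 (2 * PI)) (fun _ => / (2 * PI))).
  - apply continuous_RInt_param; [lra | exact H].
  - apply continuous_const.
Qed.

(** * Circle means of logarithms *)

Lemma continuous_ln_pos (x : R) : 0 < x -> continuous ln x.
Proof.
  intros H. apply (ex_derive_continuous (V := R_NormedModule) ln).
  exists (/ x). apply is_derive_Reals. now apply derivable_pt_lim_ln.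
Qed.

Lemma filterlim_ln {T} (F : (T -> Prop) -> Prop) (u : T -> R) (l : R) :
  0 < l -> filterlim u F (locally l) -> filterlim (fun x => ln (u x)) F (locally (ln l)).
Proof. intros Hl U. eapply filterlim_comp; [exact U | now apply continuous_ln_pos]. Qed.

Lemma filterlim_plus_const {T} (F : (T -> Prop) -> Prop) {FF : Filter F} (u : T -> R) (l c : R) :
  filterlim u F (locally l) -> filterlim (fun x => u x + c) F (locally (l + c)).
Proof.
  intros U. eapply (filterlim_comp_2 (G := locally l) (H := locally c)); [exact U | apply filterlim_const |].
  apply (filterlim_plus (V := R_NormedModule) l c).
Qed.

(** The logarithm of the modulus of a zero-free function is a constant plus a real part, so it has
    the mean value property. Rescaling by [s] transports the statement from the unit disk; [s] is
    taken above 1 for linear functions and below 1 in [cartan_pointwise], which also uses [P]. *)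
Lemma Rmean_ln_zero_free (Q : C -> C) (s r : R) : 0 < r < s ->
  holomorphic_on_D (fun z => Q (RtoC s * z)%C) -> (forall z, Cmod z < 1 -> Q (RtoC s * z)%C <> 0) ->
  exists P, holomorphic_on_D P /\ P (RtoC 0) = 0 /\
   (forall z, Cmod z < s -> 0 < Cmod (Q z) /\ ln (Cmod (Q z)) = ln (Cmod (Q (RtoC 0))) + fst (P (z / RtoC s)%C)) /\
   (forall t, continuous (fun t => ln (Cmod (Q (circ r t)))) t) /\
   Rmean (fun t => ln (Cmod (Q (circ r t)))) = ln (Cmod (Q (RtoC 0))).
Proof.
  intros Hr H NZ.
  assert (Ns : RtoC s <> 0) by (intros E; injection E; lra).
  destruct (zero_free_modulus (fun z => Q (RtoC s * z)%C) H NZ) as (P & HP & P0 & E).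
  assert (E0 : (RtoC s * RtoC 0)%C = RtoC 0) by ring. cbv beta in E. rewrite E0 in E.
  assert (N0 : 0 < Cmod (Q (RtoC 0))).
  { apply Cmod_gt_0. assert (X := NZ (RtoC 0) ltac:(rewrite Cmod_0; lra)). now rewrite E0 in X. }
  assert (M : forall z, Cmod z < s -> 0 < Cmod (Q z) /\ ln (Cmod (Q z)) = ln (Cmod (Q (RtoC 0))) + fst (P (z / RtoC s)%C)).
  { intros z Z. assert (Z1 : Cmod (z / RtoC s) < 1).
    { rewrite Cmod_div, Cmod_R, Rabs_pos_eq by (auto; lra).
      apply -> Rdiv_lt_1; lra. }
    specialize (E _ Z1). replace (RtoC s * (z / RtoC s))%C with z in E by (field; exact Ns).
    assert (Pe := exp_pos (fst (P (z / RtoC s)%C))).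
    rewrite E. split; [now apply Rmult_lt_0_compat |]. rewrite ln_mult, ln_exp; auto. }
  exists P. split; [exact HP |]. split; [exact P0 |]. split; [exact M |].
  assert (Rs : 0 <= r / s < 1).
  { split; [left; apply Rdiv_lt_0_compat; lra |].
    apply -> Rdiv_lt_1; lra. }
  assert (EC : forall t, (circ r t / RtoC s)%C = circ (r / s) t).
  { intros t. unfold Cdiv. rewrite <- RtoC_inv by lra. unfold circ, RtoC, Cmult, Rdiv; simpl. f_equal; ring. }
  assert (EE : forall t, ln (Cmod (Q (circ r t))) = 1 * ln (Cmod (Q (RtoC 0))) + 1 * fst (P (circ (r / s) t))).
  { intros t. rewrite (proj2 (M (circ r t) ltac:(rewrite Cmod_circ; lra))), EC. ring. }
  assert (CP : forall t, continuous (fun t => fst (P (circ (r / s) t))) t).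
  { intros t. apply (clim_fst (fun t => P (circ (r / s) t))). now apply (holo_pcont P). }
  split.
  - intros t. apply (continuous_ext (fun t => 1 * ln (Cmod (Q (RtoC 0))) + 1 * fst (P (circ (r / s) t)))).
    + intros x. now rewrite EE.
    + apply (continuous_plus (V := R_NormedModule) (fun _ => 1 * ln (Cmod (Q (RtoC 0))))); [apply continuous_const |].
      apply (continuous_mult (K := R_AbsRing) (fun _ => 1)); [apply continuous_const | apply CP].
  - rewrite (Rmean_ext _ _ EE).
    assert (EL := Rmean_lin (fun _ => ln (Cmod (Q (RtoC 0)))) _ (fun t => continuous_const _ t) CP 1 1).
    cbv beta in EL. rewrite EL, Rmean_const, Rmean_fst_circ, P0 by assumption. simpl. ring.
Qed.

Lemma Rmean_ln_one_sub (b : C) : Cmod b < 1 ->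
  Rmean (fun t => ln (Cmod (1 - b * circ 1 t))) = 0 /\
  forall t, continuous (fun t => ln (Cmod (1 - b * circ 1 t))) t.
Proof.
  (* This radius exceeds 1 while s |b| < 1, so 1 - b z is zero-free beyond the unit circle. *)
  intros B. assert (Pb := Cmod_ge_0 b). set (s := 2 / (1 + Cmod b)).
  assert (Ps : 0 < s) by (apply Rdiv_lt_0_compat; lra).
  assert (Es : s * (1 + Cmod b) = 2) by (unfold s; field; lra).
  assert (S1 : 1 < s) by nra. assert (S2 : s * Cmod b < 1) by nra.
  destruct (Rmean_ln_zero_free (fun z => 1 - b * z)%C s 1) as (P & _ & _ & _ & Ct & E); [lra | | |].
  - intros z _. eexists. apply cder_minus; [apply cder_const | apply cder_scal, cder_scal, cder_id].
  - intros z Z. apply Cmod_gt_0. assert (L := Cmod_lower 1 (b * (RtoC s * z))).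
    rewrite Cmod_1, !Cmod_mult, Cmod_R, Rabs_pos_eq in L by lra.
    assert (Pz := Cmod_ge_0 z).
    assert (Cmod b * (s * Cmod z) <= s * Cmod b * 1) by (replace (Cmod b * (s * Cmod z)) with (s * Cmod b * Cmod z) by ring; apply Rmult_le_compat_l; nra).
    lra.
  - split; [| exact Ct]. rewrite E. replace (1 - b * 0)%C with (RtoC 1) by ring.
    rewrite Cmod_1. apply ln_1.
Qed.

Definition lnp (x : R) : R := ln (Rmax 1 x).

(** Jensen's formula for a linear function: factor out z when |z| > 1, reflect in the circle when
    |z| < 1. On the circle itself the integrand is singular. *)
Lemma Rmean_ln_circle (z : C) : Cmod z <> 1 ->
  Rmean (fun t => ln (Cmod (z - circ 1 t))) = lnp (Cmod z) /\
  forall t, continuous (fun t => ln (Cmod (z - circ 1 t))) t.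
Proof.
  intros N. assert (Pz := Cmod_ge_0 z). destruct (Rlt_le_dec (Cmod z) 1) as [L | L].
  - destruct (Rmean_ln_one_sub (Cconj z)) as [E Ct]; [now rewrite Cmod_conj |].
    assert (EE : forall t, Cmod (1 - Cconj z * circ 1 t) = Cmod (z - circ 1 t)).
    { intros t. assert (Nc := circ_neq_0 1 t Rlt_0_1).
      replace (1 - Cconj z * circ 1 t)%C with (circ 1 t * Cconj (circ 1 t - z))%C.
      - rewrite Cmod_mult, Cmod_conj, Cmod_circ, Cmod_sym by lra. ring.
      - rewrite Cminus_conj, circ_conj by lra. rewrite Rmult_1_l. field. exact Nc. }
    unfold lnp. rewrite Rmax_left, ln_1 by lra. rewrite <- E. split.
    + apply Rmean_ext. intros t. now rewrite EE.
    + intros t. apply (continuous_ext (fun t => ln (Cmod (1 - Cconj z * circ 1 t)))); [| apply Ct].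
      intros x. now rewrite EE.
  - assert (Nz : z <> 0) by (apply Cmod_gt_0; lra).
    destruct (Rmean_ln_one_sub (/ z)) as [E Ct].
    { rewrite Cmod_inv by exact Nz. rewrite <- Rinv_1. apply Rinv_lt_contravar; lra. }
    assert (EE : forall t, ln (Cmod (z - circ 1 t)) = 1 * ln (Cmod z) + 1 * ln (Cmod (1 - / z * circ 1 t))).
    { intros t. replace (z - circ 1 t)%C with (z * (1 - / z * circ 1 t))%C by (field; exact Nz).
      rewrite Cmod_mult, ln_mult; [ring | lra |].
      apply Cmod_gt_0. intros F.
      assert (G : (z * (1 - / z * circ 1 t))%C = 0) by (rewrite F; ring).
      replace (z * (1 - / z * circ 1 t))%C with (z - circ 1 t)%C in G by (field; exact Nz).
      apply N. replace z with (z - circ 1 t + circ 1 t)%C by ring. rewrite G, Cplus_0_l. apply Cmod_circ. lra. }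
    unfold lnp. rewrite Rmax_right by lra. split.
    + rewrite (Rmean_ext _ _ EE).
      assert (EL := Rmean_lin (fun _ => ln (Cmod z)) _ (fun t => continuous_const _ t) Ct 1 1).
      cbv beta in EL. rewrite EL, Rmean_const.
      replace (Rmean _) with 0 by (symmetry; exact E). ring.
    + intros t. apply (continuous_ext (fun t => 1 * ln (Cmod z) + 1 * ln (Cmod (1 - / z * circ 1 t)))).
      * intros x. now rewrite EE.
      * apply (continuous_plus (V := R_NormedModule) (fun _ => 1 * ln (Cmod z))); [apply continuous_const |].
        apply (continuous_mult (K := R_AbsRing) (fun _ => 1)); [apply continuous_const | apply Ct].
Qed.

(** The summand k makes the inequality available for |z| = 1 too: z is replaced by a point within k
    of it and off the circle, with no smaller log^+, and |z' - u| <= |z - u| + k. *)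
Lemma lnp_le_Rmean (z : C) (k : R) : 0 < k < 1 ->
  lnp (Cmod z) <= Rmean (fun t => ln (Cmod (z - circ 1 t) + k)).
Proof.
  intros Hk. assert (Pz := Cmod_ge_0 z).
  assert (S : exists z', Cmod (z' - z) <= k /\ Cmod z' <> 1 /\ lnp (Cmod z) <= lnp (Cmod z')).
  { destruct (Req_dec (Cmod z) 1) as [E | N].
    - exists (RtoC (1 - k) * z)%C. repeat split.
      + replace (RtoC (1 - k) * z - z)%C with (RtoC (- k) * z)%C
          by (rewrite RtoC_minus, RtoC_opp; ring).
        rewrite Cmod_mult, Cmod_R, Rabs_Ropp, Rabs_pos_eq, E; lra.
      + rewrite Cmod_mult, Cmod_R, Rabs_pos_eq, E; lra.
      + unfold lnp. rewrite E, Cmod_mult, Cmod_R, Rabs_pos_eq, E by lra.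
        rewrite !Rmax_left; lra.
    - exists z. repeat split; [| exact N | lra].
      replace (z - z)%C with (RtoC 0) by ring. rewrite Cmod_0. lra. }
  destruct S as (z' & Z1 & Z2 & Z3). destruct (Rmean_ln_circle z' Z2) as [E Ct].
  eapply Rle_trans; [exact Z3 |]. rewrite <- E. apply Rmean_le; [exact Ct | |].
  - intros t. apply filterlim_ln; [assert (P := Cmod_ge_0 (z - circ 1 t)); lra |].
    apply filterlim_plus_const; [apply locally_filter |].
    apply (clim_Cmod (fun t => z - circ 1 t)%C). apply clim_minus; [apply clim_const | apply pcont_circ].
  - intros t.
    assert (P : 0 < Cmod (z' - circ 1 t)).
    { apply Cmod_gt_0. intros F. apply Z2. replace z' with (z' - circ 1 t + circ 1 t)%C by ring.
      rewrite F, Cplus_0_l. apply Cmod_circ. lra. }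
    apply ln_le; [exact P |].
    assert (T := Cmod_tri_minus z' z (circ 1 t)). lra.
Qed.

(** A maximum principle with a loss, read off Cauchy's formula; only the uniformity of the resulting
    bound matters. *)
Lemma Cmod_crude_max (Q : C -> C) (s rho B : R) (z : C) : holomorphic_on_D Q -> 0 < s < 1 ->
  (forall t, 0 <= t <= 2 * PI -> Cmod (Q (circ s t)) <= B) -> Cmod z <= rho -> rho < s ->
  Cmod (Q z) <= s / (s - rho) * B.
Proof.
  intros H Hs HB Z Hr. assert (Pz := Cmod_ge_0 z).
  rewrite <- (cauchy_formula Q 1 s z H ltac:(lra)).
  apply Cmod_Cmean_le_const_per.
  - intros t. apply clim_mult; [apply pcont_cauchy_kernel; lra | apply holo_pcont; [exact H | lra]].
  - intros t Ht. rewrite Cmod_mult. apply Rmult_le_compat; try apply Cmod_ge_0; [| now apply HB].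
    apply Cmod_div_le; [lra | rewrite Cmod_circ; lra |].
    assert (L := Cmod_lower (circ s t) z). rewrite Cmod_circ in L by lra. lra.
Qed.

Lemma circ_div (r s t : R) : s <> 0 -> (circ r t / RtoC s)%C = circ (r / s) t.
Proof.
  intros Hs. unfold Cdiv. rewrite <- RtoC_inv by exact Hs.
  unfold circ, RtoC, Cmult, Rdiv; simpl. f_equal; ring.
Qed.

(** If f >= k, then f + k^2 <= f (1 + k); otherwise f + k^2 < 2k, which is below the lower bound exp
    c for q. Hence the square in the truncation. *)
Lemma ln_add_sq_le (f q k c : R) : 0 <= f <= q -> 0 < q -> 0 < k < 1 -> 2 * k <= exp c -> c <= ln q ->
  ln (f + k ^ 2) <= ln q + k.
Proof.
  intros F Q K E Cq. destruct (Rle_lt_dec k f) as [L | L].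
  - apply Rle_trans with (ln (q * (1 + k))).
    + apply ln_le; simpl; nra.
    + rewrite ln_mult by lra. apply Rplus_le_compat_l.
      rewrite <- (ln_exp k) at 2. apply ln_le; [lra |]. apply exp_ineq1_le.
  - apply Rle_trans with (ln (exp c)); [| rewrite ln_exp; lra].
    apply ln_le; simpl; nra.
Qed.

(* The quotient of G - u by its Blaschke product is zero-free, so by Harnack the logarithm of its
   modulus is bounded below uniformly in u; this permits the truncation [+ k^2]. *)
Lemma cartan_pointwise (G : C -> C) (r : R) : holomorphic_on_D G -> Cmod (G (RtoC 0)) < 1 -> 0 < r < 1 ->
  exists s k0, r < s < 1 /\ 0 < k0 <= 1 /\ forall u L Q k eta, Cmod u = 1 -> 0 < k < k0 ->
    (forall a, In a L -> Cmod a < s) -> holomorphic_on_D Q ->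
    (forall z, G z - u = prodlin L z * Q z)%C -> (forall z, Cmod z < s -> Q z <> 0) ->
    sumlog s L <= eta ->
    Rmean (fun t => ln (Cmod (G (circ r t) - u) + k ^ 2)) <= ln (Cmod (G (RtoC 0) - u)) + eta + k.
Proof.
  intros H G0 Hr. set (g0 := Cmod (G (RtoC 0))) in *. assert (Pg : 0 <= g0) by apply Cmod_ge_0.
  set (s := (1 + r) / 2). set (rho := (r + s) / 2).
  assert (Hs : r < rho /\ rho < s /\ s < 1) by (unfold rho, s; lra).
  assert (Ns : RtoC s <> 0) by (intros E; injection E; lra).
  destruct (pcont_bounded (fun t => G (circ s t))) as [B [HB Bd]].
  { apply holo_pcont; [exact H | lra]. }
  (* [A] bounds the real part of the logarithm of Qt(z)/Qt(0) on the circle of radius rho, using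
     |Qt(0)| >= 1 - |G(0)|; [c] is the resulting lower bound for ln|Qt| on radius r. Neither
     involves u. *)
  set (A := ln (s / (s - rho) * (B + 1)) - ln (1 - g0)).
  set (c := ln (1 - g0) - 2 * A * (r / s) / (rho / s - r / s)).
  exists s, (Rmin 1 (exp c / 2)). split; [lra |].
  assert (Ec := exp_pos c). split.
  { split; [apply Rmin_pos; lra | apply Rmin_l]. }
  intros u L Q k eta Hu Hk HL HQ E NZ Hsum.
  assert (K1 := Rmin_l 1 (exp c / 2)). assert (K2 := Rmin_r 1 (exp c / 2)).
  set (Qt := fun z => (Q z * reflect s L z)%C).
  assert (HQt : holomorphic_on_D Qt) by (apply holo_mult; [exact HQ | apply holo_reflect; lra]).
  assert (NQt : forall z, Cmod z < s -> Qt z <> 0).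
  { intros z Z. apply Cmult_neq_0; [now apply NZ | apply reflect_neq_0; [lra | exact HL | lra]]. }
  assert (HL' : forall a, In a L -> Cmod a <= s) by (intros a Ha; specialize (HL a Ha); lra).
  assert (GQ : forall z, Cmod z <= s -> Cmod (G z - u) <= Cmod (Qt z) /\
                 (Cmod z = s -> Cmod (G z - u) = Cmod (Qt z))).
  { intros z Z. destruct (Cmod_reflect s L z ltac:(lra) HL' Z) as [R1 R2].
    unfold Qt. rewrite E, !Cmod_mult, (Rmult_comm (Cmod (Q z))). split.
    - apply Rmult_le_compat_r; [apply Cmod_ge_0 | exact R1].
    - intros Zs. now rewrite R2. }
  assert (Sc : forall z, Cmod z < 1 -> Cmod (RtoC s * z) < s).
  { intros z Z. rewrite Cmod_mult, Cmod_R, Rabs_pos_eq by lra. nra. }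
  destruct (Rmean_ln_zero_free Qt s r) as (P & HP & P0 & M & Ct & EM).
  - lra.
  - intros z Z. specialize (Sc z Z). destruct (HQt (RtoC s * z)%C) as [l Hl]; [unfold inD; lra |].
    eexists. apply (cder_comp Qt (fun z => RtoC s * z)%C); [exact Hl | apply cder_scal, cder_id].
  - intros z Z. apply NQt. now apply Sc.
  - assert (G0u : 1 - g0 <= Cmod (G (RtoC 0) - u)).
    { rewrite Cmod_sym. assert (X := Cmod_lower u (G (RtoC 0))). fold g0 in X. lra. }
    assert (N0 : ~ In (RtoC 0) L).
    { intros I. apply prodlin_eq_0 in I. specialize (E (RtoC 0)). rewrite I, Cmult_0_l in E.
      rewrite E, Cmod_0 in G0u. lra. }
    assert (Q0 : Cmod (Qt (RtoC 0)) = Cmod (G (RtoC 0) - u) * exp (sumlog s L)).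
    { unfold Qt. rewrite E, !Cmod_mult, Cmod_reflect_0 by (auto; lra). ring. }
    assert (Q0l : 1 - g0 <= Cmod (Qt (RtoC 0))).
    { eapply Rle_trans; [exact G0u |]. apply GQ. rewrite Cmod_0. lra. }
    assert (PA : forall t, fst (P (circ (rho / s) t)) <= A).
    { intros t. assert (Zr : Cmod (circ rho t) = rho) by (apply Cmod_circ; lra).
      destruct (M (circ rho t) ltac:(lra)) as [M1 M2]. rewrite circ_div in M2 by lra.
      assert (Up : Cmod (Qt (circ rho t)) <= s / (s - rho) * (B + 1)).
      { apply Cmod_crude_max; [exact HQt | lra | | lra | lra].
        intros t' Ht'. rewrite <- (proj2 (GQ (circ s t') ltac:(rewrite Cmod_circ; lra))) by (apply Cmod_circ; lra).
        unfold Cminus. eapply Rle_trans; [apply Cmod_triangle |]. rewrite Cmod_opp, Hu.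
        specialize (Bd t' Ht'). lra. }
      apply ln_le in Up; [| exact M1]. apply ln_le in Q0l; [| lra]. unfold A. lra. }
    assert (Low : forall t, c <= ln (Cmod (Qt (circ r t)))).
    { intros t. destruct (M (circ r t) ltac:(rewrite Cmod_circ; lra)) as [M1 M2].
      rewrite circ_div in M2 by lra.
      assert (Rs : r / s < rho / s) by (apply Rmult_lt_compat_r; [apply Rinv_0_lt_compat |]; lra).
      assert (Rs2 : rho / s < 1).
      { apply -> Rdiv_lt_1; lra. }
      assert (Rs0 : 0 < r / s) by (apply Rdiv_lt_0_compat; lra).
      assert (Hk' := harnack P A (r / s) (rho / s) (circ (r / s) t) HP P0 ltac:(lra) PA
         ltac:(rewrite Cmod_circ; lra) Rs).
      apply ln_le in Q0l; [| lra]. rewrite M2. unfold c. lra. }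
    assert (CG : forall t, continuous (fun t => ln (Cmod (G (circ r t) - u) + k ^ 2)) t).
    { intros t. assert (Pk : 0 < k ^ 2) by (apply pow_lt; lra).
      apply filterlim_ln; [assert (X := Cmod_ge_0 (G (circ r t) - u)); lra |].
      apply filterlim_plus_const; [apply locally_filter |].
      apply (clim_Cmod (fun t => G (circ r t) - u)%C). apply clim_minus; [| apply clim_const].
      apply (holo_pcont G); [exact H | lra]. }
    apply Rle_trans with (1 * Rmean (fun t => ln (Cmod (Qt (circ r t)))) + k).
    + apply Rmean_affine_le; [exact CG | exact Ct |]. intros t. rewrite Rmult_1_l.
        assert (Zr : Cmod (circ r t) = r) by (apply Cmod_circ; lra).
        apply ln_add_sq_le with c; [| | lra | lra | apply Low].
        -- split; [apply Cmod_ge_0 | apply GQ; lra].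
        -- apply (M (circ r t)). lra.
    + rewrite EM, Q0, ln_mult, ln_exp by (try apply exp_pos; lra). lra.
Qed.

Lemma continuous_lnp_Cmod (h : R -> C) (t : R) : pcont h t -> continuous (fun t => lnp (Cmod (h t))) t.
Proof.
  intros H. unfold lnp. apply filterlim_ln; [assert (X := Rmax_l 1 (Cmod (h t))); lra |].
  apply (continuous_comp (fun t => Cmod (h t)) (fun x => Rmax 1 x)).
  - apply (clim_Cmod h _ H).
  - intros P [d D]. exists d. refine (fun (y : R) Y => _). apply D.
    change (Rabs (y - Cmod (h t)) < d) in Y. change (Rabs (Rmax 1 y - Rmax 1 (Cmod (h t))) < d).
    eapply Rle_lt_trans; [| exact Y].
    unfold Rmax. repeat destruct Rle_dec; unfold Rabs; repeat destruct Rcase_abs; lra.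
Qed.

(** The pointwise inequality is averaged over all unimodular u. On the right ln|G(0) - u| averages
    to log^+|G(0)| = 0; on the left, after exchanging the two means, the average over u dominates
    log^+|G|. *)
Theorem cartan (G : C -> C) (r eta : R) : holomorphic_on_D G -> Cmod (G (RtoC 0)) < 1 -> 0 < r < 1 ->
  (forall u s L Q, Cmod u = 1 -> 0 < s < 1 -> (forall a, In a L -> Cmod a < s) -> holomorphic_on_D Q ->
    (forall z, G z - u = prodlin L z * Q z)%C -> (forall z, Cmod z < s -> Q z <> 0) -> sumlog s L <= eta) ->
  Rmean (fun t => lnp (Cmod (G (circ r t)))) <= eta.
Proof.
  intros H G0 Hr HN.
  destruct (cartan_pointwise G r H G0 Hr) as (s & k0 & Hs & Hk0 & CP).
  assert (CL : forall t, continuous (fun t => lnp (Cmod (G (circ r t)))) t).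
  { intros t. apply continuous_lnp_Cmod. apply (holo_pcont G); [exact H | lra]. }
  destruct (Rmean_ln_circle (G (RtoC 0)) ltac:(lra)) as [E0 C0].
  unfold lnp in E0. rewrite Rmax_left, ln_1 in E0 by lra.
  apply Rnot_lt_le. intros Lt.
  set (d := Rmean (fun t => lnp (Cmod (G (circ r t)))) - eta).
  (* The truncation costs at most k, which is at most half of the supposed excess [d]. *)
  set (k := Rmin k0 d / 2).
  assert (Pd : 0 < Rmin k0 d) by (apply Rmin_pos; unfold d; lra).
  assert (D1 := Rmin_l k0 d). assert (D2 := Rmin_r k0 d).
  assert (Hk : 0 < k < k0) by (unfold k; lra).
  assert (Pk : 0 < k ^ 2) by (apply pow_lt; lra).
  set (F := fun t th => ln (Cmod (G (circ r t) - circ 1 th) + k ^ 2)).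
  assert (CF : cont2 F).
  { intros t th. unfold F. apply filterlim_ln; [assert (X := Cmod_ge_0 (G (circ r t) - circ 1 th)); lra |].
    apply filterlim_plus_const; [apply locally_filter |].
    apply (clim_Cmod (fun z : R * R => G (circ r (fst z)) - circ 1 (snd z))%C). apply clim_minus.
    - apply (clim_comp G); [apply holo_cont; [exact H | rewrite Cmod_circ; lra] |].
      apply clim_circ; [apply filterlim_const | apply (continuous_fst (t : R_UniformSpace) (th : R_UniformSpace))].
    - apply clim_circ; [apply filterlim_const | apply (continuous_snd (t : R_UniformSpace) (th : R_UniformSpace))]. }
  assert (Up : Rmean (fun th => Rmean (fun t => F t th)) <= eta + k).
  { apply Rle_trans with (1 * Rmean (fun th => ln (Cmod (G (RtoC 0) - circ 1 th))) + (eta + k)).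
    - apply Rmean_affine_le; [| exact C0 |].
      + intros th. apply (continuous_Rmean_param (fun th t => F t th)). now apply cont2_swap.
      + intros th. assert (Hu : Cmod (circ 1 th) = 1) by (apply Cmod_circ; lra).
        destruct (zeros_factor (fun z => G z - circ 1 th)%C s) as (L & Q & L1 & L2 & L3 & L4).
        * apply holo_minus; [exact H | apply holo_const].
        * apply Cmod_gt_0. rewrite Cmod_sym. assert (X := Cmod_lower (circ 1 th) (G (RtoC 0))). lra.
        * lra.
        * eapply Rle_trans.
          -- apply (CP (circ 1 th) L Q k eta Hu Hk L1 L2 L3 L4).
             apply (HN (circ 1 th) s L Q Hu ltac:(lra) L1 L2 L3 L4).
          -- lra.
    - rewrite E0. lra. }
  rewrite <- (Rmean_fubini F CF) in Up.
  assert (Low : Rmean (fun t => lnp (Cmod (G (circ r t)))) <= Rmean (fun t => Rmean (F t))).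
  { apply Rmean_le; [exact CL | intros t; now apply continuous_Rmean_param |].
    intros t. apply lnp_le_Rmean. split; [exact Pk |]. simpl. nra. }
  unfold k, d in *. lra.
Qed.

(** * Sufficiency *)

Lemma sumlog_mono (r s : R) (L : list C) : 0 < r <= s -> ~ In (RtoC 0) L -> sumlog r L <= sumlog s L.
Proof.
  intros Hr N. induction L as [| a L IH]; [apply Rle_refl |]. cbn [sumlog].
  assert (Pa : 0 < Cmod a) by (apply Cmod_gt_0; intros E; apply N; now left).
  apply Rplus_le_compat; [| apply IH; intros I; apply N; now right].
  apply ln_le; [apply Rdiv_lt_0_compat; lra |].
  apply Rmult_le_compat_r; [left; now apply Rinv_0_lt_compat | lra].
Qed.

Lemma unit_conj (u : C) : Cmod u = 1 -> (u * Cconj u)%C = RtoC 1.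
Proof.
  intros H. transitivity (RtoC (Cmod u ^ 2)); [symmetry; apply Cmod2_conj |].
  rewrite H. f_equal. ring.
Qed.

Lemma Cmod_one_sub_conj (u z : C) : Cmod u = 1 -> Cmod (1 - Cconj u * z) = Cmod (u - z).
Proof.
  intros H. transitivity (Cmod u * Cmod (1 - Cconj u * z)); [rewrite H; ring |].
  rewrite <- Cmod_mult. f_equal.
  replace (u * (1 - Cconj u * z))%C with (u - (u * Cconj u) * z)%C by ring.
  rewrite unit_conj by exact H. ring.
Qed.

(* G = 4e / (1 - conj(xi) phi) takes unimodular values only where phi takes values on the
   circle of radius 4e about xi. *)
Lemma carleson_log (phi : C -> C) (n : nat) : self_map_D phi -> N_bigO phi n ->
  exists C1 e0, 0 < C1 /\ 0 < e0 < 1 /\ forall xi e r, Cmod xi = 1 -> 0 < e < e0 -> 0 < r < 1 ->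
    Rmean (fun t => lnp (4 * e / Cmod (xi - phi (circ r t)))) <= C1 * e ^ (2 * n + 1).
Proof.
  intros SM (K & del & Hdel & HN). set (p0 := Cmod (phi (RtoC 0))).
  assert (Z0 : Cmod (RtoC 0) < 1) by (rewrite Cmod_0; lra).
  assert (Pp0 : 0 <= p0 < 1) by (split; [apply Cmod_ge_0 | now apply SM]).
  (* In order: 4e < 1 - |phi(0)| makes |G(0)| < 1, 4e < 1 - del puts the values v below into the
     range of the hypothesis, and 4e < 1/2 keeps |v| above 1/2. *)
  set (e0 := Rmin ((1 - p0) / 4) (Rmin ((1 - del) / 4) (/ 8))).
  assert (E1 : e0 <= (1 - p0) / 4) by apply Rmin_l.
  assert (E2 : e0 <= Rmin ((1 - del) / 4) (/ 8)) by apply Rmin_r.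
  assert (E3 := Rmin_l ((1 - del) / 4) (/ 8)). assert (E4 := Rmin_r ((1 - del) / 4) (/ 8)).
  assert (E0 : 0 < e0) by (repeat apply Rmin_pos; lra). clearbody e0.
  assert (PK := Rabs_pos K).
  assert (P8 : 0 < 8 ^ (2 * n + 1)) by (apply pow_lt; lra).
  exists (Rabs K * 8 ^ (2 * n + 1) + 1), e0. split; [| split; [lra |]].
  { assert (0 <= Rabs K * 8 ^ (2 * n + 1)) by (apply Rmult_le_pos; lra). lra. }
  intros xi e r Hxi He Hr.
  assert (Nz : forall z, Cmod z < 1 -> (1 - Cconj xi * phi z)%C <> 0).
  { intros z Z. apply Cmod_gt_0. rewrite Cmod_one_sub_conj by exact Hxi.
    assert (B := Cmod_lower xi (phi z)). assert (S := proj2 SM z Z). unfold inD in S. lra. }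
  set (G := fun z => (RtoC (4 * e) / (1 - Cconj xi * phi z))%C).
  assert (HG : holomorphic_on_D G).
  { apply holo_div; [apply holo_const | | exact Nz].
    apply holo_minus; [apply holo_const |]. apply holo_mult; [apply holo_const | apply SM]. }
  assert (MG : forall z, Cmod z < 1 -> Cmod (G z) = 4 * e / Cmod (xi - phi z)).
  { intros z Z. unfold G. rewrite Cmod_div by now apply Nz.
    rewrite Cmod_one_sub_conj, Cmod_R, Rabs_pos_eq by (auto; lra). reflexivity. }
  rewrite (Rmean_ext _ (fun t => lnp (Cmod (G (circ r t))))).
  2:{ intros t. now rewrite MG by (rewrite Cmod_circ; lra). }
  assert (X0 : 4 * e < Cmod (xi - phi (RtoC 0))).
  { assert (B := Cmod_lower xi (phi (RtoC 0))). fold p0 in B. lra. }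
  assert (eta0 : 0 <= (Rabs K * 8 ^ (2 * n + 1) + 1) * e ^ (2 * n + 1)).
  { apply Rmult_le_pos; [| apply pow_le; lra].
    assert (0 <= Rabs K * 8 ^ (2 * n + 1)) by (apply Rmult_le_pos; lra). lra. }
  apply cartan; [exact HG | | exact Hr |].
  - rewrite MG by exact Z0. apply Rmult_lt_reg_r with (Cmod (xi - phi (RtoC 0))); [lra |].
    unfold Rdiv. rewrite Rmult_assoc, Rinv_l by lra. lra.
  - intros u s L Q Hu Hs HL HQ E NZ.
    (* Without zeros the value v may lie outside the disk, where nothing is assumed, but then the
       sum is 0. A zero a gives v = phi(a), which is in the disk. *)
    destruct L as [| a L']; [exact eta0 |]. set (L := a :: L') in *.
    assert (Nu : u <> 0) by (apply Cmod_gt_0; lra).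
    (* The solution of G = u for phi; its distance from xi is 4e. *)
    set (v := (xi * (1 - RtoC (4 * e) / u))%C).
    assert (EV : forall z, Cmod z < 1 -> (phi z - v = prodlin L z * (Q z * ((1 - Cconj xi * phi z) * (xi / u))))%C).
    { intros z Z. replace (prodlin L z * (Q z * ((1 - Cconj xi * phi z) * (xi / u))))%C
        with ((prodlin L z * Q z) * ((1 - Cconj xi * phi z) * (xi / u)))%C by ring.
      rewrite <- E. unfold G, v.
      transitivity ((RtoC (4 * e) * xi / u - xi + (xi * Cconj xi) * phi z))%C.
      - rewrite unit_conj by exact Hxi. field. exact Nu.
      - field. split; [exact Nu | now apply Nz]. }
    assert (xi0 : xi <> 0) by (apply Cmod_gt_0; lra).
    assert (NP : N_partial phi v (sumlog 1 L)).
    { apply (N_partial_of_factor phi (fun z => Q z * ((1 - Cconj xi * phi z) * (xi / u)))%C v L).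
      - apply holo_mult; [exact HQ |]. apply holo_mult; [| apply holo_const].
        apply holo_minus; [apply holo_const |]. apply holo_mult; [apply holo_const | apply SM].
      - exact EV.
      - intros b Hb. specialize (HL b Hb). split; [lra |].
        repeat apply Cmult_neq_0; [apply NZ; lra | apply Nz; lra | exact xi0 |].
        intros F. apply (f_equal (Cmult u)) in F. rewrite Cinv_r, Cmult_0_r in F by exact Nu.
        injection F. lra. }
    assert (La : In a L) by now left.
    assert (Va : phi a = v).
    { assert (A1 : Cmod a < 1) by (specialize (HL a La); lra).
      specialize (EV a A1). rewrite prodlin_eq_0, Cmult_0_l in EV by exact La.
      replace (phi a) with (phi a - v + v)%C by ring. rewrite EV. ring. }
    assert (V1 : Cmod v < 1).
    { rewrite <- Va. apply SM. specialize (HL a La). unfold inD. lra. }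
    assert (Vd : Cmod (xi - v) = 4 * e).
    { unfold v. replace (xi - xi * (1 - RtoC (4 * e) / u))%C with (xi * (RtoC (4 * e) / u))%C by ring.
      rewrite Cmod_mult, Cmod_div, Cmod_R, Rabs_pos_eq, Hxi, Hu by (auto; lra). field. }
    assert (V2 : 1 - 4 * e <= Cmod v).
    { assert (B := Cmod_lower xi (xi - v)). replace (xi - (xi - v))%C with v in B by ring. lra. }
    assert (Nv : v <> phi (RtoC 0)) by (intros F; rewrite F in Vd; lra).
    assert (N0 : ~ In (RtoC 0) L).
    { intros I. apply Nv. specialize (EV (RtoC 0) Z0). rewrite prodlin_eq_0, Cmult_0_l in EV by exact I.
      replace v with (phi (RtoC 0) - (phi (RtoC 0) - v))%C by ring. rewrite EV. ring. }
    eapply Rle_trans; [apply (sumlog_mono s 1); [lra | exact N0] |].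
    assert (HV := HN v ltac:(lra)). rewrite Nevanlinna_off_center in HV by exact Nv.
    assert (HB := proj1 (Lub_Rbar_correct (N_partial phi v)) _ NP).
    assert (HS := Rbar_le_trans _ _ _ HB HV). simpl in HS.
    eapply Rle_trans; [exact HS |].
    (* From ln(1/|v|) <= (1 - |v|)/|v| with 1 - |v| <= 4e and |v| >= 1/2. *)
    assert (LV : 0 <= ln (/ Cmod v) <= 8 * e).
    { split.
      - rewrite <- ln_1. apply ln_le; [lra |]. rewrite <- Rinv_1. apply Rinv_le_contravar; lra.
      - assert (X := exp_ineq1_le (ln (/ Cmod v))).
        assert (Pv : 0 < / Cmod v) by (apply Rinv_0_lt_compat; lra). rewrite exp_ln in X by exact Pv.
        assert (Y : / Cmod v - 1 <= 8 * e).
        { apply Rmult_le_reg_r with (Cmod v); [lra |].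
          rewrite Rmult_minus_distr_r, Rinv_l by lra. nra. }
        lra. }
    apply Rle_trans with (Rabs K * (8 * e) ^ (2 * n + 1)).
    + apply Rle_trans with (Rabs K * ln (/ Cmod v) ^ (2 * n + 1)).
      * apply Rmult_le_compat_r; [apply pow_le; lra | apply Rle_abs].
      * apply Rmult_le_compat_l; [exact PK |]. now apply pow_incr.
    + rewrite Rpow_mult_distr. assert (Pe : 0 < e ^ (2 * n + 1)) by (apply pow_lt; lra). nra.
Qed.

(** * From logarithmic means to a Carleson bound for a kernel *)

Lemma kernel_pos (d X : R) (N : nat) : 0 < d -> 0 <= X -> 0 <= (d / (d + X)) ^ N <= 1.
Proof.
  intros Hd HX. assert (A : 0 < d / (d + X)) by (apply Rdiv_lt_0_compat; lra).
  assert (B : d / (d + X) <= 1).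
  { apply -> Rdiv_le_1; lra. }
  split; [apply pow_le; lra |]. apply pow_le_one; lra.
Qed.

(** For X < 2d the logarithmic term alone is at least 1, as 4d/X > 2. For X >= 2d the kernel base at
    scale d is at most 2/3 of that at scale 2d, and (2/3)^2 = 4/9. *)
Lemma kernel_doubling (d X : R) (p : nat) : 0 < d -> 0 < X ->
  (d / (d + X)) ^ (2 * p) <= lnp (4 * d / X) / ln 2 + (4 / 9) ^ p * (2 * d / (2 * d + X)) ^ (2 * p).
Proof.
  intros Hd HX. assert (L2 : 0 < ln 2) by (rewrite <- ln_1; apply ln_increasing; lra).
  assert (Lp : 0 <= lnp (4 * d / X)).
  { unfold lnp. rewrite <- ln_1. apply ln_le; [lra | apply Rmax_l]. }
  assert (P49 : 0 < (4 / 9) ^ p) by (apply pow_lt; lra).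
  assert (Kd := kernel_pos (2 * d) X (2 * p) ltac:(lra) ltac:(lra)).
  destruct (Rlt_le_dec X (2 * d)) as [L | L].
  - assert (A : 1 <= lnp (4 * d / X) / ln 2).
    { apply Rmult_le_reg_r with (ln 2); [exact L2 |]. unfold Rdiv. rewrite Rmult_assoc, Rinv_l by lra.
      rewrite Rmult_1_l, Rmult_1_r. apply ln_le; [lra |]. eapply Rle_trans; [| apply Rmax_r].
      apply Rmult_le_reg_r with X; [exact HX |]. rewrite Rmult_assoc, Rinv_l; lra. }
    assert (B := kernel_pos d X (2 * p) Hd ltac:(lra)). nra.
  - assert (A : d / (d + X) <= 2 / 3 * (2 * d / (2 * d + X))).
    { apply Rmult_le_reg_r with ((d + X) * (2 * d + X) * 3); [repeat apply Rmult_lt_0_compat; lra |].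
      replace (d / (d + X) * ((d + X) * (2 * d + X) * 3)) with (3 * d * (2 * d + X)) by (field; lra).
      replace (2 / 3 * (2 * d / (2 * d + X)) * ((d + X) * (2 * d + X) * 3)) with (4 * d * (d + X)) by (field; lra).
      nra. }
    assert (B : (d / (d + X)) ^ (2 * p) <= (2 / 3 * (2 * d / (2 * d + X))) ^ (2 * p)).
    { apply pow_incr. split; [left; apply Rdiv_lt_0_compat; lra | exact A]. }
    rewrite Rpow_mult_distr, (pow_mult (2 / 3)) in B. replace ((2 / 3) ^ 2) with (4 / 9) in B by field.
    assert (0 <= lnp (4 * d / X) / ln 2) by (apply Rdiv_le_0_compat; assumption). lra.
Qed.

Lemma continuous_kernel (d : R) (N : nat) (h : R -> R) (t : R) : 0 < d -> (forall t, 0 <= h t) ->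
  continuous h t -> continuous (fun t => (d / (d + h t)) ^ N) t.
Proof.
  intros Hd Hh Ch. apply (continuous_comp h (fun x => (d / (d + x)) ^ N)); [exact Ch |].
  apply (ex_derive_continuous (V := R_NormedModule)). auto_derive. specialize (Hh t). lra.
Qed.

(** Induction on the scale, halving at each step. The tail inherited from scale 2d is multiplied by
    (4/9)^p, while the inherited bound carries 2^p; since (8/9)^p <= 8/9, the same constant survives
    every step. *)
Theorem carleson_kernel (phi : C -> C) (n : nat) : self_map_D phi -> N_bigO phi n ->
  exists C2, 0 < C2 /\ forall xi r j, Cmod xi = 1 -> 0 < r < 1 ->
    Rmean (fun t => ((/ 2) ^ j / ((/ 2) ^ j + Cmod (xi - phi (circ r t)))) ^ (2 * (2 * n + 1)))
    <= C2 * ((/ 2) ^ j) ^ (2 * n + 1).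
Proof.
  intros SM HN. destruct (carleson_log phi n SM HN) as (C1 & e0 & HC1 & He0 & CL).
  set (p := (2 * n + 1)%nat) in *.
  assert (L2 : 0 < ln 2) by (rewrite <- ln_1; apply ln_increasing; lra).
  assert (Pe : 0 < e0 ^ p) by (apply pow_lt; lra).
  assert (PC : 0 < C1 / ln 2) by (apply Rdiv_lt_0_compat; lra).
  assert (Pi : 0 < / e0 ^ p) by now apply Rinv_0_lt_compat.
  (* The first term solves C1/ln 2 + (8/9) C2 <= C2; the second covers the scales d >= e0, where the
     kernel is simply bounded by 1. *)
  set (C2 := 9 * (C1 / ln 2) + / e0 ^ p).
  exists C2. split; [unfold C2; lra |].
  intros xi r j Hxi Hr.
  assert (Xpos : forall t, 0 < Cmod (xi - phi (circ r t))).
  { intros t. assert (B := Cmod_lower xi (phi (circ r t))).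
    assert (S := proj2 SM (circ r t) ltac:(unfold inD; rewrite Cmod_circ; lra)). unfold inD in S. lra. }
  assert (PX : forall t, pcont (fun t => xi - phi (circ r t))%C t).
  { intros t. apply clim_minus; [apply clim_const |]. apply (holo_pcont phi); [apply SM | lra]. }
  assert (CX : forall t, continuous (fun t => Cmod (xi - phi (circ r t))) t)
    by (intros t; apply (clim_Cmod _ _ (PX t))).
  assert (CK : forall d, 0 < d -> forall t, continuous (fun t => (d / (d + Cmod (xi - phi (circ r t)))) ^ (2 * p)) t).
  { intros d Hd t. apply (continuous_kernel d (2 * p) (fun t => Cmod (xi - phi (circ r t)))); auto.
    intros s. apply Cmod_ge_0. }
  induction j as [| j IH].
  - cbn [pow]. rewrite pow1, Rmult_1_r. apply Rle_trans with (Rmean (fun _ => 1)).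
    + apply Rmean_le; [apply (CK 1 Rlt_0_1) | intros; apply continuous_const |].
      intros t. apply kernel_pos; [lra | apply Cmod_ge_0].
    + rewrite Rmean_const. assert (1 <= / e0 ^ p); [| unfold C2; lra].
      rewrite <- Rinv_1. apply Rinv_le_contravar; [exact Pe |].
      apply pow_le_one; lra.
  - set (d := (/ 2) ^ S j). assert (Pd : 0 < d) by (apply pow_lt; lra).
    assert (E2d : (/ 2) ^ j = 2 * d) by (unfold d; simpl; field). rewrite E2d in IH.
    assert (Pdp : 0 < d ^ p) by now apply pow_lt.
    destruct (Rlt_le_dec d e0) as [L | L].
    + assert (CLn : forall t, continuous (fun t => lnp (4 * d / Cmod (xi - phi (circ r t)))) t).
      { intros t. apply (continuous_ext (fun t => lnp (Cmod (RtoC (4 * d) / (xi - phi (circ r t)))%C))).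
        - intros s. rewrite Cmod_div, Cmod_R, Rabs_pos_eq; [reflexivity | lra |]. apply Cmod_gt_0, Xpos.
        - apply continuous_lnp_Cmod. apply clim_div; [apply Cmod_gt_0, Xpos | apply clim_const | apply PX]. }
      eapply Rle_trans.
      * apply (Rmean_lin_le _ _ _ (/ ln 2) ((4 / 9) ^ p) (CK d Pd) CLn (CK (2 * d) ltac:(lra))).
        intros t. rewrite (Rmult_comm (/ ln 2)). now apply kernel_doubling.
      * assert (B1 : / ln 2 * Rmean (fun t => lnp (4 * d / Cmod (xi - phi (circ r t)))) <= / ln 2 * (C1 * d ^ p)).
        { apply Rmult_le_compat_l; [left; now apply Rinv_0_lt_compat |]. apply CL; [exact Hxi | lra | exact Hr]. }
        assert (B2 : (4 / 9) ^ p * Rmean (fun t => (2 * d / (2 * d + Cmod (xi - phi (circ r t)))) ^ (2 * p))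
                      <= (4 / 9) ^ p * (C2 * (2 * d) ^ p)).
        { apply Rmult_le_compat_l; [apply pow_le; lra | exact IH]. }
        assert (B3 : (4 / 9) ^ p * (2 * d) ^ p <= 8 / 9 * d ^ p).
        { rewrite <- Rpow_mult_distr. replace (4 / 9 * (2 * d)) with (8 / 9 * d) by field.
          rewrite Rpow_mult_distr. apply Rmult_le_compat_r; [lra |].
          unfold p. rewrite Nat.add_1_r. cbn [pow]. rewrite <- (Rmult_1_r (8 / 9)) at 3.
          apply Rmult_le_compat_l; [lra |].
          apply pow_le_one; lra. }
        assert (B4 : (4 / 9) ^ p * (C2 * (2 * d) ^ p) <= C2 * (8 / 9 * d ^ p)).
        { replace ((4 / 9) ^ p * (C2 * (2 * d) ^ p)) with (C2 * ((4 / 9) ^ p * (2 * d) ^ p)) by ring.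
          apply Rmult_le_compat_l; [unfold C2; lra | exact B3]. }
        assert (B5 : / ln 2 * (C1 * d ^ p) = C1 / ln 2 * d ^ p) by (unfold Rdiv; ring).
        assert (B6 : C1 / ln 2 * d ^ p + C2 * (8 / 9 * d ^ p) <= C2 * d ^ p).
        { replace (C1 / ln 2 * d ^ p + C2 * (8 / 9 * d ^ p)) with ((C1 / ln 2 + 8 / 9 * C2) * d ^ p) by ring.
          apply Rmult_le_compat_r; [lra |]. unfold C2. lra. }
        eapply Rle_trans; [apply Rplus_le_compat; [exact B1 | exact B2] | lra].
    + apply Rle_trans with (Rmean (fun _ => 1)).
      * apply Rmean_le; [now apply CK | intros; apply continuous_const |].
        intros t. apply kernel_pos; [exact Pd | apply Cmod_ge_0].
      * rewrite Rmean_const.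
        assert (B : / e0 ^ p * e0 ^ p <= C2 * d ^ p).
        { apply Rmult_le_compat; [lra | lra | unfold C2; lra | apply pow_incr; lra]. }
        rewrite Rinv_l in B by lra. exact B.
Qed.

(* Cauchy's formula for g^2 times the N-th power of the normalised kernel
   (1 - |zeta|^2/rho^2) / (1 - conj(zeta) z/rho^2), which equals 1 at zeta. *)
Lemma pointwise_kernel (g : C -> C) (N : nat) (d : R) (zeta : C) : holomorphic_on_D g ->
  0 < d <= 1 -> d / 2 < 1 - Cmod zeta <= d ->
  Cmod (g zeta) ^ 2 <= 6 * 12 ^ N / d *
    Rmean (fun a => Cmod (g (circ (1 - d / 4) a)) ^ 2 * (d / (d + Cmod (circ 1 a - zeta))) ^ N).
Proof.
  intros H Hd Z. assert (Pz := Cmod_ge_0 zeta). set (rho := 1 - d / 4).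
  assert (Hr : Cmod zeta < rho < 1) by (unfold rho; lra).
  assert (Pr : 0 < rho) by lra.
  assert (Nr : RtoC (rho * rho) <> 0) by (intros E; injection E; nra).
  set (s := 1 - Cmod zeta ^ 2 / (rho * rho)).
  assert (Rr : Cmod zeta < rho * rho) by (unfold rho in *; nra).
  assert (S0 : 0 < s).
  { unfold s. apply Rmult_lt_reg_r with (rho * rho); [nra |].
    replace ((1 - Cmod zeta ^ 2 / (rho * rho)) * (rho * rho)) with (rho * rho - Cmod zeta ^ 2) by (field; lra).
    simpl. nra. }
  assert (S1 : s * rho <= 2 * d).
  { assert (E : s * rho = (rho - Cmod zeta) * ((rho + Cmod zeta) / rho)) by (unfold s; field; lra).
    assert (B : (rho + Cmod zeta) / rho <= 2).
    { apply Rle_div_l; lra. }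
    assert (B' : 0 <= (rho + Cmod zeta) / rho) by (apply Rdiv_le_0_compat; lra).
    rewrite E. apply Rle_trans with ((rho - Cmod zeta) * 2); [apply Rmult_le_compat_l; lra |].
    unfold rho. lra. }
  set (k := fun z => (RtoC s / (1 - Cconj zeta * z / RtoC (rho * rho)))%C).
  assert (Nk : forall z, Cmod z < 1 -> (1 - Cconj zeta * z / RtoC (rho * rho))%C <> 0).
  { intros z Hz. apply Cmod_gt_0. assert (B := Cmod_lower 1 (Cconj zeta * z / RtoC (rho * rho))).
    rewrite Cmod_1, Cmod_div, Cmod_mult, Cmod_conj, Cmod_R, Rabs_pos_eq in B by (auto; nra).
    assert (B2 : Cmod zeta * Cmod z / (rho * rho) < 1).
    { apply Rmult_lt_reg_r with (rho * rho); [nra |]. unfold Rdiv. rewrite Rmult_assoc, Rinv_l by nra.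
      assert (Pz' := Cmod_ge_0 z). nra. }
    lra. }
  assert (Hk : holomorphic_on_D k).
  { apply holo_div; [apply holo_const | | exact Nk].
    apply holo_minus; [apply holo_const |]. apply (holo_div (fun z => Cconj zeta * z)%C).
    - apply holo_mult; [apply holo_const | apply holo_id].
    - apply holo_const.
    - intros _ _. exact Nr. }
  assert (HH : holomorphic_on_D (fun z => g z ^ 2 * k z ^ N)%C)
    by (apply holo_mult; now apply holo_pow).
  assert (Cf := cauchy_formula _ 1 rho zeta HH Hr). cbv beta in Cf.
  assert (K1 : k zeta = RtoC 1).
  { unfold k. replace (1 - Cconj zeta * zeta / RtoC (rho * rho))%C with (RtoC s).
    - field. intros E. injection E. lra.
    - unfold s. rewrite RtoC_minus, RtoC_div, Cmod2_conj by nra. unfold Cdiv. ring. }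
  rewrite K1, Cpow_1_l, Cmult_1_r in Cf.
  assert (HP : forall t, pcont (fun t => g (circ rho t) ^ 2 * k (circ rho t) ^ N)%C t)
    by (apply (holo_pcont (fun z => g z ^ 2 * k z ^ N)%C); [exact HH | lra]).
  assert (CU : forall t, continuous (fun a => Cmod (g (circ rho a)) ^ 2 * (d / (d + Cmod (circ 1 a - zeta))) ^ N) t).
  { intros t. apply (continuous_mult (K := R_AbsRing) (fun a => Cmod (g (circ rho a)) ^ 2) (fun a => (d / (d + Cmod (circ 1 a - zeta))) ^ N)).
    - apply (continuous_comp (fun a => Cmod (g (circ rho a))) (fun x => x ^ 2)).
      + apply (clim_Cmod (fun a => g (circ rho a))). apply (holo_pcont g); [exact H | lra].
      + apply (ex_derive_continuous (V := R_NormedModule)). auto_derive. exact I.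
    - apply (continuous_kernel d N (fun a => Cmod (circ 1 a - zeta))); [lra | intros; apply Cmod_ge_0 |].
      apply (clim_Cmod (fun a => circ 1 a - zeta)%C). apply clim_minus; [apply pcont_circ | apply clim_const]. }
  rewrite <- Cmod_pow, <- Cf. rewrite <- (Rmean_scal _ _ CU).
  apply Cmod_Cmean_le.
  - intros t. apply clim_mult; [apply pcont_cauchy_kernel; lra | apply HP].
  - apply ex_RInt_all. intros t.
    apply (continuous_mult (K := R_AbsRing) (fun _ => 6 * 12 ^ N / d)); [apply continuous_const | apply CU].
  - intros t. assert (Nc := circ_neq_0 rho t Pr). assert (Ns := circ_sub_neq_0 rho t zeta (proj1 Hr)).
    assert (Zr : Cmod (circ rho t) = rho) by (apply Cmod_circ; lra).
    set (m := Cmod (circ rho t - zeta)). assert (Pm : 0 < m) by now apply Cmod_gt_0.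
    assert (Mk : Cmod (k (circ rho t)) = s * rho / m).
    { unfold k. rewrite Cmod_div, Cmod_R, Rabs_pos_eq by (try apply Nk; lra).
      replace (Cmod (1 - Cconj zeta * circ rho t / RtoC (rho * rho))) with (m / rho); [field; lra |].
      rewrite <- (Cmod_conj (1 - _)). transitivity (Cmod (circ rho t - zeta) / Cmod (circ rho t)); [now rewrite Zr |].
      rewrite <- Cmod_div by exact Nc. f_equal.
      rewrite Cminus_conj, Cdiv_conj, Cmult_conj, Cconj_conj, circ_conj by (auto; lra).
      replace (Cconj 1) with (RtoC 1) by (unfold Cconj, RtoC; simpl; f_equal; ring).
      replace (Cconj (RtoC (rho * rho))) with (RtoC (rho * rho)) by (unfold Cconj, RtoC; simpl; f_equal; ring).
      field. auto. }
    rewrite !Cmod_mult, !Cmod_pow, Mk, Cmod_div, Zr by exact Ns. fold m.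
    set (X := Cmod (circ 1 t - zeta)). assert (PX : 0 <= X) by apply Cmod_ge_0.
    assert (M1 : d / 4 <= m).
    { unfold m. assert (B := Cmod_lower (circ rho t) zeta). rewrite Zr in B. unfold rho in *. lra. }
    assert (M2 : X <= m + d / 4).
    { unfold X, m. assert (B := Cmod_tri_minus (circ 1 t) (circ rho t) zeta).
      assert (D : Cmod (circ 1 t - circ rho t) = d / 4).
      { replace (circ 1 t - circ rho t)%C with (circ (d / 4) t)
          by (unfold circ, Cminus, Cplus, Copp, rho; simpl; f_equal; field).
        apply Cmod_circ. lra. }
      lra. }
    (* Since d <= 4m and X <= m + d/4, the sum d + X is at most 6m. The constant 12 then arises from
       s rho <= 2d. *)
    assert (M3 : / m <= 6 * / (d + X)).
    { apply Rmult_le_reg_r with (m * (d + X)); [apply Rmult_lt_0_compat; lra |].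
      replace (/ m * (m * (d + X))) with (d + X) by (field; lra).
      replace (6 * / (d + X) * (m * (d + X))) with (6 * m) by (field; lra). lra. }
    assert (PI1 : 0 < / m) by now apply Rinv_0_lt_compat.
    assert (Q1 : rho / m <= 6 / d).
    { apply Rle_trans with (1 * (6 * / (d + X))).
      - apply Rmult_le_compat; lra.
      - rewrite Rmult_1_l. apply Rmult_le_compat_l; [lra |]. apply Rinv_le_contravar; lra. }
    assert (Q2 : s * rho / m <= 12 * (d / (d + X))).
    { apply Rle_trans with (2 * d * (6 * / (d + X))); [| apply Req_le; unfold Rdiv; ring].
      apply Rmult_le_compat; try lra. apply Rmult_le_pos; lra. }
    assert (Q3 : (s * rho / m) ^ N <= 12 ^ N * (d / (d + X)) ^ N).
    { rewrite <- Rpow_mult_distr. apply pow_incr. split; [| exact Q2].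
      apply Rmult_le_pos; [apply Rmult_le_pos; lra | lra]. }
    assert (Pg := pow2_ge_0 (Cmod (g (circ rho t)))).
    assert (Q4 : 0 <= (s * rho / m) ^ N).
    { apply pow_le. apply Rmult_le_pos; [apply Rmult_le_pos; lra | lra]. }
    assert (Q5 : 0 <= rho / m) by (apply Rmult_le_pos; lra).
    replace (6 * 12 ^ N / d * (Cmod (g (circ rho t)) ^ 2 * (d / (d + X)) ^ N))
      with (6 / d * (Cmod (g (circ rho t)) ^ 2 * (12 ^ N * (d / (d + X)) ^ N))) by (unfold Rdiv; ring).
    apply Rmult_le_compat; [exact Q5 | apply Rmult_le_pos; assumption | exact Q1 |].
    apply Rmult_le_compat_l; assumption.
Qed.

Lemma Rmean_le_per (u v : R -> R) : (forall t, continuous u t) -> (forall t, continuous v t) ->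
  (forall t, 0 <= t <= 2 * PI -> u t <= v t) -> Rmean u <= Rmean v.
Proof.
  intros Hu Hv L. assert (PP := two_PI_pos). unfold Rmean. apply Rmult_le_compat_r.
  - left. now apply Rinv_0_lt_compat.
  - apply RInt_le; [lra | now apply ex_RInt_all | now apply ex_RInt_all |]. intros t Ht. apply L. lra.
Qed.

Lemma dyadic_scale (x : R) (J : nat) : (/ 2) ^ J <= x -> x <= 1 ->
  exists j, (j <= J)%nat /\ (/ 2) ^ j / 2 < x <= (/ 2) ^ j.
Proof.
  induction J as [| J IH]; intros L U.
  - exists O. simpl in *. split; [lia | lra].
  - destruct (Rle_lt_dec ((/ 2) ^ J) x) as [K | K].
    + destruct (IH K U) as [j [Hj B]]. exists j. split; [lia | exact B].
    + destruct (Req_dec x ((/ 2) ^ S J)) as [E | E].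
      * exists (S J). assert (P : 0 < (/ 2) ^ S J) by (apply pow_lt; lra). split; [lia | lra].
      * exists J. simpl in *. split; [lia | lra].
Qed.

Fixpoint rsum (f : nat -> R) (J : nat) : R :=
  match J with O => f O | S J => rsum f J + f (S J) end.

Lemma rsum_le (f g : nat -> R) (J : nat) : (forall j, f j <= g j) -> rsum f J <= rsum g J.
Proof. intros H. induction J as [| J IH]; simpl; [apply H |]. specialize (H (S J)). lra. Qed.

Lemma rsum_term (f : nat -> R) (J j : nat) : (forall j, 0 <= f j) -> (j <= J)%nat -> f j <= rsum f J.
Proof.
  intros H. induction J as [| J IH]; intros L; simpl.
  - replace j with O by lia. lra.
  - assert (P : 0 <= rsum f J).
    { clear IH L. induction J as [| J IH]; simpl; [apply H |]. specialize (H (S J)). lra. }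
    destruct (Nat.eq_dec j (S J)) as [-> | N]; [lra |].
    specialize (IH ltac:(lia)). specialize (H (S J)). lra.
Qed.

Lemma continuous_rsum (F : nat -> R -> R) (J : nat) (t : R) : (forall j, continuous (F j) t) ->
  continuous (fun t => rsum (fun j => F j t) J) t.
Proof.
  intros H. induction J as [| J IH]; simpl; [apply H |].
  apply (continuous_plus (V := R_NormedModule) (fun t => rsum (fun j => F j t) J)); [exact IH | apply H].
Qed.

Lemma Rmean_rsum (F : nat -> R -> R) (J : nat) : (forall j t, continuous (F j) t) ->
  Rmean (fun t => rsum (fun j => F j t) J) = rsum (fun j => Rmean (F j)) J.
Proof.
  intros H. induction J as [| J IH]; simpl; [reflexivity |]. rewrite <- IH.
  rewrite (Rmean_ext _ (fun t => 1 * rsum (fun j => F j t) J + 1 * F (S J) t)) by (intros; ring).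
  assert (EL := Rmean_lin (fun t => rsum (fun j => F j t) J) (F (S J))
    (fun t => continuous_rsum F J t (fun j => H j t)) (H (S J)) 1 1).
  cbv beta in EL. rewrite EL. ring.
Qed.

Lemma rsum_scal (c : R) (f : nat -> R) (J : nat) : rsum (fun j => c * f j) J = c * rsum f J.
Proof. induction J as [| J IH]; simpl; [reflexivity | rewrite IH; ring]. Qed.

(* Fubini turns the pointwise estimate at each dyadic distance from the circle into the
   Carleson bound for the kernel. *)
Lemma mean2_comp_le (phi g : C -> C) (n : nat) (C2 r : R) : self_map_D phi -> holomorphic_on_D g -> 0 < r < 1 ->
  (forall xi j, Cmod xi = 1 ->
    Rmean (fun t => ((/ 2) ^ j / ((/ 2) ^ j + Cmod (xi - phi (circ r t)))) ^ (2 * (2 * n + 1)))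
    <= C2 * ((/ 2) ^ j) ^ (2 * n + 1)) ->
  exists J, mean2 (fun z => g (phi z)) r <= 6 * 12 ^ (2 * (2 * n + 1)) * C2 *
    rsum (fun j => ((/ 2) ^ j) ^ (2 * n) * mean2 g (1 - (/ 2) ^ j / 4)) J.
Proof.
  intros SM Hg Hr CK. assert (PP := two_PI_pos). set (N := (2 * (2 * n + 1))%nat) in *.
  assert (PC : forall t, pcont (fun t => phi (circ r t)) t) by (apply (holo_pcont phi); [apply SM | lra]).
  assert (Sm : forall t, Cmod (phi (circ r t)) < 1).
  { intros t. apply SM. unfold inD. rewrite Cmod_circ; lra. }
  (* On a fixed circle |phi| attains a maximum below 1, so finitely many dyadic scales occur; the
     final bound does not depend on their number. *)
  destruct (continuity_ab_maj (fun t => Cmod (phi (circ r t))) 0 (2 * PI)) as [tm [Hm _]].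
  { lra. } { intros t _. apply continuity_pt_filterlim. apply (clim_Cmod _ _ (PC t)). }
  destruct (pow_lt_1_zero (/ 2) ltac:(rewrite Rabs_pos_eq; lra) (1 - Cmod (phi (circ r tm)))) as [J HJ].
  { specialize (Sm tm). lra. }
  specialize (HJ J (Nat.le_refl J)). rewrite Rabs_pos_eq in HJ by (apply pow_le; lra).
  exists J.
  assert (Pd : forall j, 0 < (/ 2) ^ j <= 1).
  { intros j. split; [apply pow_lt; lra |].
    apply pow_le_one; lra. }
  set (F := fun j t a => Cmod (g (circ (1 - (/ 2) ^ j / 4) a)) ^ 2
               * ((/ 2) ^ j / ((/ 2) ^ j + Cmod (circ 1 a - phi (circ r t)))) ^ N).
  assert (CF : forall j, cont2 (F j)).
  { intros j t a. unfold F. specialize (Pd j).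
    eapply (filterlim_comp_2 (G := locally (Cmod (g (circ (1 - (/ 2) ^ j / 4) a)) ^ 2))
      (H := locally (((/ 2) ^ j / ((/ 2) ^ j + Cmod (circ 1 a - phi (circ r t)))) ^ N))).
    - apply (filterlim_comp _ _ _ (fun z : R * R => Cmod (g (circ (1 - (/ 2) ^ j / 4) (snd z)))) (fun x => x ^ 2) _
        (locally (Cmod (g (circ (1 - (/ 2) ^ j / 4) a))))).
      + apply (clim_Cmod (fun z : R * R => g (circ (1 - (/ 2) ^ j / 4) (snd z)))).
        apply (clim_comp g); [apply holo_cont; [exact Hg | rewrite Cmod_circ; lra] |].
        apply clim_circ; [apply filterlim_const | apply (continuous_snd (t : R_UniformSpace) (a : R_UniformSpace))].
      + apply (ex_derive_continuous (V := R_NormedModule) (fun x : R => x ^ 2)). auto_derive. exact I.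
    - apply (filterlim_comp _ _ _ (fun z : R * R => Cmod (circ 1 (snd z) - phi (circ r (fst z))))
        (fun x => ((/ 2) ^ j / ((/ 2) ^ j + x)) ^ N) _ (locally (Cmod (circ 1 a - phi (circ r t))))).
      + apply (clim_Cmod (fun z : R * R => circ 1 (snd z) - phi (circ r (fst z)))%C). apply clim_minus.
        * apply clim_circ; [apply filterlim_const | apply (continuous_snd (t : R_UniformSpace) (a : R_UniformSpace))].
        * apply (clim_comp phi); [apply holo_cont; [apply SM | rewrite Cmod_circ; lra] |].
          apply clim_circ; [apply filterlim_const | apply (continuous_fst (t : R_UniformSpace) (a : R_UniformSpace))].
      + assert (X := Cmod_ge_0 (circ 1 a - phi (circ r t))).
        apply (ex_derive_continuous (V := R_NormedModule) (fun x : R => ((/ 2) ^ j / ((/ 2) ^ j + x)) ^ N)).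
        auto_derive. lra.
    - apply (filterlim_mult (K := R_AbsRing)). }
  set (E := 6 * 12 ^ N).
  assert (PE : 0 < E) by (unfold E; apply Rmult_lt_0_compat; [lra | apply pow_lt; lra]).
  assert (PRm : forall j t, 0 <= Rmean (F j t)).
  { intros j t. rewrite <- (Rmean_const 0). apply Rmean_le.
    - intros; apply continuous_const.
    - intros a. now apply cont2_r.
    - intros a. unfold F. apply Rmult_le_pos; [apply pow2_ge_0 |].
      apply kernel_pos; [apply Pd | apply Cmod_ge_0]. }
  assert (CR : forall j t, continuous (fun t => E / (/ 2) ^ j * Rmean (F j t)) t).
  { intros j t. apply (continuous_mult (K := R_AbsRing) (fun _ => E / (/ 2) ^ j)); [apply continuous_const |].
    now apply continuous_Rmean_param. }
  unfold mean2. change (Rmean (fun t => Cmod (g (phi (circ r t))) ^ 2) <=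
    E * C2 * rsum (fun j => ((/ 2) ^ j) ^ (2 * n) * mean2 g (1 - (/ 2) ^ j / 4)) J).
  apply Rle_trans with (Rmean (fun t => rsum (fun j => E / (/ 2) ^ j * Rmean (F j t)) J)).
  - apply Rmean_le_per.
    + intros t. apply (continuous_comp (fun t => Cmod (g (phi (circ r t)))) (fun x => x ^ 2)).
      * apply (clim_Cmod (fun t => g (phi (circ r t)))). apply (clim_comp g); [now apply holo_cont | apply PC].
      * apply (ex_derive_continuous (V := R_NormedModule)). auto_derive. exact I.
    + intros t. apply (continuous_rsum (fun j t => E / (/ 2) ^ j * Rmean (F j t))). intros j. apply CR.
    + intros t Ht. assert (Pz := Cmod_ge_0 (phi (circ r t))). specialize (Hm t Ht).
      destruct (dyadic_scale (1 - Cmod (phi (circ r t))) J) as [j [Hj B]]; [lra | lra |].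
      eapply Rle_trans; [apply (pointwise_kernel g N ((/ 2) ^ j) (phi (circ r t)) Hg (Pd j) B) |].
      apply (rsum_term (fun j => E / (/ 2) ^ j * Rmean (F j t)) J j); [| exact Hj].
      intros i. apply Rmult_le_pos; [| apply PRm]. left. apply Rdiv_lt_0_compat; [exact PE | apply Pd].
  - rewrite (Rmean_rsum (fun j t => E / (/ 2) ^ j * Rmean (F j t))) by exact CR.
    rewrite <- rsum_scal. apply rsum_le. intros j. specialize (Pd j).
    assert (ES := Rmean_scal _ (E / (/ 2) ^ j) (fun t => continuous_Rmean_param (F j) t (CF j))). cbv beta in ES.
    (* After the exchange the inner mean is the kernel mean at the boundary point [circ 1 a], of
       order d^(2n+1); one power of d cancels the factor 1/d of the pointwise estimate. *)
    eapply Rle_trans; [apply Req_le; eapply eq_trans; [exact ES | apply f_equal; exact (Rmean_fubini (F j) (CF j))] |].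
    assert (Pdn : 0 < ((/ 2) ^ j) ^ (2 * n)) by (apply pow_lt; lra).
    assert (CA : forall a, continuous (fun a => Cmod (g (circ (1 - (/ 2) ^ j / 4) a)) ^ 2) a).
    { intros a. apply (continuous_comp (fun a => Cmod (g (circ (1 - (/ 2) ^ j / 4) a))) (fun x => x ^ 2)).
      - apply (clim_Cmod (fun a => g (circ (1 - (/ 2) ^ j / 4) a))). apply (holo_pcont g); [exact Hg | lra].
      - apply (ex_derive_continuous (V := R_NormedModule)). auto_derive. exact I. }
    assert (B : Rmean (fun a => Rmean (fun t => F j t a)) <= C2 * ((/ 2) ^ j) ^ (2 * n + 1) * mean2 g (1 - (/ 2) ^ j / 4)).
    { unfold mean2.
      change (RInt _ 0 (2 * PI) / (2 * PI)) with (Rmean (fun a => Cmod (g (circ (1 - (/ 2) ^ j / 4) a)) ^ 2)).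
      rewrite <- (Rmean_scal _ _ CA). apply Rmean_le.
      - intros a. apply (continuous_Rmean_param (fun a t => F j t a)). now apply cont2_swap.
      - intros a. apply (continuous_mult (K := R_AbsRing) (fun _ => C2 * ((/ 2) ^ j) ^ (2 * n + 1))); [apply continuous_const | apply CA].
      - intros a. unfold F.
        assert (CKn : forall t, continuous (fun t => ((/ 2) ^ j / ((/ 2) ^ j + Cmod (circ 1 a - phi (circ r t)))) ^ N) t).
        { intros t. apply (continuous_kernel ((/ 2) ^ j) N (fun t => Cmod (circ 1 a - phi (circ r t)))); [lra | intros; apply Cmod_ge_0 |].
          apply (clim_Cmod (fun t => circ 1 a - phi (circ r t))%C). apply clim_minus; [apply clim_const | apply PC]. }
        rewrite (Rmean_scal _ _ CKn), Rmult_comm. apply Rmult_le_compat_r; [apply pow2_ge_0 |].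
        apply CK. apply Cmod_circ. lra. }
    apply Rle_trans with (E / (/ 2) ^ j * (C2 * ((/ 2) ^ j) ^ (2 * n + 1) * mean2 g (1 - (/ 2) ^ j / 4))).
    + apply Rmult_le_compat_l; [left; apply Rdiv_lt_0_compat; lra | exact B].
    + rewrite Nat.add_1_r. cbn [pow]. apply Req_le. field. lra.
Qed.

(** * A dyadic Littlewood-Paley estimate for the n-th derivative *)

Lemma coef_Cderiv_n_le (f : C -> C) (n k : nat) : holomorphic_on_D f ->
  Cmod (coef (Cderiv_n n f) k) <= INR (k + n) ^ n * Cmod (coef f (k + n)).
Proof.
  intros H. revert k. induction n as [| n IH]; intros k.
  - rewrite Nat.add_0_r. simpl. lra.
  - cbn [Cderiv_n]. rewrite coef_Cderiv by now apply Cderiv_n_holo.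
    rewrite Cmod_mult, Cmod_R, Rabs_pos_eq by apply pos_INR.
    specialize (IH (S k)). replace (S k + n)%nat with (k + S n)%nat in IH by lia.
    assert (P := Cmod_ge_0 (coef f (k + S n))).
    (* The exact factor is the product of k+1 up to k+n; replacing each term by the largest loses
       only a constant in what follows. *)
    assert (L : INR (S k) <= INR (k + S n)) by (apply le_INR; lia).
    assert (P0 := pos_INR (S k)).
    cbn [pow]. rewrite Rmult_assoc. apply Rmult_le_compat; [exact P0 | apply Cmod_ge_0 | exact L | exact IH].
Qed.

Lemma exp_pow_nat (x : R) (m : nat) : exp (INR m * x) = exp x ^ m.
Proof.
  induction m as [| m IH]; [simpl; rewrite Rmult_0_l; apply exp_0 |].
  rewrite S_INR, Rmult_plus_distr_r, exp_plus, IH, Rmult_1_l. simpl. ring.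
Qed.

(** The inequality (1 + t)^m <= exp(m t) at t = y/(2m), whose exponent is then y/2. *)
Lemma two_plus_pow_le (y : R) (m : nat) : 0 <= y -> (1 <= m)%nat ->
  (2 + y) ^ m <= (2 * INR m) ^ m * exp (y / 2).
Proof.
  intros Hy Hm. assert (M1 : 1 <= INR m) by (rewrite <- INR_1; now apply le_INR).
  replace (y / 2) with (INR m * (y / (2 * INR m))) by (field; lra).
  rewrite exp_pow_nat, <- Rpow_mult_distr. apply pow_incr. split; [lra |].
  assert (X := exp_ineq1_le (y / (2 * INR m))).
  apply Rle_trans with (2 * INR m * (1 + y / (2 * INR m))).
  - replace (2 * INR m * (1 + y / (2 * INR m))) with (2 * INR m + y) by (field; lra). lra.
  - apply Rmult_le_compat_l; lra.
Qed.

(** The right side is chosen to telescope when y is halved repeatedly. Its factor y, affordable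
    because n >= 1, gives summability for small y; the exponential absorbs the remaining power (2 +
    y)^(2n+1). *)
Lemma exp_neg_half_bound (y : R) (n : nat) : 0 <= y -> (1 <= n)%nat ->
  y ^ (2 * n) * exp (- (y / 2)) <= (2 * INR (2 * n + 1)) ^ (2 * n + 1) * (y / ((1 + y) * (2 + y))).
Proof.
  intros Hy Hn. assert (A := two_plus_pow_le y (2 * n + 1) Hy ltac:(lia)).
  assert (P := exp_pos (y / 2)). rewrite exp_Ropp.
  set (c := (2 * INR (2 * n + 1)) ^ (2 * n + 1)) in *.
  apply Rmult_le_reg_r with (exp (y / 2) * ((1 + y) * (2 + y))); [apply Rmult_lt_0_compat; nra |].
  replace (y ^ (2 * n) * / exp (y / 2) * (exp (y / 2) * ((1 + y) * (2 + y))))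
    with (y ^ (2 * n) * ((1 + y) * (2 + y))) by (field; lra).
  replace (c * (y / ((1 + y) * (2 + y))) * (exp (y / 2) * ((1 + y) * (2 + y))))
    with (y * (c * exp (y / 2))) by (field; lra).
  apply Rle_trans with (y * (2 + y) ^ (2 * n + 1)); [| now apply Rmult_le_compat_l].
  destruct n as [| n]; [lia |]. replace (2 * S n)%nat with (S (2 * n + 1)) by lia.
  replace (S (2 * n + 1) + 1)%nat with ((2 * n + 1) + 2)%nat by lia.
  cbn [pow]. rewrite Rmult_assoc. apply Rmult_le_compat_l; [exact Hy |].
  rewrite (pow_add (2 + y) (2 * n + 1) 2). apply Rmult_le_compat; [apply pow_le; exact Hy | nra | apply pow_incr; lra |].
  simpl. nra.
Qed.

Definition psi (y : R) : R := y / (1 + y).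

(* y / ((1+y)(2+y)) = psi(y) - psi(y/2), so the sum over dyadic scales telescopes. *)
Lemma rsum_psi_le (Y : R) (J : nat) : 0 <= Y ->
  rsum (fun j => (Y * (/ 2) ^ j) / ((1 + Y * (/ 2) ^ j) * (2 + Y * (/ 2) ^ j))) J <= 1.
Proof.
  intros HY.
  assert (P : forall j, 0 <= Y * (/ 2) ^ j) by (intros j; apply Rmult_le_pos; [exact HY | apply pow_le; lra]).
  assert (T : forall j, (Y * (/ 2) ^ j) / ((1 + Y * (/ 2) ^ j) * (2 + Y * (/ 2) ^ j))
     = psi (Y * (/ 2) ^ j) - psi (Y * (/ 2) ^ S j)).
  { intros j. specialize (P j). cbn [pow]. unfold psi.
    replace (Y * (/ 2 * (/ 2) ^ j)) with (Y * (/ 2) ^ j / 2) by field. set (y := Y * (/ 2) ^ j) in *.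
    field. lra. }
  assert (S : rsum (fun j => (Y * (/ 2) ^ j) / ((1 + Y * (/ 2) ^ j) * (2 + Y * (/ 2) ^ j))) J
     = psi Y - psi (Y * (/ 2) ^ S J)).
  { induction J as [| J IH]; cbn [rsum].
    - rewrite T. cbn [pow]. rewrite Rmult_1_r. reflexivity.
    - rewrite IH, T. ring. }
  rewrite S. specialize (P (Datatypes.S J)). set (y := Y * (/ 2) ^ Datatypes.S J) in *.
  assert (A : 0 <= psi y) by (apply Rdiv_le_0_compat; lra).
  assert (B : psi Y <= 1).
  { unfold psi. apply -> Rdiv_le_1; lra. }
  lra.
Qed.

(** With x = 2^-j and y = (k + n) x, the radial factor (1 - x/4)^(2k) is at most exp(-k x/2) <=
    exp(n/2) exp(-y/2), because k = (k + n) - n and x <= 1. The bound depends on neither k nor J, so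
    it applies to all coefficients at once. *)
Lemma dyadic_coef_sum (n k J : nat) : (1 <= n)%nat ->
  rsum (fun j => ((/ 2) ^ j) ^ (2 * n) * (INR (k + n) ^ n) ^ 2 * ((1 - (/ 2) ^ j / 4) ^ 2) ^ k) J
  <= exp (INR n / 2) * (2 * INR (2 * n + 1)) ^ (2 * n + 1).
Proof.
  intros Hn. set (Y := INR (k + n)). assert (HY : 0 <= Y) by apply pos_INR.
  set (c := (2 * INR (2 * n + 1)) ^ (2 * n + 1)).
  assert (Pc : 0 <= c).
  { apply pow_le. apply Rmult_le_pos; [lra | apply pos_INR]. }
  assert (Pe := exp_pos (INR n / 2)).
  apply Rle_trans with (rsum (fun j => (exp (INR n / 2) * c) * ((Y * (/ 2) ^ j) / ((1 + Y * (/ 2) ^ j) * (2 + Y * (/ 2) ^ j)))) J).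
  - apply rsum_le. intros j. set (x := (/ 2) ^ j).
    assert (Px : 0 < x <= 1).
    { unfold x. split; [apply pow_lt; lra |].
      apply pow_le_one; lra. }
    set (y := Y * x). assert (Py : 0 <= y) by (apply Rmult_le_pos; lra).
    assert (B := exp_neg_half_bound y n Py Hn). fold c in B.
    replace (x ^ (2 * n) * (Y ^ n) ^ 2) with (y ^ (2 * n))
      by (unfold y; rewrite Rpow_mult_distr, <- pow_mult; replace (n * 2)%nat with (2 * n)%nat by lia; ring).
    assert (E : ((1 - x / 4) ^ 2) ^ k <= exp (INR n / 2) * exp (- (y / 2))).
    { rewrite <- exp_plus. apply Rle_trans with (exp (- (x / 2)) ^ k).
      - apply pow_incr. split; [apply pow2_ge_0 |].
        replace (- (x / 2)) with (INR 2 * (- (x / 4))) by (simpl; field). rewrite exp_pow_nat.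
        apply pow_incr. split; [lra |]. assert (X := exp_ineq1_le (- (x / 4))). lra.
      - rewrite <- exp_pow_nat. assert (Q : INR k * - (x / 2) <= INR n / 2 + - (y / 2)).
        { unfold y, Y. rewrite plus_INR. assert (Pn := pos_INR n). nra. }
        destruct Q as [Q | ->]; [left; now apply exp_increasing | lra]. }
    apply Rle_trans with (y ^ (2 * n) * (exp (INR n / 2) * exp (- (y / 2)))).
    + apply Rmult_le_compat_l; [now apply pow_le | exact E].
    + replace (y ^ (2 * n) * (exp (INR n / 2) * exp (- (y / 2))))
        with (exp (INR n / 2) * (y ^ (2 * n) * exp (- (y / 2)))) by ring.
      rewrite Rmult_assoc. apply Rmult_le_compat_l; [lra | exact B].
  - rewrite rsum_scal. rewrite <- (Rmult_1_r (exp (INR n / 2) * c)) at 2.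
    apply Rmult_le_compat_l; [apply Rmult_le_pos; lra | now apply rsum_psi_le].
Qed.

(** At radius 1 the function itself has no mean, but the finite sum is a polynomial in r, so the
    inequality passes to the limit. *)
Lemma parseval_sum_limit (f : C -> C) (L : R) (K : nat) : H2_norm2 f L -> parseval_sum f 1 K <= L.
Proof.
  intros HL.
  assert (Ct : continuous (fun r => parseval_sum f r K) 1).
  { induction K as [| K IH]; cbn [parseval_sum]; [apply continuous_const |].
    apply (continuous_plus (V := R_NormedModule) (fun r => parseval_sum f r K)); [exact IH |].
    apply (ex_derive_continuous (V := R_NormedModule)). auto_derive. exact I. }
  apply (filterlim_le (F := at_left 1) (fun r => parseval_sum f r K) (fun _ => L) (parseval_sum f 1 K) L).
  - generalize (at_left_1_near 1 Rlt_0_1). apply filter_imp. intros r Hr.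
    eapply Rle_trans; [apply parseval_sum_le_mean2; [apply HL | lra] |].
    apply (mean2_le_norm2 f L r HL). lra.
  - intros P HP. specialize (Ct P HP). destruct Ct as [d D]. exists d. intros y Y _. now apply D.
  - apply filterlim_const.
Qed.

(** Induction on the number of coefficients exchanges the two finite sums. The coefficient of index
    K of f^(n) is paid for by that of index K + n of f, hence the shift. *)
Lemma dyadic_parseval (f : C -> C) (n K J : nat) : holomorphic_on_D f -> (1 <= n)%nat ->
  rsum (fun j => ((/ 2) ^ j) ^ (2 * n) * parseval_sum (Cderiv_n n f) (1 - (/ 2) ^ j / 4) K) J
  <= exp (INR n / 2) * (2 * INR (2 * n + 1)) ^ (2 * n + 1) * parseval_sum f 1 (K + n).
Proof.
  intros H Hn. set (c := exp (INR n / 2) * (2 * INR (2 * n + 1)) ^ (2 * n + 1)).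
  assert (Pc : 0 <= c).
  { apply Rmult_le_pos; [left; apply exp_pos |]. apply pow_le, Rmult_le_pos; [lra | apply pos_INR]. }
  induction K as [| K IH].
  - rewrite (Rle_antisym (rsum _ J) 0).
    + apply Rmult_le_pos; [exact Pc |]. change 0 with (parseval_sum f 1 0) at 1.
      rewrite <- (Nat.add_0_r (0 + n)). apply parseval_sum_incr.
    + rewrite <- (Rmult_0_l (rsum (fun _ => 0) J)), <- rsum_scal. apply rsum_le. intros j. simpl. lra.
    + rewrite <- (Rmult_0_l (rsum (fun _ => 0) J)), <- rsum_scal. apply rsum_le. intros j. simpl. lra.
  - change (S K + n)%nat with (S (K + n)). cbn [parseval_sum].
    replace ((1 ^ 2) ^ (K + n)) with 1 by (rewrite !pow1; reflexivity). rewrite Rmult_1_r.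
    assert (D := dyadic_coef_sum n K J Hn). fold c in D.
    assert (B : rsum (fun j => ((/ 2) ^ j) ^ (2 * n) * (Cmod (coef (Cderiv_n n f) K) ^ 2 * ((1 - (/ 2) ^ j / 4) ^ 2) ^ K)) J
      <= c * Cmod (coef f (K + n)) ^ 2).
    { apply Rle_trans with (Cmod (coef f (K + n)) ^ 2 *
        rsum (fun j => ((/ 2) ^ j) ^ (2 * n) * (INR (K + n) ^ n) ^ 2 * ((1 - (/ 2) ^ j / 4) ^ 2) ^ K) J).
      - rewrite <- rsum_scal. apply rsum_le. intros j.
        assert (A := coef_Cderiv_n_le f n K H).
        assert (A2 : Cmod (coef (Cderiv_n n f) K) ^ 2 <= (INR (K + n) ^ n * Cmod (coef f (K + n))) ^ 2)
          by (apply pow_incr; split; [apply Cmod_ge_0 | exact A]).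
        rewrite Rpow_mult_distr in A2.
        assert (W : 0 <= ((/ 2) ^ j) ^ (2 * n) * ((1 - (/ 2) ^ j / 4) ^ 2) ^ K)
          by (apply Rmult_le_pos; [apply pow_le, pow_le; lra | apply pow_le, pow2_ge_0]).
        nra.
      - rewrite Rmult_comm. apply Rmult_le_compat_r; [apply pow2_ge_0 | exact D]. }
    assert (Sp : forall u v : nat -> R, rsum (fun j => u j + v j) J = rsum u J + rsum v J).
    { intros u v. clear. induction J as [| J IH]; simpl; [reflexivity | rewrite IH; ring]. }
    assert (E : rsum (fun j => ((/ 2) ^ j) ^ (2 * n) * (parseval_sum (Cderiv_n n f) (1 - (/ 2) ^ j / 4) K
              + Cmod (coef (Cderiv_n n f) K) ^ 2 * ((1 - (/ 2) ^ j / 4) ^ 2) ^ K)) J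
       = rsum (fun j => ((/ 2) ^ j) ^ (2 * n) * parseval_sum (Cderiv_n n f) (1 - (/ 2) ^ j / 4) K) J
         + rsum (fun j => ((/ 2) ^ j) ^ (2 * n) * (Cmod (coef (Cderiv_n n f) K) ^ 2 * ((1 - (/ 2) ^ j / 4) ^ 2) ^ K)) J).
    { rewrite <- Sp. apply Rle_antisym; apply rsum_le; intros j; apply Req_le; ring. }
    rewrite E. lra.
Qed.

(** The left side is a dyadic version of the integral of (1 - r)^(2n-1) times the circle mean of
    |f^(n)|^2. Letting the number of coefficients grow at fixed J turns the partial sums into these
    means. *)
Lemma dyadic_littlewood_paley (f : C -> C) (n J : nat) (L : R) : H2_norm2 f L -> (1 <= n)%nat ->
  rsum (fun j => ((/ 2) ^ j) ^ (2 * n) * mean2 (Cderiv_n n f) (1 - (/ 2) ^ j / 4)) J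
  <= exp (INR n / 2) * (2 * INR (2 * n + 1)) ^ (2 * n + 1) * L.
Proof.
  intros HL Hn. assert (H := proj1 HL). set (c := exp (INR n / 2) * (2 * INR (2 * n + 1)) ^ (2 * n + 1)).
  assert (Pc : 0 <= c).
  { apply Rmult_le_pos; [left; apply exp_pos |]. apply pow_le, Rmult_le_pos; [lra | apply pos_INR]. }
  assert (Lim : is_lim_seq (fun K => rsum (fun j => ((/ 2) ^ j) ^ (2 * n) * parseval_sum (Cderiv_n n f) (1 - (/ 2) ^ j / 4) K) J)
     (rsum (fun j => ((/ 2) ^ j) ^ (2 * n) * mean2 (Cderiv_n n f) (1 - (/ 2) ^ j / 4)) J)).
  { assert (T : forall j, is_lim_seq (fun K => ((/ 2) ^ j) ^ (2 * n) * parseval_sum (Cderiv_n n f) (1 - (/ 2) ^ j / 4) K)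
       (((/ 2) ^ j) ^ (2 * n) * mean2 (Cderiv_n n f) (1 - (/ 2) ^ j / 4))).
    { intros j. assert (Px : 0 < (/ 2) ^ j <= 1).
      { split; [apply pow_lt; lra |]. apply pow_le_one; lra. }
      apply (is_lim_seq_scal_l _ (((/ 2) ^ j) ^ (2 * n)) (mean2 (Cderiv_n n f) (1 - (/ 2) ^ j / 4))).
      apply parseval_approx; [now apply Cderiv_n_holo | lra]. }
    induction J as [| J IH]; cbn [rsum]; [apply T |]. apply is_lim_seq_plus'; [exact IH | apply T]. }
  apply (is_lim_seq_le _ (fun _ => c * L) (rsum (fun j => ((/ 2) ^ j) ^ (2 * n) * mean2 (Cderiv_n n f) (1 - (/ 2) ^ j / 4)) J) (c * L)) with (2 := Lim).
  - intros K. eapply Rle_trans; [apply (dyadic_parseval f n K J H Hn) |].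
    apply Rmult_le_compat_l; [exact Pc | now apply parseval_sum_limit].
  - apply is_lim_seq_const.
Qed.

Theorem sufficiency (phi : C -> C) (n : nat) : self_map_D phi -> (1 <= n)%nat -> N_bigO phi n -> bounded_on_H2 phi n.
Proof.
  intros SM Hn HN. destruct (carleson_kernel phi n SM HN) as (C2 & HC2 & CK).
  set (E := 6 * 12 ^ (2 * (2 * n + 1)) * C2).
  assert (PE : 0 < E) by (unfold E; repeat apply Rmult_lt_0_compat; try lra; apply pow_lt; lra).
  exists (E * (exp (INR n / 2) * (2 * INR (2 * n + 1)) ^ (2 * n + 1))).
  intros f L HL. assert (H := proj1 HL). assert (HD := Cderiv_n_holo f n H).
  apply norm2_exists.
  - apply (cder_holo_comp (Cderiv_n n f)); assumption.
  - intros r Hr.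
    destruct (mean2_comp_le phi (Cderiv_n n f) n C2 r SM HD Hr) as [J B].
    { intros xi j Hxi. now apply CK. }
    eapply Rle_trans; [exact B |]. fold E. rewrite (Rmult_assoc E).
    apply Rmult_le_compat_l; [lra |]. now apply dyadic_littlewood_paley.
Qed.

Theorem theorem2p1 (phi : C -> C) (n : nat) :
  self_map_D phi -> (1 <= n)%nat ->
  (bounded_on_H2 phi n <-> N_bigO phi n).
Proof.
  intros SM Hn. split.
  - now apply necessity.
  - now apply sufficiency.
Qed.
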